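(* Let $e=\min\{i\ge 2 : \ell \mid \frac{q^i-1}{q-1}\}$, $d=\nu_\ell\big(\frac{q^e-1}{q-1}\big)$, and $m=\max\{i\ge 0 : \ell^i\le\lfloor n/e\rfloor\}$ (with $m=0$ if $n<e$). Assume that $\lfloor n/e\rfloor\le d\ell$ if $d\le\ell$; that $\lfloor n/e\rfloor\le\ell^2$ if $d=\ell+1$; and that $\lfloor n/e\rfloor<\ell^2+\ell$ if $d>\ell+1$. Then: (a) $c(L)=V=|\mathcal P^*|=\lfloor n/e\rfloor+1$ if $m=0$. (b) $c(L)=V=|\mathcal P^*|=(x_1+1)\big(\frac{x_1}{2}\ell+x_0+1\big)$ if $m=1$ and $\lfloor n/e\rfloor=x_1\ell+x_0$ is the base-$\ell$ expansion. (c) $c(L)=V=|\mathcal P^*|=\frac12\ell^3+\frac12\ell^2+(x_0+1)\ell+2(x_0+1)$ if $m=2$ and $\lfloor n/e\rfloor=\ell^2+x_0$ with $0\le x_0<\ell$ (i.e. base-$\ell$ digits $(1,0,x_0)$).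
   Context: Let $n\ge 2$ and $G=\mathrm{GL}_n(q)$, the general linear group over the finite field $F_q$ of characteristic $p$. Let $\ell\ne p$ be a prime, and let $R$ be a local principal ideal domain of characteristic $0$ with maximal ideal $\ell R$, containing a primitive $p$-th root of unity; $K=R/\ell R$. $\nu_\ell$ denotes the $\ell$-adic valuation of integers. $B$ is the group of upper triangular matrices in $G$; $S_n$ is viewed as the subgroup of permutation matrices of $G$; $\widehat{S}=\sum_{s\in S}s\in RG$ for $S\subseteq G$. Put $\varepsilon=\sum_{\sigma\in S_n}\mathrm{sg}(\sigma)\,\sigma\widehat{B}\in RG$. The Steinberg lattice is the left ideal $I=RG\cdot\varepsilon$, and $L=I/\ell I$, a $KG$-module. $c(L)$ is the composition length of $L$. $\mathcal P$ is the set of standard parabolic subgroups (subgroups of $G$ containing $B$), and $V$ is the number of distinct integers of the form $\nu_\ell([G:P])$ with $P\in\mathcal P$. A composition $(a_1,\dots,a_k)$ of $n$ is identified with the block upper triangular subgroup with diagonal blocks of sizes $a_1,\dots,a_k$; this gives a bijection between compositions of $n$ and $\mathcal P$. $\mathcal P^*$ is the set of $P\in\mathcal P$ whose composition is nondecreasing with every part equal to $1$ or of the form $e\ell^i$, $i\ge 0$ (so $\mathcal P^*$ corresponds to partitions of $n$ with such parts). *)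

(* Defs.v *)
Set Warnings "-notation-overridden,-ambiguous-paths".
Set Warnings "-redundant-canonical-projection,-projection-no-head-constant".
From HB Require Import structures.
From mathcomp Require Import all_boot all_order all_algebra all_fingroup.
From mathcomp Require Import ring_quotient generic_quotient.
From mathcomp Require Import boolp.

Set Implicit Arguments.
Unset Strict Implicit.
Unset Printing Implicit Defensive.

Import GRing.Theory.
Local Open Scope ring_scope.
Local Open Scope quotient_scope.

(* [idealr_closed] is the library's closure condition for proper ideals. *)
Definition maximal_ideal (R : comNzRingType) (J : {pred R}) : Prop :=
  idealr_closed J /\
  forall J' : {pred R}, idealr_closed J' -> {subset J <= J'} -> J' =i J.

Definition local_with_maximal_ideal (R : comNzRingType) (J : {pred R}) : Prop :=
  forall J' : {pred R}, maximal_ideal J' <-> J' =i J.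

(* Ideals are the submodules of the regular module [R^o]. *)
Definition principal_ideal_domain (R : idomainType) : Prop :=
  forall J : {pred R^o}, submod_closed J ->
    exists a : R, forall x : R, x \in J <-> exists r, x = r * a.

(* The subgroup lV of an additive group V.  It is the ideal lR when V = R is a
   commutative ring, and the submodule lM when V = M is a module. *)
Definition multiples (l : nat) (V : zmodType) : {pred V} :=
  fun x => `[< exists y : V, x = y *+ l >].
Arguments multiples : clear implicits.

Fact multiplesP l (V : zmodType) (x : V) :
  reflect (exists y : V, x = y *+ l) (x \in multiples l V).
Proof. exact: asboolP. Qed.

Fact multiples_zmod_closed l (V : zmodType) : zmod_closed (multiples l V).
Proof.
split; first by apply/multiplesP; exists 0; rewrite mul0rn.
move=> x y /multiplesP[x' ->] /multiplesP[y' ->].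
by apply/multiplesP; exists (x' - y'); rewrite mulrnBl.
Qed.
HB.instance Definition _ l (V : zmodType) :=
  GRing.isZmodClosed.Build V (multiples l V) (multiples_zmod_closed l V).

Fact pi_multiplesP l (V : zmodType) (x y : V) :
  \pi_({ideal_quot multiples l V}%type) x = \pi_({ideal_quot multiples l V}%type) y
  <-> exists z, x = y + z *+ l.
Proof.
split=> [/eqP|[z ->]].
  rewrite -Quotient.idealrBE => /multiplesP[z e]; exists z.
  by rewrite -e addrC subrK.
apply/eqP; rewrite -Quotient.idealrBE addrC addKr.
by apply/multiplesP; exists z.
Qed.

(* R/lR.  As lR need not be proper for arbitrary l and R, the general structure
   is only that of a possibly zero ring; it is a field when lR is maximal. *)
Definition residue_ring (l : nat) (R : comNzRingType) : Type :=
  {ideal_quot multiples l R}.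

Section ResidueRing.
Variables (l : nat) (R : comNzRingType).
Local Notation K := (residue_ring l R).

HB.instance Definition _ := GRing.Zmodule.on K.

Definition residue (x : R) : K := \pi_({ideal_quot multiples l R}%type) x.
Definition residue_repr (k : K) : R := repr (k : {ideal_quot multiples l R}).

Fact residue_reprK : cancel residue_repr residue.
Proof. exact: reprK. Qed.

Fact residueP (x y : R) : residue x = residue y <-> exists z, x = y + z *+ l.
Proof. exact: pi_multiplesP. Qed.

Fact residue_zmod_morphism : zmod_morphism residue.
Proof. by move=> x y; rewrite /residue raddfB. Qed.
HB.instance Definition _ := GRing.isZmodMorphism.Build R K residue
  residue_zmod_morphism.

Definition residue_one : K := residue 1.
Definition residue_mul (x y : K) : K :=
  residue (residue_repr x * residue_repr y).

Fact residueM x y : residue (x * y) = residue_mul (residue x) (residue y).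
Proof.
rewrite /residue_mul; apply/residueP.
have /residueP[u eu] := esym (residue_reprK (residue x)).
have /residueP[v ev] := esym (residue_reprK (residue y)).
set x' := residue_repr (residue x) in eu *.
set y' := residue_repr (residue y) in ev *.
exists (x' * v + u * y' + u * v *+ l).
by rewrite {1}eu {1}ev mulrDl !mulrDr !mulrnDl !mulrnAr !mulrnAl !addrA.
Qed.

Fact residue_mulA : associative residue_mul.
Proof.
move=> x y z; rewrite -[x]residue_reprK -[y]residue_reprK -[z]residue_reprK.
by rewrite -!residueM mulrA.
Qed.
Fact residue_mulC : commutative residue_mul.
Proof. by move=> x y; rewrite /residue_mul mulrC. Qed.
Fact residue_mul1 : left_id residue_one residue_mul.
Proof. by move=> x; rewrite -[x]residue_reprK -residueM mul1r. Qed.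
Fact residue_mulDl : left_distributive residue_mul +%R.
Proof.
move=> x y z; rewrite -[x]residue_reprK -[y]residue_reprK -[z]residue_reprK.
by rewrite -raddfD -!residueM mulrDl raddfD.
Qed.
HB.instance Definition _ := GRing.Zmodule_isComPzRing.Build K
  residue_mulA residue_mulC residue_mul1 residue_mulDl.

Fact residue_monoid_morphism : monoid_morphism residue.
Proof. by split=> // x y; rewrite residueM. Qed.
HB.instance Definition _ := GRing.isMonoidMorphism.Build R K residue
  residue_monoid_morphism.
End ResidueRing.

Definition group_algebra (R : pzRingType) (gT : finGroupType) : Type :=
  {ffun gT -> R}.

Section GroupAlgebra.
Variables (R : pzRingType) (gT : finGroupType).
Local Notation RG := (group_algebra R gT).

HB.instance Definition _ := GRing.Zmodule.on RG.

Definition ga_coef (a : RG) (g : gT) : R := (a : {ffun gT -> R}) g.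
Definition ga_elt (g : gT) : RG := [ffun h => (h == g)%:R].
Definition ga_one : RG := ga_elt 1%g.
Definition ga_mul (a b : RG) : RG :=
  [ffun g => \sum_h ga_coef a h * ga_coef b (h^-1 * g)%g].

Fact ga_coefP (a b : RG) : ga_coef a =1 ga_coef b <-> a = b.
Proof. by split=> [|->//]; move/ffunP. Qed.

Fact ga_coefD (a b : RG) g : ga_coef (a + b) g = ga_coef a g + ga_coef b g.
Proof. exact: ffunE. Qed.
Fact ga_coefM (a b : RG) g :
  ga_coef (ga_mul a b) g = \sum_h ga_coef a h * ga_coef b (h^-1 * g)%g.
Proof. exact: ffunE. Qed.
Fact ga_coef_elt g h : ga_coef (ga_elt g) h = (h == g)%:R.
Proof. exact: ffunE. Qed.

Fact ga_mulA : associative ga_mul.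
Proof.
move=> a b c; apply/ga_coefP => g; rewrite !ga_coefM.
under eq_bigr do rewrite ga_coefM mulr_sumr.
under [RHS]eq_bigr do rewrite ga_coefM mulr_suml.
rewrite [RHS]exchange_big; apply: eq_bigr => h _ /=.
rewrite [RHS](reindex_inj (mulgI h)); apply: eq_bigr => k _ /=.
by rewrite mulrA mulKg invMg mulgA.
Qed.
Fact ga_mul1l : left_id ga_one ga_mul.
Proof.
move=> a; apply/ga_coefP => g; rewrite ga_coefM (bigD1 1%g) //= big1 => [|h ne].
  by rewrite ga_coef_elt eqxx mul1r invg1 mul1g addr0.
by rewrite ga_coef_elt (negPf ne) mul0r.
Qed.
Fact ga_mul1r : right_id ga_one ga_mul.
Proof.
move=> a; apply/ga_coefP => g; rewrite ga_coefM (bigD1 g) //= big1 => [|h ne].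
  by rewrite ga_coef_elt mulVg eqxx mulr1 addr0.
by rewrite ga_coef_elt -eq_mulVg1 (negPf ne) mulr0.
Qed.
Fact ga_mulDl : left_distributive ga_mul +%R.
Proof.
move=> a b c; apply/ga_coefP => g; rewrite ga_coefD !ga_coefM -big_split /=.
by apply: eq_bigr => h _; rewrite ga_coefD mulrDl.
Qed.
Fact ga_mulDr : right_distributive ga_mul +%R.
Proof.
move=> a b c; apply/ga_coefP => g; rewrite ga_coefD !ga_coefM -big_split /=.
by apply: eq_bigr => h _; rewrite ga_coefD mulrDr.
Qed.
HB.instance Definition _ := GRing.Zmodule_isPzRing.Build RG
  ga_mulA ga_mul1l ga_mul1r ga_mulDl ga_mulDr.

Definition ga_sum (S : {set gT}) : RG := \sum_(g in S) ga_elt g.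
End GroupAlgebra.
Arguments ga_elt R {gT} g.
Arguments ga_sum R {gT} S.

(* A * x as a submodule of the left regular module A^o. *)
Section PrincipalLeftIdeal.
Variables (A : pzRingType) (x : A).

Definition left_ideal_pred : {pred A^o} := fun y => `[< exists a : A, y = a * x >].

Fact left_ideal_submod_closed : submod_closed left_ideal_pred.
Proof.
split; first by apply/asboolP; exists 0; rewrite mul0r.
move=> a _ _ /asboolP[u ->] /asboolP[v ->]; apply/asboolP.
by exists (a * u + v); rewrite mulrDl -mulrA.
Qed.
HB.instance Definition _ := GRing.isSubmodClosed.Build A A^o left_ideal_pred
  left_ideal_submod_closed.

Record left_ideal : Type :=
  LeftIdeal { left_ideal_val :> A^o; _ : left_ideal_val \in left_ideal_pred }.
HB.instance Definition _ := [isSub for left_ideal_val].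
HB.instance Definition _ := [Choice of left_ideal by <:].
HB.instance Definition _ := [SubChoice_isSubLmodule of left_ideal by <:].
End PrincipalLeftIdeal.

(* M/lM as a module over (R/lR)G, for an RG-module M. *)
Definition reduction (l : nat) (R : comNzRingType) (gT : finGroupType)
    (M : lmodType (group_algebra R gT)) : Type :=
  {ideal_quot multiples l M}.

Section Reduction.
Variables (l : nat) (R : comNzRingType) (gT : finGroupType).
Variable M : lmodType (group_algebra R gT).
Local Notation RG := (group_algebra R gT).
Local Notation KG := (group_algebra (residue_ring l R) gT).
Local Notation L := (reduction l M).

HB.instance Definition _ := GRing.Zmodule.on L.

Definition reduce (v : M) : L := \pi_({ideal_quot multiples l M}%type) v.
Definition reduce_repr (v : L) : M := repr (v : {ideal_quot multiples l M}).

Fact reduce_reprK : cancel reduce_repr reduce.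
Proof. exact: reprK. Qed.
Fact reduceP (u v : M) : reduce u = reduce v <-> exists w, u = v + w *+ l.
Proof. exact: pi_multiplesP. Qed.
Fact reduce_zmod_morphism : zmod_morphism reduce.
Proof. by move=> x y; rewrite /reduce raddfB. Qed.
HB.instance Definition _ := GRing.isZmodMorphism.Build M L reduce
  reduce_zmod_morphism.

Definition ga_residue (a : RG) : KG := [ffun g => residue l (ga_coef a g)].
Definition ga_residue_repr (a : KG) : RG :=
  [ffun g => residue_repr (ga_coef a g)].

Fact ga_residue_reprK : cancel ga_residue_repr ga_residue.
Proof.
by move=> a; apply/ffunP => g; rewrite ffunE /ga_coef ffunE residue_reprK.
Qed.

Fact ga_residueP (a b : RG) :
  ga_residue a = ga_residue b -> exists c, a = b + c *+ l.
Proof.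
move=> /ffunP e.
have h g : exists z, ga_coef a g = ga_coef b g + z *+ l.
  by apply/residueP; move: (e g); rewrite !ffunE.
exists [ffun g => projT1 (cid (h g))]; apply/ga_coefP => g.
rewrite ga_coefD (projT2 (cid (h g))); congr (_ + _).
by rewrite /ga_coef ffunMnE !ffunE.
Qed.

Fact ga_residueD a b : ga_residue (a + b) = ga_residue a + ga_residue b.
Proof. by apply/ffunP => g; rewrite !ffunE ga_coefD raddfD. Qed.
Fact ga_residue1 : ga_residue 1 = 1.
Proof. by apply/ffunP => g; rewrite !ffunE ga_coef_elt rmorph_nat. Qed.
Fact ga_residueM a b : ga_residue (a * b) = ga_residue a * ga_residue b.
Proof.
apply/ffunP => g; rewrite !ffunE ga_coefM rmorph_sum; apply: eq_bigr => h _.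
by rewrite rmorphM /= /ga_coef !ffunE.
Qed.

Definition reduction_scale (a : KG) (v : L) : L :=
  reduce (ga_residue_repr a *: reduce_repr v).

Fact reduceZ (a : RG) (v : M) :
  reduce (a *: v) = reduction_scale (ga_residue a) (reduce v).
Proof.
rewrite /reduction_scale; apply/reduceP.
have /ga_residueP[c ec] := esym (ga_residue_reprK (ga_residue a)).
have /reduceP[w ew] := esym (reduce_reprK (reduce v)).
set a' := ga_residue_repr _ in ec *; set v' := reduce_repr _ in ew *.
exists (a' *: w + c *: v).
by rewrite {1}ec scalerDl {1}ew scalerDr mulrnDl scalerMnr scalerMnl addrA.
Qed.

Fact reduction_scaleA a b v :
  reduction_scale a (reduction_scale b v) = reduction_scale (a * b) v.
Proof.
rewrite -[a]ga_residue_reprK -[b]ga_residue_reprK -[v]reduce_reprK.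
by rewrite -ga_residueM -!reduceZ scalerA.
Qed.
Fact reduction_scale1 : left_id 1 reduction_scale.
Proof. by move=> v; rewrite -[v]reduce_reprK -ga_residue1 -reduceZ scale1r. Qed.
Fact reduction_scaleDr : right_distributive reduction_scale +%R.
Proof.
move=> a u v; rewrite -[a]ga_residue_reprK -[u]reduce_reprK -[v]reduce_reprK.
by rewrite -raddfD -!reduceZ scalerDr raddfD.
Qed.
Fact reduction_scaleDl v : {morph reduction_scale^~ v : a b / a + b}.
Proof.
move=> a b; rewrite -[a]ga_residue_reprK -[b]ga_residue_reprK.
by rewrite -[v]reduce_reprK -ga_residueD -!reduceZ scalerDl raddfD.
Qed.
HB.instance Definition _ := GRing.Zmodule_isLmodule.Build KG L
  reduction_scaleA reduction_scale1 reduction_scaleDr reduction_scaleDl.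
End Reduction.

Definition submod_covers (A : pzRingType) (V : lmodType A) (M N : {pred V}) :=
  [/\ submod_closed M /\ submod_closed N, {subset M <= N},
      ~ {subset N <= M}
    & forall X : {pred V}, submod_closed X ->
        {subset M <= X} -> {subset X <= N} -> X =i M \/ X =i N].

(* V has a composition series 0 = f 0 < f 1 < ... < f k = V; by Jordan-Hoelder
   this determines k. *)
Definition has_composition_length (A : pzRingType) (V : lmodType A) (k : nat) :=
  exists f : nat -> {pred V},
    [/\ f 0%N =i pred1 0, f k =i predT
      & forall i : nat, (i < k)%N -> submod_covers (f i) (f i.+1)].

Section GeneralLinear.
Variables (n : nat) (F : finFieldType).
Local Notation G := {'GL_n[F]}.

Definition borel : {set G} :=
  [set g : G | [forall i : 'I_n.-1.+1, forall j : 'I_n.-1.+1,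
     (j < i)%N ==> (GLval g i j == 0)]].

Definition perm_GL (s : 'S_n.-1.+1) : G :=
  FinRing.unit 'M[F]_n.-1.+1 (unitmx_perm F s).

Definition steinberg_elt (R : pzRingType) : group_algebra R G :=
  \sum_(s : 'S_n.-1.+1) (-1) ^+ s * (ga_elt R (perm_GL s) * ga_sum R borel).

Definition steinberg_lattice (R : pzRingType) : lmodType (group_algebra R G) :=
  left_ideal (steinberg_elt R).

Definition standard_parabolics : {set {group G}} :=
  [set P : {group G} | borel \subset P].

Definition num_index_valuations (l : nat) : nat :=
  size (undup [seq logn l #|[set: G] : P|%g | P : {group G} in standard_parabolics]).

Definition is_composition (a : seq nat) : bool :=
  (0%N \notin a) && (sumn a == n).

(* [reshape_index a i] is the index of the block containing row i when the n
   rows are split into consecutive blocks of sizes given by [a]. *)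
Definition block_triangular (a : seq nat) : {set G} :=
  [set g : G | [forall i : 'I_n.-1.+1, forall j : 'I_n.-1.+1,
     (reshape_index a j < reshape_index a i)%N ==> (GLval g i j == 0)]].

Definition special_parabolics (e l : nat) : {set {group G}} :=
  [set P in standard_parabolics |
    `[< exists a : seq nat,
          [/\ is_composition a, P = block_triangular a :> {set G}, sorted leq a
            & forall x, x \in a -> x = 1%N \/ exists i, x = (e * l ^ i)%N] >]].
End GeneralLinear.
Arguments steinberg_lattice n F R : clear implicits.
Arguments num_index_valuations n F l : clear implicits.
Arguments special_parabolics n F e l : clear implicits.

Definition is_min_nat (P : nat -> Prop) (m : nat) : Prop :=
  P m /\ forall i, P i -> (m <= i)%N.

(* Main.v *)
Require Import Defs.
From HB Require Import structures.
From mathcomp Require Import all_boot all_order all_algebra all_fingroup all_field.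
From mathcomp Require Import boolp zify ring.
From mathcomp Require classical_sets.

Set Implicit Arguments.
Unset Strict Implicit.
Unset Printing Implicit Defensive.

Import Order.TTheory GRing.Theory Num.Theory.
Local Open Scope ring_scope.

(** The composition factors are read off from the eigenvectors of the unipotent
    group [U], whose order is a unit in the coefficient ring.  A linear character
    of [U] is given by its parameters [c] on the superdiagonal.  Each of them
    occurs in the Steinberg lattice with a one-dimensional eigenspace
    ([eig_coordP]): sums over left cosets of minimal parabolic subgroups vanish,
    so an eigenvector is determined by its value at the longest permutation
    ([eigenvector_eq0]).  Conversely every element can be recovered from the
    eigenvectors in the submodule that it generates ([eig_generate]).  Hence a
    submodule of the reduction is determined by the characters whose eigenvector
    it contains; conjugation by diagonal matrices shows that only the support of
    [c] matters, which is a set of simple roots, or a composition of [n].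

    The lattice carries an invariant form for which the square length of an
    eigenvector is the index of the parabolic subgroup [P] of the composition,
    divided by the order of [U] ([norm_index]).  By invariance, the coefficients
    through which two eigenlines reach each other in the two directions are
    related by the ratio of the square lengths ([eig_coord_symmetry]).  So
    modulo [l] an eigenvector of larger valuation does not reach one of smaller
    valuation ([separation]).  Merging two adjacent blocks of a composition
    yields a coefficient that is a unit in one direction ([merge_coord]), and if
    the valuation of the index is unchanged it is a unit in the other direction
    as well, so that both eigenvectors generate the same submodule
    ([merge_link]).

    Lifting the exponent shows that up to sign and an additive constant the
    valuation of the index is the sum over the parts [x] of [d * y + logn l y`!]
    with [y = x %/ e] ([logn_index]).  Comparing base-[l] expansions, every
    composition is brought by merges and splittings that preserve this sum to a
    nondecreasing one with all parts of the form [1] or [e * l ^ i]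
    ([merge_equiv_normal]).  Within the given bounds on [n %/ e] the valuation
    determines that normal form ([load_weight_inj]).  Therefore the eigenvectors
    of a given valuation all generate each other modulo those of larger
    valuation, the filtration by the valuation has simple quotients
    ([layer_covers]), and its length is the number of values, which is also the
    number of normal forms.  These are given by the multiplicities of [e],
    [e * l] and [e * l ^ 2], and counting them is a matter of arithmetic
    progressions. *)

(** * Permutations dominated entrywise *)

(** A permutation and a rearrangement of it have the same sum of values, so
    domination forces equality.  Every uniqueness statement about double cosets
    below is an instance: an invertible upper triangular matrix has a nonzero
    diagonal, which gives the required inequalities. *)
Lemma perm_dominated n (s r : 'S_n) (f : 'I_n -> nat) :
  (forall i, f (s i) <= f (r i))%N -> forall i, f (s i) = f (r i).
Proof.
move=> le_sr i.
have : (\sum_i (f (r i) - f (s i)) = 0)%N.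
  have sum_perm (t : 'S_n) : (\sum_i f (t i) = \sum_i f i)%N.
    by rewrite [RHS](reindex_inj (@perm_inj _ t)).
  by rewrite sumnB // !sum_perm subnn.
move/eqP; rewrite sum_nat_eq0 => /forallP/(_ i)/=.
by rewrite subn_eq0 => ler; apply/eqP; rewrite eqn_leq le_sr.
Qed.

Lemma perm_le_eq n (s r : 'S_n) : (forall i, s i <= r i)%N -> s = r.
Proof.
by move=> le_sr; apply/permP => i; apply/val_inj/(perm_dominated (f := val)).
Qed.

Lemma ascending_le n (f : 'I_n.+1 -> nat) :
  (forall i j : 'I_n.+1, j = i.+1 :> nat -> f i < f j)%N ->
  forall i j : 'I_n.+1, (i < j)%N -> (f i < f j)%N.
Proof.
move=> fS i j; move: {2}(j : nat) (erefl (j : nat)) => m.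
elim: m j => [|m IH] j ej; first by rewrite ej.
have mn : (m < n.+1)%N by rewrite ltnW // -ej.
have lt_m : (f (Ordinal mn) < f j)%N by apply: fS.
rewrite ej ltnS leq_eqVlt => /orP[/eqP eim | im].
  by have -> : i = Ordinal mn by apply: val_inj.
exact: ltn_trans (IH (Ordinal mn) (erefl _) im) lt_m.
Qed.

Lemma perm_ascending_id n (s : 'S_n.+1) :
  (forall i j : 'I_n.+1, i < j -> s i < s j)%N -> s = 1%g.
Proof.
move=> s_mono; apply/esym/perm_le_eq => -[i lt_i]; rewrite perm1 /=.
elim: i lt_i => // i IH lt_i; apply: leq_ltn_trans (IH (ltnW lt_i)) _.
exact: s_mono.
Qed.

(** * Matrices in the general linear group *)

(** Naming the group structure keeps all group operations syntactically over one
    [finGroupType]; otherwise unification unfolds them down to matrices. *)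
Definition GLg (N : nat) (F : finFieldType) : finGroupType := {'GL_N.+1[F]}.
Definition upper_triangular (N : nat) (F : finFieldType) : {set GLg N F} :=
  borel N.+1 F.

Section Matrices.
Variables (N : nat) (F : finFieldType).
Local Notation n := N.+1.
Local Notation G := (GLg N F).
Local Notation B := (upper_triangular N F).
Implicit Types (g h u b : G) (s r t : 'S_n) (i j k : 'I_n).

Definition mat g : 'M[F]_n := @GLval n F g.
Definition pm s : G := @perm_GL n F s.

Lemma matM g h : mat (g * h)%g = mat g *m mat h. Proof. by []. Qed.
Lemma mat1 : mat 1%g = 1%:M. Proof. by []. Qed.
Lemma mat_inj : injective mat. Proof. exact: val_inj. Qed.
Lemma mat_unit g : mat g \in unitmx. Proof. exact: (@GL_unit n F g). Qed.
Lemma matKV g : mat g *m mat g^-1%g = 1%:M. Proof. by rewrite -matM mulgV. Qed.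

Lemma mat_surj (A : 'M[F]_n) : A \in unitmx -> exists g, mat g = A.
Proof. by move=> uA; exists (FinRing.unit 'M[F]_n uA). Qed.

Lemma mat_pm s : mat (pm s) = perm_mx s. Proof. by []. Qed.
Lemma pmM s t : pm (s * t) = (pm s * pm t)%g.
Proof. by apply: mat_inj; rewrite matM !mat_pm perm_mxM. Qed.
Lemma pm1 : pm 1 = 1%g. Proof. by apply: mat_inj; rewrite mat_pm perm_mx1. Qed.
Lemma pmV s : pm s^-1 = (pm s)^-1%g.
Proof. by apply: (mulgI (pm s)); rewrite -pmM !mulgV pm1. Qed.

Lemma mat_pml s g i j : mat (pm s * g)%g i j = mat g (s i) j.
Proof. by rewrite matM mat_pm -row_permE mxE. Qed.
Lemma mat_pmr s g i j : mat (g * pm s)%g i j = mat g i (s^-1%g j).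
Proof. by rewrite matM mat_pm -[s in LHS]invgK -col_permE mxE. Qed.

Lemma borelP g :
  reflect (forall i j, (j < i)%N -> mat g i j = 0) (g \in B).
Proof.
rewrite inE; apply: (iffP forallP) => [gB i j lt_ji | g0 i].
  by move: (gB i) => /forallP/(_ j); rewrite lt_ji => /eqP.
by apply/forallP => j; apply/implyP => lt_ji; apply/eqP/g0.
Qed.

Lemma borel_diag g i : g \in B -> mat g i i != 0.
Proof.
move=> /borelP gB; have := mat_unit g.
rewrite unitmxE unitfE -det_tr det_trig; last first.
  by apply/is_trig_mxP => a b lt_ab; rewrite mxE gB.
by apply: contra => gii; rewrite (bigD1 i) //= mxE (eqP gii) mul0r.
Qed.

Definition unipotent : {set G} :=
  [set g in B | [forall i, mat g i i == 1]].

Lemma unipotentP g :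
  reflect (forall i j, (j <= i)%N -> mat g i j = (i == j)%:R)
          (g \in unipotent).
Proof.
rewrite inE; apply: (iffP andP) => [[/borelP gB /forallP g1] i j | gU].
  rewrite leq_eqVlt => /orP[/eqP/val_inj-> | lt_ji]; first by rewrite (eqP (g1 _)) eqxx.
  by rewrite gB //; case: eqP lt_ji => // ->; rewrite ltnn.
split; last by apply/forallP => i; rewrite gU // eqxx.
by apply/borelP => i j lt_ji; rewrite gU ?(ltnW lt_ji) // -val_eqE gtn_eqF.
Qed.

Fact borel_group_set : group_set (B).
Proof.
apply/group_setP; split; first by apply/borelP => i j ji; rewrite mat1 mxE -val_eqE gtn_eqF.
move=> g h /borelP gB /borelP hB; apply/borelP => i j ji.
rewrite matM mxE big1 // => k _; case: (ltnP k i) => ki; first by rewrite gB ?mul0r.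
by rewrite hB ?mulr0 // (leq_trans ji).
Qed.
Canonical borel_group := group borel_group_set.

Fact unipotent_group_set : group_set unipotent.
Proof.
apply/group_setP; split.
  by rewrite inE group1; apply/forallP => i; rewrite mat1 mxE eqxx.
move=> g h gU hU; move: (gU) (hU).
rewrite inE => /andP[gB _]; rewrite inE => /andP[hB _].
rewrite inE groupM //; apply/forallP => i; rewrite matM mxE (bigD1 i) //=.
move: gU hU => /unipotentP gU /unipotentP hU.
rewrite gU // hU // eqxx mul1r big1 ?addr0 // => k ki.
case: (ltnP k i) => [lt_ki|le_ik]; first by rewrite (borelP _ gB) ?mul0r.
by rewrite (borelP _ hB) ?mulr0 // ltn_neqAle le_ik eq_sym andbT.
Qed.
Canonical unipotent_group := group unipotent_group_set.

Lemma unipotent_borel : unipotent \subset B.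
Proof. by apply/subsetP => g; rewrite inE => /andP[]. Qed.

(** The transvection adding [c] times row [j] to row [i]; only for [i != j]. *)
Definition tv i j (c : F) : G := @insubd _ _ {'GL_n[F]} (1%g : G) (1%:M + c *: delta_mx i j).

Lemma mat_tv i j c : i != j -> mat (tv i j c) = 1%:M + c *: delta_mx i j.
Proof.
move=> ij; apply: (@insubdK _ _ {'GL_n[F]}); pose E d : 'M[F]_n := 1%:M + d *: delta_mx i j.
suff /mulmx1_unit[] : E c *m E (- c) = 1%:M by [].
rewrite /E mulmxDl !mul1mx mulmxDr mulmx1 -scalemxAl -scalemxAr.
rewrite mul_delta_mx_0 1?eq_sym // !scaler0 addr0 -addrA -scalerDl addNr.
by rewrite scale0r addr0.
Qed.

Lemma mat_tvl i j c h k l : i != j ->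
  mat (tv i j c * h)%g k l = mat h k l + (if k == i then c * mat h j l else 0).
Proof.
move=> ij; rewrite matM mat_tv // mulmxDl mul1mx mxE -scalemxAl mxE; congr (_ + _).
rewrite mxE (bigD1 j) //= mxE eqxx andbT big1 ?addr0 => [|m mj]; last first.
  by rewrite mxE (negPf mj) andbF mul0r.
by case: eqP => _; rewrite ?mul1r // mul0r mulr0.
Qed.

Lemma mat_tvr i j c h k l : i != j ->
  mat (h * tv i j c)%g k l = mat h k l + (if l == j then mat h k i * c else 0).
Proof.
move=> ij; rewrite matM mat_tv // mulmxDr mulmx1 mxE -scalemxAr mxE; congr (_ + _).
rewrite mxE (bigD1 i) //= mxE eqxx /= big1 ?addr0 => [|m mi]; last first.
  by rewrite mxE (negPf mi) mulr0.
by case: eqP => _; rewrite ?mulr0 ?mulr1 1?mulrC.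
Qed.

Lemma tv_unipotent i j c : (i < j)%N -> tv i j c \in unipotent.
Proof.
move=> ij; have nij : i != j by rewrite -val_eqE ltn_eqF.
apply/unipotentP => k m mk; rewrite -[tv i j c]mulg1 mat_tvl // mat1 !mxE.
case: (k =P i) => [ki|]; last by rewrite addr0.
have /negPf-> : j != m by rewrite -val_eqE /= gtn_eqF // (leq_ltn_trans mk) // ki.
by rewrite mulr0 addr0.
Qed.

(** Bruhat decomposition.  Among the matrices [u * g] with [u] unipotent, take
    one whose rows start as far to the right as possible.  If two rows had the
    same leading column, subtracting a multiple of the lower one from the upper
    one would improve it; so the leading columns form a permutation, and undoing
    it leaves an upper triangular matrix. *)
Lemma bruhat g : exists u s b,
  [/\ u \in unipotent, b \in B & g = (u * pm s * b)%g].
Proof.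
pose lead (h : G) i := find (fun j => mat h i j != 0) (enum 'I_n).
have leadP h i : (lead h i < n)%N.
  rewrite -[X in (_ < X)%N]size_enum_ord -has_find; apply/hasP.
  suff [j hj] : exists j, mat h i j != 0 by exists j => //; rewrite mem_enum.
  apply/existsP; apply: contraT; rewrite negb_exists => /forallP h0.
  have := matKV h => /matrixP/(_ i i); rewrite !mxE eqxx big1 => [/esym/eqP|j _].
    by rewrite oner_eq0.
  by have := h0 j; rewrite negbK => /eqP->; rewrite mul0r.
have lead_neq h i : mat h i (Ordinal (leadP h i)) != 0.
  have <- : nth ord0 (enum 'I_n) (lead h i) = Ordinal (leadP h i).
    by apply: val_inj; rewrite /= nth_enum_ord.
  have hi : has (fun j => mat h i j != 0) (enum 'I_n) by rewrite has_find size_enum_ord leadP.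
  exact: (nth_find ord0 hi).
have lead_min h i j : (j < lead h i)%N -> mat h i j = 0.
  move=> /[dup] lt_j /(before_find ord0)/negbT; rewrite negbK => /eqP.
  by have -> : nth ord0 (enum 'I_n) j = j by apply: val_inj; rewrite /= nth_enum_ord.
have lead_ge h i m : (m < n)%N -> (forall j, (j <= m)%N -> mat h i j = 0) ->
    (m < lead h i)%N.
  move=> mn h0; rewrite ltnNge; apply/negP => le_m.
  by have := lead_neq h i; rewrite h0 ?eqxx.
case: (arg_maxnP (fun u => \sum_i lead (u * g)%g i) (group1 unipotent)) => u uU umax.
pose h := (u * g)%g.
have lead_inj : injective (fun i => Ordinal (leadP h i)).
  have cmp i i' : (i' < i)%N -> lead h i' = lead h i -> False.
    move=> lt_i e_lead.
    pose l := Ordinal (leadP h i).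
    have i'i : i' != i by rewrite -val_eqE ltn_eqF.
    pose x := tv i' i (- (mat h i' l / mat h i l)).
    have xU : x \in unipotent by apply: tv_unipotent.
    have xP k m := mat_tvl (- (mat h i' l / mat h i l)) h k m i'i.
    have /= := umax _ (groupM xU uU); rewrite leqNgt => /negP[]; rewrite -mulgA -/h.
    rewrite (bigD1 i') //= [X in (_ < X)%N](bigD1 i') //= -addSn leq_add //.
      rewrite {1}e_lead; apply: (lead_ge _ _ _ (leadP h i)) => j.
      rewrite xP eqxx leq_eqVlt => /orP[/eqP jl | jl].
        have -> : j = l by apply: val_inj.
        by rewrite mulNr divfK ?subrr //; apply: lead_neq.
      by rewrite (lead_min h i' j) ?e_lead // (lead_min h i j) // mulr0 addr0.
    apply: eq_leq; apply: eq_bigr => k ki'; apply: eq_find => j.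
    by rewrite xP (negPf ki') addr0.
  move=> i i' e; have {}e : lead h i = lead h i' := congr1 val e.
  case: (ltngtP i i') => [lt_i|lt_i|/ord_inj //]; first by case: (cmp i' i).
  by case: (cmp i i').
pose s := perm lead_inj.
exists u^-1%g, s, ((pm s)^-1 * h)%g; split; first by rewrite groupV.
  have lead_s i : lead h (s^-1%g i) = i :> nat.
    by rewrite -[in RHS](permKV s i) [in RHS]permE.
  by apply/borelP => i j ji; rewrite -pmV mat_pml lead_min ?lead_s.
by rewrite -mulgA mulKVg mulKg.
Qed.

End Matrices.

(** * The group algebra over a commutative ring *)

Section ScalarAction.
Variables (R : comNzRingType) (gT : finGroupType).
Local Notation A := (group_algebra R gT).

Definition ga_scale (r : R) (a : A) : A := [ffun g => r * ga_coef a g].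

Fact ga_scaleA r1 r2 a : ga_scale r1 (ga_scale r2 a) = ga_scale (r1 * r2) a.
Proof. by apply/ffunP => g; rewrite !ffunE /ga_coef ffunE mulrA. Qed.
Fact ga_scale1 : left_id 1 ga_scale.
Proof. by move=> a; apply/ffunP => g; rewrite ffunE mul1r. Qed.
Fact ga_scaleDr : right_distributive ga_scale +%R.
Proof. by move=> r a b; apply/ffunP => g; rewrite !ffunE ga_coefD mulrDr. Qed.
Fact ga_scaleDl a : {morph ga_scale^~ a : r1 r2 / r1 + r2}.
Proof. by move=> r1 r2; apply/ffunP => g; rewrite !ffunE mulrDl. Qed.
HB.instance Definition _ := GRing.Zmodule_isLmodule.Build R A
  ga_scaleA ga_scale1 ga_scaleDr ga_scaleDl.
End ScalarAction.

Section GroupAlgebraTheory.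
Variables (R : comNzRingType) (gT : finGroupType).
Local Notation A := (group_algebra R gT).
Local Notation elt := (@ga_elt R gT).
Implicit Types (a b : A) (g h : gT) (r : R).

Lemma coef0 g : ga_coef (0 : A) g = 0. Proof. exact: ffunE. Qed.
Lemma coefN a g : ga_coef (- a) g = - ga_coef a g. Proof. exact: ffunE. Qed.
Lemma coefZ r a g : ga_coef (r *: a) g = r * ga_coef a g.
Proof. exact: ffunE. Qed.

Lemma coef_sum (I : Type) (r : seq I) (P : pred I) (f : I -> A) g :
  ga_coef (\sum_(i <- r | P i) f i) g = \sum_(i <- r | P i) ga_coef (f i) g.
Proof.
by apply: (big_morph (fun a => ga_coef a g)) => [a b|]; rewrite ?ga_coefD ?coef0.
Qed.

Lemma ga_scalerAl r a b : r *: (a * b) = (r *: a) * b.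
Proof.
apply/ga_coefP => g; rewrite coefZ !ga_coefM mulr_sumr.
by apply: eq_bigr => h _; rewrite coefZ mulrA.
Qed.

Lemma ga_scalerAr r a b : r *: (a * b) = a * (r *: b).
Proof.
apply/ga_coefP => g; rewrite coefZ !ga_coefM mulr_sumr.
by apply: eq_bigr => h _; rewrite coefZ mulrCA.
Qed.

Lemma eltM g h : elt (g * h)%g = elt g * elt h.
Proof.
apply/ga_coefP => k; rewrite ga_coefM (bigD1 g) //= big1 => [|m mg].
  by rewrite !ga_coef_elt eqxx mul1r addr0 -(inj_eq (mulgI g^-1%g)) mulKg.
by rewrite ga_coef_elt (negPf mg) mul0r.
Qed.

Lemma coef_eltl g a h : ga_coef (elt g * a) h = ga_coef a (g^-1 * h)%g.
Proof.
rewrite ga_coefM (bigD1 g) //= big1 => [|m mg].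
  by rewrite ga_coef_elt eqxx mul1r addr0.
by rewrite ga_coef_elt (negPf mg) mul0r.
Qed.

Lemma coef_eltr g a h : ga_coef (a * elt g) h = ga_coef a (h * g^-1)%g.
Proof.
rewrite ga_coefM (bigD1 (h * g^-1)%g) //= big1 => [|m mg].
  by rewrite ga_coef_elt invMg invgK mulgKV eqxx mulr1 addr0.
rewrite ga_coef_elt; case: eqP => [e|]; last by rewrite mulr0.
by case/eqP: mg; rewrite -e invMg invgK mulKVg.
Qed.

Lemma ga_expand a : a = \sum_g ga_coef a g *: elt g.
Proof.
apply/ga_coefP => h; rewrite coef_sum (bigD1 h) //= big1 => [|g gh].
  by rewrite coefZ ga_coef_elt eqxx mulr1 addr0.
by rewrite coefZ ga_coef_elt eq_sym (negPf gh) mulr0.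
Qed.

Lemma coef_ga_sum (S : {set gT}) g : ga_coef (ga_sum R S) g = (g \in S)%:R.
Proof.
rewrite coef_sum; case: (boolP (g \in S)) => gS; last first.
  by rewrite big1 // => h hS; rewrite ga_coef_elt; case: eqP gS hS => // -> /negPf->.
rewrite (bigD1 g) //= big1 ?ga_coef_elt ?eqxx ?addr0 // => h /andP[_ hg].
by rewrite ga_coef_elt eq_sym (negPf hg).
Qed.

(** The antipode, which is the transpose for the bilinear form below. *)
Definition antipode a : A := [ffun g => ga_coef a g^-1%g].

Lemma coef_antipode a g : ga_coef (antipode a) g = ga_coef a g^-1%g.
Proof. exact: ffunE. Qed.

Lemma antipodeM a b : antipode (a * b) = antipode b * antipode a.
Proof.
apply/ga_coefP => g; rewrite coef_antipode !ga_coefM.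
rewrite (reindex_inj (mulgI g^-1%g)) /=; apply: eq_bigr => h _.
by rewrite !coef_antipode !invMg !invgK mulgK mulrC.
Qed.

Lemma antipode_elt g : antipode (elt g) = elt g^-1%g.
Proof.
by apply/ga_coefP => h; rewrite coef_antipode !ga_coef_elt (can2_eq invgK invgK).
Qed.

Lemma antipodeD a b : antipode (a + b) = antipode a + antipode b.
Proof. by apply/ga_coefP => g; rewrite ga_coefD !coef_antipode ga_coefD. Qed.

Lemma antipodeZ r a : antipode (r *: a) = r *: antipode a.
Proof. by apply/ga_coefP => g; rewrite coefZ !coef_antipode coefZ. Qed.

Lemma antipode_sum (I : Type) (s : seq I) (P : pred I) (f : I -> A) :
  antipode (\sum_(i <- s | P i) f i) = \sum_(i <- s | P i) antipode (f i).
Proof.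
apply: (big_morph antipode) => [a b|]; first exact: antipodeD.
by apply/ga_coefP => g; rewrite coef_antipode !coef0.
Qed.

(** The canonical symmetrising trace. *)
Definition ga_trace a : R := ga_coef a 1%g.

Lemma ga_traceC a b : ga_trace (a * b) = ga_trace (b * a).
Proof.
rewrite /ga_trace !ga_coefM [RHS](reindex_inj invg_inj) /=.
by apply: eq_bigr => h _; rewrite invgK !mulg1 mulrC.
Qed.

Lemma ga_trace_antipode a : ga_trace (antipode a) = ga_trace a.
Proof. by rewrite /ga_trace coef_antipode invg1. Qed.

Lemma ga_traceZ r a : ga_trace (r *: a) = r * ga_trace a.
Proof. exact: coefZ. Qed.

End GroupAlgebraTheory.

(** * Eigenvectors of the unipotent subgroup *)

Section Swap.
Variable N : nat.
Local Notation n := N.+1.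
Implicit Types (t : 'S_n) (i j k : 'I_n).

(** Maximal elements for the sum of the [i * t i] are thus increasing wherever an
    adjacent transposition may be applied; this serves as termination measure
    and as choice of shortest coset representatives. *)
Lemma tperm_adjacent_sum t k k' : k' = k.+1 :> nat -> (t k < t k')%N ->
  (\sum_(i < n) i * (tperm k k' * t)%g i < \sum_(i < n) i * t i)%N.
Proof.
move=> kk' lt_t; have k'k : k' != k by rewrite -val_eqE /= kk' gtn_eqF.
rewrite (bigD1 k) // (bigD1 k') //= [X in (_ < X)%N](bigD1 k) // (bigD1 k') //=.
rewrite !permM tpermL tpermR !addnA -addSn leq_add //; last first.
  apply: eq_leq; apply: eq_bigr => i /andP[ik ik'].
  by rewrite permM tpermD // eq_sym.
by rewrite kk' !mulSn addnCA [ltnRHS]addnCA (addnC (k * t k)%N) ltn_add2r.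
Qed.

Lemma perm_descending_rev t :
  (forall k k' : 'I_n, k' = k.+1 :> nat -> (t k' < t k)%N) -> t = perm rev_ord_inj.
Proof.
move=> desc; set w0 := perm _.
suff : (t * w0)%g = 1%g.
  move/(canRL (mulgK _)); rewrite mul1g => ->; apply/eqP; rewrite eq_invg_mul.
  by apply/eqP/permP => i; rewrite permM !permE rev_ordK.
apply: perm_ascending_id; apply: ascending_le => i j ij.
rewrite !permM !permE /=; have := desc _ _ ij.
have := ltn_ord (t i); have := ltn_ord (t j); lia.
Qed.

End Swap.

Definition stein (N : nat) (F : finFieldType) (R : idomainType) :
  group_algebra R (GLg N F) := steinberg_elt N.+1 F R.

Section Steinberg.
Variables (N : nat) (F : finFieldType) (R : idomainType).
Local Notation n := N.+1.
Local Notation G := (GLg N F).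
Local Notation A := (group_algebra R G).
Local Notation elt := (@ga_elt R G).
Local Notation U := (unipotent N F).
Local Notation B := (upper_triangular N F).
Local Notation eps := (stein N F R).
Local Notation pm := (@pm N F).
Local Notation mat := (@mat N F).
Implicit Types (g h u b : G) (s r w : 'S_n) (i j k : 'I_n) (a x y : A).

Definition sgn s : R := (-1) ^+ s.

Lemma sgnM s t : sgn (s * t) = sgn s * sgn t.
Proof. by rewrite /sgn odd_permM signr_addb. Qed.

Lemma sgn_sq s : sgn s * sgn s = 1.
Proof. by rewrite /sgn -signr_addb addbb. Qed.

Definition signed_sum : A := \sum_s sgn s *: elt (pm s).

Lemma steinberg_eltE : eps = signed_sum * ga_sum R B.
Proof.
rewrite /stein /steinberg_elt /signed_sum mulr_suml; apply: eq_bigr => s _.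
rewrite -ga_scalerAl /sgn; case: (odd_perm s); rewrite ?expr0 ?mul1r ?scale1r //.
by rewrite expr1 mulN1r scaleN1r.
Qed.

Lemma coef_eps g :
  ga_coef eps g = \sum_s sgn s * ((pm s)^-1 * g \in B)%g%:R.
Proof.
rewrite steinberg_eltE /signed_sum mulr_suml coef_sum; apply: eq_bigr => s _.
by rewrite -ga_scalerAl coefZ coef_eltl coef_ga_sum.
Qed.

Lemma pm_signed_sum s : elt (pm s) * signed_sum = sgn s *: signed_sum.
Proof.
rewrite /signed_sum mulr_sumr scaler_sumr [RHS](reindex_inj (mulgI s)).
apply: eq_bigr => t _ /=; rewrite -ga_scalerAr -eltM -pmM scalerA sgnM mulrA.
by rewrite sgn_sq mul1r.
Qed.

Lemma antipode_signed_sum : antipode signed_sum = signed_sum.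
Proof.
rewrite /signed_sum antipode_sum [RHS](reindex_inj invg_inj); apply: eq_bigr => s _.
by rewrite antipodeZ antipode_elt /sgn odd_permV pmV.
Qed.

Lemma antipode_ga_sum (H : {group G}) : antipode (ga_sum R H) = ga_sum R H.
Proof.
apply/ga_coefP => g; rewrite coef_antipode !coef_ga_sum groupV //.
Qed.

Lemma pm_eps s : elt (pm s) * eps = sgn s *: eps.
Proof. by rewrite steinberg_eltE mulrA pm_signed_sum ga_scalerAl. Qed.

Lemma coef_eps_borel a g b : b \in B -> ga_coef (a * eps) (g * b) = ga_coef (a * eps) g.
Proof.
move=> bB; rewrite !ga_coefM; apply: eq_bigr => h _; congr (_ * _).
rewrite !coef_eps; apply: eq_bigr => s _; rewrite !mulgA.
by rewrite (@groupMr _ (borel_group N F)).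
Qed.

(** Only the term of [w] in the alternating sum survives, because the cells
    [U s B] are disjoint. *)
Lemma coef_eps_cell u w : u \in U ->
  ga_coef eps (u * pm w)%g = sgn w * ((pm w)^-1 * u * pm w \in B)%g%:R.
Proof.
move=> uU; rewrite coef_eps (bigD1 w) //= mulgA big1 ?addr0 // => s sw.
case: (boolP (_ \in B)) => [gB|]; last by rewrite mulr0.
case/eqP: sw; apply: invg_inj; apply: perm_le_eq => i.
have := borel_diag i gB; rewrite mulgA -pmV mat_pmr mat_pml leqNgt.
apply: contra => lt_w; have /unipotentP uP := uU.
by rewrite uP 1?ltnW // -val_eqE gtn_eqF.
Qed.

(** For [k' = k.+1] these are the elements of the parabolic subgroup generated by
    the upper triangular matrices and the transposition of [k] and [k']. *)
Definition min_parabolic k k' g :=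
  [forall i : 'I_n, forall j : 'I_n, (j < i)%N ==> ((i, j) != (k', k)) ==> (mat g i j == 0)].

Lemma min_parabolicP k k' g :
  reflect (forall i j, (j < i)%N -> (i, j) != (k', k) -> mat g i j = 0)
          (min_parabolic k k' g).
Proof.
apply: (iffP forallP) => [gP i j ji ne|g0 i].
  by have /forallP/(_ j) := gP i; rewrite ji ne => /eqP.
by apply/forallP => j; apply/implyP => ji; apply/implyP => ne; rewrite g0.
Qed.

(** A minimal parabolic subgroup is the union of [#|F|.+1] right cosets of the
    upper triangular group; row [k'] of [g] tells which of them contains [g]. *)
Lemma min_parabolic_cosets k k' g : k' = k.+1 :> nat ->
  (g \in B)%:R + \sum_(t : F) (g * tv k k' t * pm (tperm k k') \in B)%g%:R
  = (min_parabolic k k' g)%:R :> R.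
Proof.
move=> kk'; have k'k : k' != k by rewrite -val_eqE /= kk' gtn_eqF.
have nkk' : k != k' by rewrite eq_sym.
pose gx t := (g * tv k k' t * pm (tperm k k'))%g.
have gxk t i : mat (gx t) i k = mat g i k' + mat g i k * t.
  by rewrite mat_pmr tpermV tpermL mat_tvr // eqxx.
have gxk' t i : mat (gx t) i k' = mat g i k.
  by rewrite mat_pmr tpermV tpermR mat_tvr // (negPf nkk') addr0.
have gxj t i j : j != k -> j != k' -> mat (gx t) i j = mat g i j.
  move=> jk jk'; rewrite mat_pmr tpermV tpermD 1?eq_sym // mat_tvr //.
  by rewrite (negPf jk') addr0.
have PB : (g \in B) = min_parabolic k k' g && (mat g k' k == 0).
  apply/borelP/andP => [gB|[/min_parabolicP gP /eqP g0] i j ji].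
    split; last by rewrite gB ?kk'.
    by apply/min_parabolicP => i j ji _; apply: gB.
  have [[-> ->//]|ne] := eqVneq (i, j) (k', k); exact: gP.
have xB t : (gx t \in B) =
    [&& min_parabolic k k' g, mat g k' k != 0 & t == - (mat g k' k' / mat g k' k)].
  apply/idP/and3P => [gB|[/min_parabolicP gP g0 /eqP et]].
    have g0 : mat g k' k != 0 by rewrite -(gxk' t); apply: borel_diag.
    have gB0 := borelP _ gB; split=> //.
      apply/min_parabolicP => i j ji; rewrite xpair_eqE negb_and.
      have [ej | jk] := eqVneq j k.
        rewrite orbF => ik'; rewrite ej -(gxk' t) gB0 //.
        by move: ik' ji; rewrite ej -val_eqE /= kk'; lia.
      have [ej | jk' _] := eqVneq j k'; last by rewrite -(gxj t) // gB0.
      have lt_i : (k < i)%N by move: ji; rewrite ej kk'; lia.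
      move=> _; have := gB0 i k lt_i; rewrite gxk -(gxk' t) (gB0 i k') -?ej //.
      by rewrite mul0r addr0.
    have /eqP : mat (gx t) k' k = 0 by rewrite gB0 ?kk'.
    rewrite gxk addrC addr_eq0 => /eqP e.
    by rewrite -mulNr -e mulrAC divff ?mul1r.
  apply/borelP => i j ji; have [ej|jk] := eqVneq j k.
    rewrite ej gxk; have [->|ik'] := eqVneq i k'.
      by rewrite et mulrN mulrCA divff // mulr1 subrr.
    have lt_k'i : (k' < i)%N.
      by move: ik' ji; rewrite ej -val_eqE /=; lia.
    rewrite (gP i k') ?(gP i k) ?mul0r ?addr0 //.
    - by rewrite -ej.
    - by rewrite xpair_eqE negb_and ik'.
    - by rewrite xpair_eqE negb_and ik'.
  have [ej|jk'] := eqVneq j k'.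
    rewrite ej gxk' gP //; first by move: ji; rewrite ej; lia.
    rewrite xpair_eqE negb_and -(inj_eq val_inj) /= neq_ltn.
    by move: ji; rewrite ej => ->; rewrite orbT.
  by rewrite gxj // gP // xpair_eqE negb_and jk orbT.
rewrite PB; under eq_bigr => t _ do rewrite -/(gx t) xB.
case: (min_parabolic _ _ _) => /=; last by rewrite big1 ?addr0.
case: (mat g k' k =P 0) => g0 /=; first by rewrite big1 ?addr0.
by rewrite add0r (bigD1 (- (mat g k' k' / mat g k' k))) //= eqxx big1 ?addr0 // => t /negPf->.
Qed.

Hypothesis R_two : forall r : R, r + r = 0 -> r = 0.

(** Summing the generator over a coset of a minimal parabolic subgroup gives
    zero, because left multiplication by the adjacent transposition preserves
    that subgroup and reverses the sign in the alternating sum. *)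
Lemma coef_eps_line a g k k' : k' = k.+1 :> nat ->
  ga_coef (a * eps) g
  + \sum_(t : F) ga_coef (a * eps) (g * tv k k' t * pm (tperm k k'))%g = 0.
Proof.
move=> kk'; have k'k : k != k' by rewrite -val_eqE /= kk' ltn_eqF.
(* The relation is stable under left multiplication. *)
suff eps0 h : ga_coef eps h + \sum_(t : F) ga_coef eps (h * tv k k' t * pm (tperm k k'))%g = 0.
  under eq_bigr => t _ do rewrite ga_coefM; rewrite ga_coefM exchange_big -big_split /=.
  apply: big1 => h _; rewrite -mulr_sumr -mulrDr.
  by under eq_bigr => t _ do rewrite 2!mulgA; rewrite eps0 mulr0.
under eq_bigr => t _ do rewrite coef_eps; rewrite coef_eps exchange_big -big_split /=.
rewrite (eq_bigr (fun s => sgn s * (min_parabolic k k' ((pm s)^-1 * h)%g)%:R)) => [|s _]; last first.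
  rewrite -mulr_sumr -mulrDr -(min_parabolic_cosets _ kk').
  by under eq_bigr => t _ do rewrite !mulgA.
apply: R_two; rewrite {2}(reindex_inj (mulIg (tperm k k'))) /= -big_split /=.
apply: big1 => s _; rewrite sgnM [sgn (tperm _ _)]/sgn odd_tperm k'k expr1 mulrN1 mulNr.
suff -> : min_parabolic k k' ((pm (s * tperm k k'))^-1 * h)%g =
          min_parabolic k k' ((pm s)^-1 * h)%g by rewrite subrr.
have half f : min_parabolic k k' f -> min_parabolic k k' (pm (tperm k k') * f)%g.
  move/min_parabolicP => fP; apply/min_parabolicP => i j ji ne; rewrite mat_pml.
  case: tpermP => [ei|ei|/eqP ik /eqP ik']; last exact: fP.
    apply: fP; first by rewrite kk' ltnW // ltnS -ei.
    by rewrite xpair_eqE eqxx -val_eqE /= neq_ltn -ei ji.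
  apply: fP; last by rewrite xpair_eqE negb_and k'k.
  by move: ne; rewrite ei xpair_eqE eqxx /= -val_eqE /=; move: ji; rewrite ei; lia.
rewrite -!pmV invMg tpermV pmM -mulgA; apply/idP/idP; last exact: half.
by move/half; rewrite !mulgA -pmM tperm2 pm1 mul1g.
Qed.

(** An eigenvector for [U] in the left ideal of [eps] is determined by its value
    on the longest permutation: the relation on a line through [pm s], where
    [s] is not the longest, expresses its value at [s] by values in the cell of
    [s] times an adjacent transposition. *)
Lemma eigenvector_eq0 (chi : G -> R) x y : y = x * eps ->
  (forall u g, u \in U -> ga_coef y (u * g)%g = chi u * ga_coef y g) ->
  ga_coef y (pm (perm (@rev_ord_inj n))) = 0 -> y = 0.
Proof.
move=> ey yU y0; apply/ga_coefP => g; rewrite coef0.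
have [u [s [b [uU bB ->]]]] := bruhat g.
rewrite ey coef_eps_borel // -ey yU //; suff -> : ga_coef y (pm s) = 0 by rewrite mulr0.
have rev_s (t : 'S_n) : (forall k k' : 'I_n, k' = k.+1 :> nat -> (t^-1%g k' < t^-1%g k)%N) ->
    t = perm (@rev_ord_inj n).
  move=> desc; apply/invg_inj; rewrite (perm_descending_rev desc).
  apply/eqP; rewrite eq_sym eq_invg_mul; apply/eqP/permP => i.
  by rewrite permM !permE rev_ordK.
(* Descending the sum of the [i * s^-1 i] leads to the longest permutation. *)
move: {2}(\sum_i _ * _)%N (leqnn (\sum_(i < n) i * s^-1%g i)%N) => m.
elim: m s => [|m IH] s le_s.
  rewrite (rev_s s) // => k k' kk'; rewrite ltnNge leq_eqVlt negb_or; apply/andP; split.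
    by rewrite val_eqE (inj_eq perm_inj) -val_eqE /= kk' ltn_eqF.
  apply/negP => /(tperm_adjacent_sum kk').
  by rewrite ltnNge (leq_trans le_s).
have [desc|] := pselect (forall k k' : 'I_n, k' = k.+1 :> nat -> (s^-1%g k' < s^-1%g k)%N).
  by rewrite (rev_s s).
move/existsNP => [k /existsNP[k' /not_implyP[kk' /negP]]].
rewrite -leqNgt leq_eqVlt val_eqE (inj_eq perm_inj) -val_eqE /= kk' ltn_eqF //= => lt_s.
have := coef_eps_line x (pm s) kk'; rewrite -ey big1 ?addr0 // => t _.
have nkk' : k != k' by rewrite -val_eqE /= kk' ltn_eqF.
have xU : (pm s * tv k k' t * (pm s)^-1)%g \in U.
  apply/unipotentP => i j ji; rewrite -pmV mat_pmr invgK mat_pml mat_tv // !mxE.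
  rewrite (inj_eq perm_inj); case: (s i =P k) => [ei|_] /=; last by rewrite mulr0 addr0.
  case: (s j =P k') => [ej|_] /=; last by rewrite mulr0 addr0.
  by move: lt_s; rewrite -ei -ej !permK ltnNge ji.
have -> : (pm s * tv k k' t * pm (tperm k k'))%g =
          (pm s * tv k k' t * (pm s)^-1 * pm (s * tperm k k'))%g.
  by rewrite pmM !mulgA mulgKV.
rewrite yU // IH ?mulr0 // -ltnS; apply: leq_trans le_s.
by rewrite invMg tpermV; apply: tperm_adjacent_sum.
Qed.

End Steinberg.

(** * Linear characters of the unipotent subgroup *)

Section Pattern.
Variables (N : nat) (F : finFieldType).
Local Notation n := N.+1.
Local Notation G := (GLg N F).
Local Notation U := (unipotent N F).
Local Notation B := (upper_triangular N F).
Local Notation pm := (@pm N F).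
Local Notation mat := (@mat N F).
Implicit Types (g h u : G) (s t : 'S_n) (i j : 'I_n).

(** Upper triangular matrices can be prescribed entry by entry: they are
    invertible as soon as the diagonal entries are nonzero. *)
Lemma card_pattern (S : 'I_n -> 'I_n -> {set F}) :
  (forall i j, (j < i)%N -> S i j = [set 0]) -> (forall i, 0 \notin S i i) ->
  #|[set g : G | [forall i, forall j, mat g i j \in S i j]]| =
    (\prod_i \prod_j #|S i j|)%N.
Proof.
move=> S_low S_diag; set X := [set g | _].
pose f g : {ffun 'I_n * 'I_n -> F} := [ffun ij => mat g ij.1 ij.2].
have f_inj : injective f.
  move=> g h /ffunP e; apply: mat_inj; apply/matrixP => i j.
  by have := e (i, j); rewrite !ffunE.
rewrite -(card_imset _ f_inj) pair_big /=.
have -> : f @: X = [set a in family (fun ij => mem (S ij.1 ij.2))].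
  apply/setP => a; rewrite inE; apply/imsetP/familyP => [[g gX ->] [i j]|aS].
    by move: gX; rewrite inE ffunE => /forallP/(_ i)/forallP/(_ j).
  pose M : 'M[F]_n := \matrix_(i, j) a (i, j).
  have Mlow i j : (j < i)%N -> M i j = 0.
    by move=> ji; have := aS (i, j); rewrite mxE /= S_low // => /set1P.
  have uM : M \in unitmx.
    rewrite unitmxE -det_tr det_trig; last by apply/is_trig_mxP => i j ij; rewrite mxE Mlow.
    rewrite unitfE; apply/prodf_neq0 => i _; rewrite 2!mxE.
    by apply: contra (S_diag i) => /eqP <-; apply: (aS (i, i)).
  have [g gM] := mat_surj uM; exists g; last by apply/ffunP => -[i j]; rewrite ffunE gM mxE.
  by rewrite inE; apply/forallP => i; apply/forallP => j; rewrite gM mxE; apply: (aS (i, j)).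
rewrite cardsE card_family /image_mem foldrE big_map big_enum /=.
by apply: eq_bigr => -[i j] _; rewrite cardE /= -cardE.
Qed.

(** The stabiliser in [U] of the coset [t B]. *)
Definition unipotent_sub t : {set G} := U :&: (B :^ (pm t)^-1)%g.

Lemma unipotent_subP t u : reflect
  (u \in U /\ forall i j, (t j < t i)%N -> mat u i j = 0) (u \in unipotent_sub t).
Proof.
rewrite in_setI mem_conjgV conjgE -pmV; apply: (iffP andP) => -[-> H]; split=> //.
  move=> i j lt_t; have := borelP _ H _ _ lt_t.
  by rewrite mat_pml mat_pmr !permK.
apply/borelP => i j ji; rewrite mat_pml mat_pmr; apply: H.
by rewrite !permKV.
Qed.

Lemma unipotent_subE t u : u \in U ->
  (u \in unipotent_sub t) = ((pm t)^-1 * u * pm t \in B)%g.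
Proof. by move=> uU; rewrite in_setI uU mem_conjgV conjgE mulgA. Qed.

Canonical unipotent_sub_group t := [group of unipotent_sub t].

Definition inversions t := [set p : 'I_n * 'I_n | (p.1 < p.2)%N && (t p.2 < t p.1)%N].
Definition noninversions t := [set p : 'I_n * 'I_n | (p.1 < p.2)%N && (t p.1 < t p.2)%N].

Let entries (D : {set F}) t i j : {set F} :=
  if i == j then D else if (i < j)%N && (t i < t j)%N then setT else [set 0].

Let prod_entries D t :
  (\prod_i \prod_j #|entries D t i j| = #|D| ^ n * #|F| ^ #|noninversions t|)%N.
Proof.
have -> : (#|D| ^ n = \prod_(i < n) #|D|)%N by rewrite prod_nat_const card_ord.
have -> : (#|F| ^ #|noninversions t| =
    \prod_i \prod_j if (i, j) \in noninversions t then #|F| else 1)%N.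
  by rewrite pair_bigA -prod_nat_const big_mkcond; apply: eq_bigr => -[].
rewrite -big_split; apply: eq_bigr => i _ /=; rewrite (bigD1 i) //= [in RHS](bigD1 i) //=.
rewrite {1}/entries eqxx inE /= ltnn mul1n; congr (_ * _)%N; apply: eq_bigr => j ji.
by rewrite /entries eq_sym (negPf ji) inE /=; case: ifP; rewrite ?cardsT ?cards1.
Qed.

Lemma card_unipotent_sub t : #|unipotent_sub t| = (#|F| ^ #|noninversions t|)%N.
Proof.
have -> : unipotent_sub t =
    [set g : G | [forall i, forall j, mat g i j \in entries [set 1] t i j]].
  apply/setP => g; rewrite [RHS]inE; apply/unipotent_subP/forallP => [[/unipotentP gU g0] i|gS].
    apply/forallP => j; rewrite /entries; case: eqP => [->|/eqP ij]; first by rewrite inE gU ?eqxx.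
    case: ifP => [|/negbT]; rewrite ?inE // negb_and -!leqNgt.
    by case/orP => [le_ji|]; [rewrite gU // (negPf ij) | rewrite leq_eqVlt val_eqE (inj_eq perm_inj) eq_sym (negPf ij) /= => /g0->].
  have gE i j := forallP (gS i) j; rewrite /entries in gE; split.
    apply/unipotentP => i j ji; have := gE i j.
    case: eqP => _; first by rewrite inE => /eqP.
    by rewrite ltnNge ji /= inE => /eqP.
  move=> i j lt_t; have := gE i j; case: eqP lt_t => [->|_ lt_t]; first by rewrite ltnn.
  by rewrite [(t i < _)%N]ltnNge (ltnW lt_t) andbF inE => /eqP.
rewrite card_pattern ?prod_entries ?cards1 ?exp1n ?mul1n // => [i j ji|i].
  by rewrite /entries -val_eqE gtn_eqF //= ltnNge (ltnW ji).
by rewrite /entries eqxx inE eq_sym oner_eq0.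
Qed.

Lemma card_borel_sub t :
  #|B :&: (B :^ (pm t)^-1)%g| = (#|F|.-1 ^ n * #|F| ^ #|noninversions t|)%N.
Proof.
have -> : B :&: (B :^ (pm t)^-1)%g =
    [set g : G | [forall i, forall j, mat g i j \in entries [set~ 0] t i j]].
  apply/setP => g; rewrite in_setI [RHS]inE mem_conjgV conjgE -pmV.
  apply/andP/forallP => [[gB gtB] i|gS].
    apply/forallP => j; rewrite /entries; case: eqP => [->|/eqP ij].
      by rewrite !inE borel_diag.
    case: ifP => [|/negbT]; rewrite ?inE // negb_and -!leqNgt.
    case/orP => [|]; rewrite leq_eqVlt ?val_eqE ?(inj_eq perm_inj) eq_sym (negPf ij) /=.
      by move/(borelP _ gB) ->.
    move=> lt_t; have := borelP _ gtB _ _ lt_t.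
    by rewrite mat_pml mat_pmr !permK => ->.
  have gE i j := forallP (gS i) j; rewrite /entries in gE; split.
    apply/borelP => i j ji; have := gE i j.
    by rewrite -val_eqE gtn_eqF //= ltnNge (ltnW ji) /= inE => /eqP.
  apply/borelP => i j ji; rewrite mat_pml mat_pmr.
  have := gE (t^-1%g i) (t^-1%g j); rewrite (inj_eq perm_inj) !permKV.
  by rewrite -val_eqE gtn_eqF //= [(i < j)%N]ltnNge (ltnW ji) andbF inE => /eqP.
have card_nz : #|[set~ (0 : F)]| = #|F|.-1 by rewrite cardsC1.
rewrite card_pattern ?prod_entries ?card_nz // => [i j ji|i].
  by rewrite /entries -val_eqE gtn_eqF //= ltnNge (ltnW ji).
by rewrite /entries eqxx !inE eqxx.
Qed.

Lemma unipotent_sub1 : unipotent_sub 1%g = U.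
Proof.
apply/setP => u; apply/unipotent_subP/idP => [[] // | uU]; split=> // i j.
rewrite !perm1 => ji; have /unipotentP -> := uU; last exact: ltnW.
by rewrite -val_eqE gtn_eqF.
Qed.

Lemma card_unipotent : #|U| = (#|F| ^ #|noninversions 1%g|)%N.
Proof. by rewrite -card_unipotent_sub unipotent_sub1. Qed.

(** Composing with the reversal exchanges inversions and noninversions. *)
Lemma card_unipotent_sub_rev t :
  (#|unipotent_sub t| * #|unipotent_sub (t * perm (@rev_ord_inj n))| = #|U|)%N.
Proof.
rewrite card_unipotent !card_unipotent_sub -expnD; congr (_ ^ _)%N.
have -> : noninversions (t * perm (@rev_ord_inj n)) = inversions t.
  apply/setP => -[i j]; rewrite !inE !permM !permE /=; congr (_ && _).
  by have := ltn_ord (t i); have := ltn_ord (t j); lia.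
rewrite -cardsUI [X in (_ + X)%N](_ : _ = 0)%N ?addn0; last first.
  apply/eqP; rewrite cards_eq0; apply/eqP/setP => -[i j]; rewrite !inE /=.
  by case: (ltngtP (t i) (t j)); rewrite ?andbF.
apply: eq_card => -[i j]; rewrite !inE !perm1 /= -andb_orr.
case: (ltngtP i j) => //= ij.
by rewrite -neq_ltn val_eqE (inj_eq perm_inj) -val_eqE ltn_eqF.
Qed.

End Pattern.

(** * Idempotents of linear characters *)

Section LinearIdempotent.
Variables (R : idomainType) (gT : finGroupType) (H : {group gT}) (f : gT -> R).
Local Notation elt := (@ga_elt R gT).
Hypothesis fM : {in H &, {morph f : x y / (x * y)%g >-> x * y}}.
Hypothesis f1 : f 1%g = 1.
Hypothesis cardH : (#|H|%:R : R) \is a GRing.unit.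
Implicit Types (u v g : gT) (a b : group_algebra R gT).

Lemma homV u : u \in H -> f u * f u^-1%g = 1.
Proof. by move=> uH; rewrite -fM ?groupV // mulgV f1. Qed.

(** Translation by [h] multiplies the sum by a scalar different from one. *)
Lemma hom_sum_eq0 (K : {group gT}) h :
  K \subset H -> h \in K -> f h != 1 -> \sum_(u in K) f u = 0.
Proof.
move=> sKH hK fh; have : f h * \sum_(u in K) f u = \sum_(u in K) f u.
  rewrite mulr_sumr [RHS](reindex_inj (mulgI h)) /=.
  by apply: eq_big => u; rewrite ?groupMl // => uK; rewrite fM // (subsetP sKH).
move/eqP; rewrite -subr_eq0 -{2}[\sum_(_ in _) _]mul1r -mulrBl mulf_eq0.
by rewrite subr_eq0 (negPf fh) => /eqP.
Qed.

(** The projection onto the vectors on which each [u] in [H] acts by the inverse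
    of [f u]. *)
Definition lin_idem : group_algebra R gT :=
  (#|H|%:R)^-1 *: \sum_(u in H) f u *: elt u.

Lemma elt_lin_idem u : u \in H -> elt u * lin_idem = f u^-1%g *: lin_idem.
Proof.
move=> uH; rewrite /lin_idem -ga_scalerAr !scalerA mulrC -scalerA; congr (_ *: _).
rewrite mulr_sumr scaler_sumr [RHS](reindex_inj (mulgI u)) /=.
apply: eq_big => v; rewrite ?groupMl // => vH.
rewrite -ga_scalerAr -eltM scalerA fM // mulrA [f u^-1%g * _]mulrC.
by rewrite homV // mul1r.
Qed.

Lemma lin_idem_elt u : u \in H -> lin_idem * elt u = f u^-1%g *: lin_idem.
Proof.
move=> uH; rewrite /lin_idem -ga_scalerAl !scalerA mulrC -scalerA; congr (_ *: _).
rewrite mulr_suml scaler_sumr [RHS](reindex_inj (mulIg u)) /=.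
apply: eq_big => v; rewrite ?groupMr // => vH.
rewrite -ga_scalerAl -eltM scalerA fM // mulrCA [f u^-1%g * _]mulrC.
by rewrite homV // mulr1.
Qed.

Lemma lin_idemK : lin_idem * lin_idem = lin_idem.
Proof.
rewrite {1}/lin_idem -ga_scalerAl mulr_suml.
rewrite (eq_bigr (fun _ => lin_idem)) => [|u uH]; last first.
  by rewrite -ga_scalerAl elt_lin_idem // scalerA homV // scale1r.
by rewrite sumr_const -scaler_nat scalerA mulVr ?scale1r.
Qed.

Lemma coef_lin_idem a g :
  ga_coef (lin_idem * a) g =
    (#|H|%:R)^-1 * \sum_(u in H) f u * ga_coef a (u^-1 * g)%g.
Proof.
rewrite /lin_idem -ga_scalerAl coefZ mulr_suml coef_sum; congr (_ * _).
by apply: eq_bigr => u _; rewrite -ga_scalerAl coefZ coef_eltl.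
Qed.

Lemma coef_lin_idem_mul a u g : u \in H ->
  ga_coef (lin_idem * a) (u * g)%g = f u * ga_coef (lin_idem * a) g.
Proof.
move=> uH; have := coef_eltl u^-1%g (lin_idem * a) g; rewrite invgK => <-.
by rewrite mulrA elt_lin_idem ?groupV // -ga_scalerAl coefZ invgK.
Qed.

End LinearIdempotent.

Lemma antipode_lin_idem (R : idomainType) (gT : finGroupType) (H : {group gT})
    (f f' : gT -> R) :
  {in H, forall u, f' u = f u^-1%g} -> antipode (lin_idem H f) = lin_idem H f'.
Proof.
move=> ff'; rewrite /lin_idem antipodeZ antipode_sum; congr (_ *: _).
rewrite [RHS](reindex_inj invg_inj) /=; apply: eq_big => u; rewrite ?groupV // => uH.
by rewrite antipodeZ antipode_elt ff' ?groupV // invgK.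
Qed.

(** * Linear characters and the line of eigenvectors *)

Section Characters.
Variables (N : nat) (F : finFieldType) (R : idomainType).
Local Notation n := N.+1.
Local Notation G := (GLg N F).
Local Notation A := (group_algebra R G).
Local Notation elt := (@ga_elt R G).
Local Notation U := (unipotent N F).
Local Notation eps := (stein N F R).
Local Notation pm := (@pm N F).
Local Notation mat := (@mat N F).
Local Notation sgn := (@sgn N R).
Local Notation w0 := (perm (@rev_ord_inj n)).
Implicit Types (g h u v : G) (s t : 'S_n) (i j : 'I_n) (a : A) (c : nat -> F).

Variable psi : F -> R.
Hypothesis psiD : forall x y, psi (x + y) = psi x * psi y.
Hypothesis psi0 : psi 0 = 1.
Hypothesis psi_nontrivial : exists x, psi x != 1.
Hypothesis q_unit : (#|F|%:R : R) \is a GRing.unit.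
Hypothesis R_two : forall r : R, r + r = 0 -> r = 0.

Lemma psi_sum_eq0 : \sum_(x : F) psi x = 0.
Proof.
have [z fz] := psi_nontrivial.
have : psi z * \sum_x psi x = \sum_x psi x.
  by rewrite mulr_sumr [RHS](reindex_inj (addrI z)) /=; apply: eq_bigr => x _; rewrite psiD.
move/eqP; rewrite -subr_eq0 -{2}[\sum_x _]mul1r -mulrBl mulf_eq0.
by rewrite subr_eq0 (negPf fz) => /eqP.
Qed.

(** Indexed by [nat] to spare casts; only [k < N] is meaningful. *)
Definition sd g (k : nat) : F := mat g (inord k) (inord k.+1).

Lemma sdM u v (k : nat) : (k < N)%N -> u \in U -> v \in U -> sd (u * v) k = sd u k + sd v k.
Proof.
move=> kN /unipotentP uU /unipotentP vU; rewrite /sd matM mxE.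
have ik : (inord k : 'I_n) = k :> nat by rewrite inordK // ltnW.
have ik' : (inord k.+1 : 'I_n) = k.+1 :> nat by rewrite inordK.
have ne : (inord k : 'I_n) != inord k.+1 by rewrite -val_eqE /= ik ik' ltn_eqF.
rewrite (bigD1 (inord k)) // (bigD1 (inord k.+1)) 1?eq_sym //=.
rewrite (uU (inord k) (inord k)) // (vU (inord k.+1) (inord k.+1)) // !eqxx.
rewrite mul1r mulr1 big1 ?addr0 1?addrC // => i /andP[ni ni'].
case: (leqP i k) => [le_ik|lt_ki].
  by rewrite uU ?ik // eq_sym (negPf ni) mul0r.
by rewrite vU ?ik' // (negPf ni') mulr0.
Qed.

Definition lam c g : R := psi (\sum_(k < N) c k * sd g k).

Lemma lamM c : {in U &, {morph lam c : u v / (u * v)%g >-> u * v}}.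
Proof.
move=> u v uU vU; rewrite /lam -psiD; congr psi.
transitivity (\sum_(k < N) (c k * sd u k + c k * sd v k)); last exact: big_split.
by apply: eq_bigr => k _; rewrite -mulrDr -sdM.
Qed.

Lemma lam1 c : lam c 1%g = 1.
Proof.
rewrite /lam big1 ?psi0 // => k _; rewrite /sd mat1 mxE -val_eqE /=.
by rewrite !inordK ?ltn_eqF ?mulr0 // ltnS // ltnW.
Qed.

Lemma lamV c u : u \in U -> lam c u * lam c u^-1 = 1.
Proof. by move=> uU; rewrite -lamM ?groupV // mulgV lam1. Qed.

Lemma lamN c u : u \in U -> lam (fun k => - c k) u = lam c u^-1.
Proof.
move=> uU; have e := lamV c uU.
have : lam c u * lam (fun k => - c k) u = 1.
  rewrite /lam -psiD -psi0; congr psi; rewrite -big_split big1 //= => k _.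
  by rewrite -mulrDl subrr mul0r.
rewrite -e => /mulfI; apply; apply/eqP => l0; move: e.
by rewrite l0 mul0r => /esym/eqP; rewrite oner_eq0.
Qed.

Lemma lam_ext c c' u : (forall k, (k < N)%N -> c k = c' k) -> lam c u = lam c' u.
Proof. by move=> e; congr psi; apply: eq_bigr => k _; rewrite e. Qed.

Lemma card_unipotent_unit : (#|U|%:R : R) \is a GRing.unit.
Proof. by rewrite card_unipotent natrX unitrX. Qed.

(** [U] acts on the image of this projection by the inverse of [lam c]. *)
Definition eig c : A := lin_idem (unipotent_group N F) (lam c).

Lemma eig_ext c c' : (forall k, (k < N)%N -> c k = c' k) -> eig c = eig c'.
Proof. by move=> e; congr (_ *: _); apply: eq_bigr => u _; rewrite (lam_ext _ e). Qed.

Lemma eig_elt c u : u \in U -> eig c * elt u = lam c u^-1 *: eig c.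
Proof. exact: (lin_idem_elt (@lamM c) (lam1 c)). Qed.

Lemma eig_idem c : eig c * eig c = eig c.
Proof. exact: (lin_idemK (@lamM c) (lam1 c) card_unipotent_unit). Qed.

Lemma antipode_eig c : antipode (eig c) = eig (fun k => - c k).
Proof. by apply: antipode_lin_idem => u; apply: lamN. Qed.

Lemma coef_eig_mul c a u g : u \in U ->
  ga_coef (eig c * a) (u * g)%g = lam c u * ga_coef (eig c * a) g.
Proof. exact: (coef_lin_idem_mul (@lamM c) (lam1 c)). Qed.

(** Only the elements of [U] that fix the coset of [s] contribute, each with the
    same sign; for a suitable [s] this shows that the eigenvector is nonzero. *)
Lemma coef_eig_eps_pm c s :
  {in unipotent_sub F s, forall u, lam c u = 1} ->
  ga_coef (eig c * eps) (pm s) = (#|U|%:R)^-1 * sgn s * #|unipotent_sub F s|%:R.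
Proof.
move=> c1; rewrite coef_lin_idem; set v := _^-1; rewrite -[RHS]mulrA; congr (v * _).
rewrite -sumr_const mulr_sumr.
rewrite (bigID (fun u => u \in unipotent_sub F s)) /= addrC big1 ?add0r => [|u]; last first.
  move=> /andP[uU us]; have uV := groupVr uU.
  rewrite (coef_eps_cell R s uV) -unipotent_subE //.
  by rewrite (@groupV _ (unipotent_sub_group F s)) (negPf us) !mulr0.
apply: eq_big => u; first by rewrite andb_idl // in_setI => /andP[].
case/andP => uU us; have uV := groupVr uU.
rewrite c1 // mul1r (coef_eps_cell R s uV) -unipotent_subE //.
by rewrite (@groupV _ (unipotent_sub_group F s)) us mulr1.
Qed.

Lemma unipotent_sub_rev : unipotent_sub F w0 = [set 1%g].
Proof.
apply/eqP; rewrite eq_sym eqEcard sub1set cards1.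
have := card_unipotent_sub_rev F (1%g : 'S_n); rewrite mul1g unipotent_sub1.
rewrite -{2}[#|U|]muln1 => /eqP; rewrite eqn_pmul2l ?cardG_gt0 // => /eqP ->.
rewrite leqnn andbT; apply/unipotent_subP; split; first exact: group1.
by move=> i j; rewrite mat1 mxE; case: eqP => // ->; rewrite ltnn.
Qed.

Lemma coef_eig_eps_rev c : ga_coef (eig c * eps) (pm w0) = (#|U|%:R)^-1 * sgn w0.
Proof.
rewrite coef_eig_eps_pm unipotent_sub_rev ?cards1 ?mulr1 // => u /set1P ->.
exact: lam1.
Qed.

(** The eigenspace of [U] in the left ideal of [eps] is a line; this is the
    coordinate of the projection of [a * eps] on it. *)
Definition eig_coord c a : R :=
  #|U|%:R * sgn w0 * ga_coef (eig c * a * eps) (pm w0).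

Lemma eig_coordP c a : eig c * a * eps = eig_coord c a *: (eig c * eps).
Proof.
apply/eqP; rewrite -subr_eq0; apply/eqP.
apply: (@eigenvector_eq0 _ _ _ R_two (lam c) (eig c * (a - eig_coord c a *: (1 : A)))).
- by rewrite mulrBr mulrBl -ga_scalerAr mulr1 (ga_scalerAl (eig_coord c a) (eig c)).
- move: (eig_coord c a) => r u g uU.
  by rewrite !ga_coefD !coefN !coefZ -!mulrA !coef_eig_mul // mulrBr [r * (_ * _)]mulrCA.
rewrite ga_coefD coefN coefZ coef_eig_eps_rev /eig_coord.
have uK := mulrV card_unipotent_unit; have sK := sgn_sq R (perm (@rev_ord_inj n)).
set v := (#|U|%:R)^-1 in uK *; set X := ga_coef _ _.
suff -> : #|U|%:R * sgn w0 * X * (v * sgn w0) = (#|U|%:R * v) * (sgn w0 * sgn w0) * X.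
  by rewrite uK sK !mul1r subrr.
by ring.
Qed.

End Characters.

(** * Eigenvectors detect everything *)

Section Mirabolic.
Variables (N : nat) (F : finFieldType) (R : idomainType).
Local Notation n := N.+1.
Local Notation G := (GLg N F).
Local Notation A := (group_algebra R G).
Local Notation elt := (@ga_elt R G).
Local Notation U := (unipotent N F).
Local Notation mat := (@mat N F).
Local Notation pm := (@pm N F).
Implicit Types (g h u v : G) (a b : A) (k : nat) (c : nat -> F).

Variable psi : F -> R.
Hypothesis psiD : forall x y, psi (x + y) = psi x * psi y.
Hypothesis psi0 : psi 0 = 1.
Hypothesis psi_nontrivial : exists x, psi x != 1.
Hypothesis q_unit : (#|F|%:R : R) \is a GRing.unit.

Local Notation lam := (lam psi).

(** These subgroups lead from [U], for [k = 1], to the trivial group, for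
    [k = n]; passing from one to the next is the induction step below. *)
Definition trivial_columns k : {set G} :=
  [set u | [forall i : 'I_n, forall j : 'I_n,
     ((j < k) || (j <= i))%N ==> (mat u i j == (i == j)%:R)]].

Lemma trivial_columnsP k u : reflect
  (forall i j : 'I_n, ((j < k) || (j <= i))%N -> mat u i j = (i == j)%:R)
  (u \in trivial_columns k).
Proof.
rewrite inE; apply: (iffP forallP) => [uP i j kj|uP i].
  by have /forallP/(_ j) := uP i; rewrite kj => /eqP.
by apply/forallP => j; apply/implyP => kj; rewrite uP.
Qed.

Lemma trivial_columns1 : trivial_columns 1 = U.
Proof.
apply/setP => u; apply/trivial_columnsP/unipotentP => uP i j H.
  by rewrite uP // H orbT.
by case/orP: H => H; apply: uP => //; move: H; case: (j : nat).
Qed.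

Lemma trivial_columns_all : trivial_columns n = [set 1%g].
Proof.
apply/setP => u; rewrite in_set1; apply/trivial_columnsP/eqP => [uP|-> i j _].
  by apply: mat_inj; apply/matrixP => i j; rewrite uP ?ltn_ord // mat1 mxE.
by rewrite mat1 mxE.
Qed.

(** A copy of the general linear group of rank [k]; it normalises
    [trivial_columns k] and permutes the characters of column [k]. *)
Definition corner_group k : {set G} :=
  [set h | [forall i : 'I_n, forall j : 'I_n,
     ((k <= i) || (k <= j))%N ==> (mat h i j == (i == j)%:R)]].

Lemma corner_groupP k h : reflect
  (forall i j : 'I_n, ((k <= i) || (k <= j))%N -> mat h i j = (i == j)%:R)
  (h \in corner_group k).
Proof.
rewrite inE; apply: (iffP forallP) => [uP i j kj|uP i].
  by have /forallP/(_ j) := uP i; rewrite kj => /eqP.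
by apply/forallP => j; apply/implyP => kj; rewrite uP.
Qed.

Lemma corner_row k h v (i j : 'I_n) : h \in corner_group k -> (k <= i)%N ->
  mat (h * v)%g i j = mat v i j.
Proof.
move=> /corner_groupP hP ki; rewrite matM mxE (bigD1 i) //= hP ?ki // eqxx mul1r.
by rewrite big1 ?addr0 // => m mi; rewrite hP ?ki // eq_sym (negPf mi) mul0r.
Qed.

Lemma corner_col k h v (i j : 'I_n) : h \in corner_group k -> (k <= j)%N ->
  mat (v * h)%g i j = mat v i j.
Proof.
move=> /corner_groupP hP kj; rewrite matM mxE (bigD1 j) //= hP ?kj ?orbT // eqxx mulr1.
by rewrite big1 ?addr0 // => m mj; rewrite hP ?kj ?orbT // (negPf mj) mulr0.
Qed.

Fact corner_group_set k : group_set (corner_group k).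
Proof.
apply/group_setP; split; first by apply/corner_groupP => i j _; rewrite mat1 mxE.
move=> g h gP hP; apply/corner_groupP => i j; have /corner_groupP gE := gP.
have /corner_groupP hE := hP => /orP[ki|kj].
  by rewrite (corner_row _ _ gP) // hE ?ki.
by rewrite (corner_col _ _ hP) // gE ?kj ?orbT.
Qed.
Canonical corner_group_group k := group (corner_group_set k).

Lemma corner_norm k h v : h \in corner_group k -> v \in trivial_columns k ->
  (h * v * h^-1)%g \in trivial_columns k.
Proof.
move=> hP vP; have hVP := groupVr hP.
have /trivial_columnsP vE := vP; apply/trivial_columnsP => i j.
case: (ltnP j k) => [jk _|kj ji']; last first.
  have ji : (j <= i)%N := ji'.
  rewrite (corner_col _ _ hVP) // (corner_row _ _ hP) ?(leq_trans kj) //.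
  by rewrite vE // ji orbT.
have -> : (i == j)%:R = mat (h * h^-1)%g i j by rewrite mulgV mat1 mxE.
rewrite (matM (h * v)%g) (matM h) [LHS]mxE [RHS]mxE; apply: eq_bigr => m _.
case: (ltnP m k) => [mk|km]; last first.
  have /corner_groupP -> := hVP; last by rewrite km.
  by rewrite -val_eqE gtn_eqF ?mulr0 //= (leq_trans jk).
congr (_ * _); rewrite mxE (bigD1 m) //= vE ?mk // eqxx mulr1.
by rewrite big1 ?addr0 // => l lm; rewrite vE ?mk // (negPf lm) mulr0.
Qed.

(** Nonzero row vectors form a single orbit, so each one is the last row of some
    invertible matrix up to a scalar; the scalar also covers [d = 0]. *)
Lemma corner_transitive k (d : {ffun 'I_k.+1 -> F}) : (k.+1 <= n)%N ->
  exists h x, h \in corner_group k.+1 /\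
    forall m : 'I_k.+1, x * mat h (inord k) (inord m) = d m.
Proof.
move=> kn; (* For [d m0 != 0] take the identity matrix with row [m0] replaced by the multiple
   of [d] that keeps the diagonal entry, and move this row to the end. *)
have [d0|] := pselect (forall m, d m = 0).
  by exists 1%g, 0; split=> [|m]; rewrite ?group1 // mul0r d0.
move=> /existsNP[m0 /eqP dm0].
pose i0 : 'I_n := inord m0.
have ordK (m : 'I_k.+1) : (inord m : 'I_n) = m :> nat.
  by rewrite inordK // (leq_trans (ltn_ord m)).
have i0k : (i0 < k.+1)%N by rewrite ordK.
pose r : 'rV[F]_n :=
  \row_m ((if (m < k.+1)%N then d (inord m) / d m0 else 0) - (i0 == m)%:R).
pose E (s : F) : 'M[F]_n := 1%:M + s *: (delta_mx i0 (0 : 'I_1) *m r).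
have ri0 : r 0 i0 = 0.
  rewrite mxE i0k eqxx; have -> : inord i0 = m0 by apply: val_inj; rewrite /= ordK inordK.
  by rewrite divff // subrr.
have rr : delta_mx i0 (0 : 'I_1) *m r *m (delta_mx i0 (0 : 'I_1) *m r) = 0.
  rewrite mulmxA -[_ *m r *m delta_mx _ _]mulmxA.
  have -> : r *m delta_mx i0 (0 : 'I_1) = 0.
    apply/matrixP => a b; rewrite !ord1 mxE (bigD1 i0) //= ri0 mul0r add0r mxE big1 // => m mi.
    by rewrite [delta_mx _ _ _ _]mxE (negPf mi) mulr0.
  by rewrite mulmx0 mul0mx.
have uE : E 1 \in unitmx.
  suff /mulmx1_unit[] : E 1 *m E (- 1) = 1%:M by [].
  rewrite /E mulmxDl !mul1mx mulmxDr mulmx1 -scalemxAl -scalemxAr rr.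
  by rewrite !scaler0 addr0 -addrA -scalerDl addNr scale0r addr0.
have [T TE] := mat_surj uE.
have Tij (i j : 'I_n) : mat T i j = (i == j)%:R + (if i == i0 then r 0 j else 0).
  rewrite TE /E scale1r mxE [1%:M _ _]mxE; congr (_ + _).
  rewrite mxE big_ord1 [delta_mx _ _ _ _]mxE eqxx andbT.
  by case: eqP; rewrite ?mul1r ?mul0r.
pose k0 : 'I_n := inord k; have k0E : k0 = k :> nat by rewrite inordK.
exists (pm (tperm i0 k0) * T)%g, (d m0); split.
  apply/corner_groupP => i j kij; rewrite mat_pml Tij.
  have rj : (k.+1 <= j)%N -> r 0 j = 0.
    move=> kj; rewrite mxE ltnNge kj /= -val_eqE ltn_eqF ?subrr //.
    exact: leq_trans kj.
  case: (leqP k.+1 i) kij => [ki _ | ik /= kj].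
    have i0i : (i0 < i)%N by apply: leq_trans ki.
    have k0i : (k0 < i)%N by rewrite k0E.
    have ni0 : i0 != i by rewrite -val_eqE ltn_eqF.
    have nk0 : k0 != i by rewrite -val_eqE ltn_eqF.
    by rewrite tpermD // [i == i0]eq_sym (negPf ni0) addr0.
  rewrite rj // if_same addr0 -!val_eqE /= !ltn_eqF ?(leq_trans _ kj) //.
  by case: tpermP => _ //; rewrite ?k0E.
move=> m; rewrite mat_pml tpermR Tij eqxx mxE ordK ltn_ord addrC subrK.
have -> : inord m = m by apply: val_inj; rewrite /= inordK.
by rewrite mulrC divfK.
Qed.

(** Orthogonality of the characters of the additive group [F ^ k]. *)
Lemma psi_sum_pairing k (x : 'I_k -> F) :
  \sum_(d : {ffun 'I_k -> F}) psi (\sum_(i < k) d i * x i)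
  = if [forall i, x i == 0] then #|F|%:R ^+ k else 0.
Proof.
have psi_big (d : {ffun 'I_k -> F}) : psi (\sum_i d i * x i) = \prod_i psi (d i * x i).
  by apply: (big_morph psi psiD psi0).
under eq_bigr => d _ do rewrite psi_big.
rewrite -(bigA_distr_bigA (fun i y => psi (y * x i))) /=.
have line i : \sum_(y : F) psi (y * x i) = if x i == 0 then #|F|%:R else 0.
  case: eqP => [->|/eqP xi].
    under eq_bigr => y _ do rewrite mulr0 psi0.
    by rewrite sumr_const.
  by rewrite -[RHS](psi_sum_eq0 psiD psi_nontrivial) [RHS](reindex_inj (mulIf xi)).
under eq_bigr => i _ do rewrite line.
case: (boolP [forall i, _]) => [/forallP x0|].
  rewrite (eq_bigr (fun _ => #|F|%:R)) => [|i _]; last by rewrite x0.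
  by rewrite prodr_const card_ord.
rewrite negb_forall => /existsP[i xi].
by rewrite (bigD1 i) //= (negPf xi) mul0r.
Qed.

Definition column_sum k c : A := \sum_(u in trivial_columns k) lam c u *: elt u.

(** The characters of the elementary abelian group of column [k] are permuted
    by the corner group, and every orbit contains one that only sees the entry
    above the diagonal; summing over all characters isolates the elements with
    trivial column [k]. *)
Lemma column_sum_step k c : (k < N)%N ->
  exists (h : {ffun 'I_k.+1 -> F} -> G) (c' : {ffun 'I_k.+1 -> F} -> nat -> F),
    #|F|%:R ^+ k.+1 *: column_sum k.+2 c =
    \sum_d elt (h d)^-1%g * column_sum k.+1 (c' d) * elt (h d).
Proof.
move=> kN; have kn : (k.+1 < n)%N by [].
have /choice[h /choice[x hx]] := fun d => @corner_transitive k d (ltnW kn).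
pose c' d (j : nat) : F := if (j < k)%N then 0 else if j == k then x d else c j.
exists h, c'; pose k1 : 'I_n := inord k.+1; have k1E : k1 = k.+1 :> nat by rewrite inordK.
have conj d : elt (h d)^-1%g * column_sum k.+1 (c' d) * elt (h d) =
    \sum_(v in trivial_columns k.+1)
      (lam (fun j => if (j < k.+1)%N then 0 else c j) v *
       psi (\sum_(i < k.+1) d i * mat v (inord i) k1)) *: elt v.
  have [hP hd] := hx d; have hVP := groupVr hP.
  rewrite mulr_sumr mulr_suml (reindex_inj (conjg_inj (h d)^-1%g)) /=.
  apply: eq_big => v; rewrite conjgE invgK mulgA.
    apply/idP/idP => vP; last exact: corner_norm.
    have -> : v = ((h d)^-1 * (h d * v * (h d)^-1) * (h d)^-1^-1)%g.
      by rewrite invgK !mulgA mulVg mul1g -mulgA mulVg mulg1.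
    exact: corner_norm hVP vP.
  move=> wP; rewrite -ga_scalerAr -ga_scalerAl -!eltM.
  have -> : ((h d)^-1 * (h d * v * (h d)^-1) * h d)%g = v.
    by rewrite !mulgA mulVg mul1g -mulgA mulVg mulg1.
  congr (_ *: _); rewrite /lam -psiD; congr psi.
  set w := (h d * v * _)%g in wP *; have /trivial_columnsP wE := wP.
  have wv (i j : 'I_n) : (k.+1 <= j)%N -> mat w i j = mat (h d * v)%g i j.
    by move=> kj; rewrite (corner_col _ _ hVP).
  have sdw (j : 'I_N) : (k < j)%N -> sd w j = sd v j.
    move=> kj; have jn : (j < n)%N by rewrite ltnW // ltnS.
    rewrite /sd wv; first by rewrite (corner_row _ _ hP) // inordK.
    by rewrite inordK ?ltnS // ltnW.
  rewrite (bigD1 (Ordinal kN)) //= [in RHS](bigD1 (Ordinal kN)) //=.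
  rewrite ltnSn mul0r add0r addrC; congr (_ + _).
    apply: eq_bigr => j jk; rewrite /c'; have := jk; rewrite -val_eqE /= => /negPf ->.
    case: (ltngtP (j : nat) k) => [lt_jk|kj|e].
    - by rewrite (ltn_trans lt_jk) // !mul0r.
    - by rewrite ltnNge kj /= sdw.
    by move: jk; rewrite -val_eqE /= e eqxx.
  rewrite /c' ltnn eqxx /sd wv ?k1E // matM mxE mulr_sumr.
  rewrite (bigID (fun m : 'I_n => (m < k.+1)%N)) /= addrC big1 ?add0r => [|m km]; last first.
    rewrite -leqNgt in km; have /corner_groupP -> := hP; last by rewrite km orbT.
    rewrite -val_eqE /= inordK ?ltn_eqF ?mul0r ?mulr0 //; exact: ltnW.
  rewrite (reindex_onto (fun i : 'I_k.+1 => inord i : 'I_n) (fun m : 'I_n => inord m : 'I_k.+1)) /=; last first.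
    by move=> m mk; apply: val_inj; rewrite /= !inordK.
  apply: eq_big => i.
    have iE : (inord i : 'I_n) = i :> nat by rewrite inordK // (leq_trans (ltn_ord i) (ltnW kn)).
    by rewrite iE ltn_ord inord_val eqxx.
  by move=> _; rewrite mulrA hd.
under [RHS]eq_bigr => d _ do rewrite conj.
rewrite exchange_big /= scaler_sumr [RHS](bigID (fun v => v \in trivial_columns k.+2)) /=.
rewrite [X in _ = _ + X]big1 ?addr0 => [|v /andP[vP vN]]; last first.
  rewrite -scaler_suml -mulr_sumr psi_sum_pairing ifF ?mulr0 ?scale0r //.
  apply: contraNF vN => /forallP v0; apply/trivial_columnsP => i j.
  have /trivial_columnsP vE := vP; rewrite ltnS [(j <= k.+1)%N]leq_eqVlt => /orP[/orP[/eqP jk|jk]|ji].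
  - case: (leqP j i) => ji; first by rewrite vE // ji orbT.
    have ik : (i < k.+1)%N by rewrite -jk.
    have := v0 (Ordinal ik); rewrite /= inord_val.
    have -> : k1 = j by apply: val_inj; rewrite /= k1E.
    by move/eqP ->; rewrite -val_eqE ltn_eqF.
  - by apply: vE; rewrite jk.
  by apply: vE; rewrite ji orbT.
apply: eq_big => v.
  rewrite andb_idl // => /trivial_columnsP vE; apply/trivial_columnsP => i j /orP[jk|ji].
    by apply: vE; rewrite ltnW.
  by apply: vE; rewrite ji orbT.
move=> /trivial_columnsP vE.
rewrite -scaler_suml -mulr_sumr psi_sum_pairing ifT; last first.
  apply/forallP => i; rewrite vE ?k1E ?leqnn //.
  by rewrite -val_eqE /= k1E inordK ?ltn_eqF // ltnW // ltnS (leq_trans (ltn_ord i)) // ltnW.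
rewrite scalerA mulrC; congr ((psi _ * _) *: _); apply: eq_bigr => j _.
case: ltnP => // jk; have jn : (j.+1 < n)%N by rewrite ltnS ltn_ord.
rewrite /sd vE; last by rewrite inordK // ltnS jk.
by rewrite -val_eqE /= !inordK ?(ltnW jn) // ltn_eqF // mulr0 mul0r.
Qed.

(** Descend along the subgroups [trivial_columns]: the trivial group gives [a]
    itself, and the sum over one subgroup is recovered, through conjugates, from
    sums over the next larger one.  So [a] lies in the left ideal generated by
    the projections of its multiples on the eigenspaces of [U]. *)
Lemma eig_generate (X : A -> Prop) :
  X 0 -> (forall a b, X a -> X b -> X (a + b)) -> (forall a b, X b -> X (a * b)) ->
  forall a, (forall c b, X (eig N psi c * b * a)) -> X a.
Proof.
move=> X0 XD XM.
have XZ (r : R) a : X a -> X (r *: a).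
  by move=> Xa; rewrite -[a]mul1r ga_scalerAl; apply: XM.
have step k : (k <= N)%N -> forall a, (forall c b, X (column_sum (N - k).+1 c * b * a)) -> X a.
  elim: k => [|k IH] kN a Xa.
    have := Xa (fun _ => 0) 1; rewrite subn0 /column_sum trivial_columns_all.
    by rewrite big_set1 (lam1 N psi0) scale1r mulr1 mul1r.
  apply: (IH (ltnW kN)) => c b; pose k' := (N - k.+1)%N.
  have ek : (N - k = k'.+1)%N by rewrite /k' -subSn.
  have k'N : (k' < N)%N by rewrite /k' ltn_subrL (leq_trans _ kN).
  have [h [c' e]] := column_sum_step c k'N.
  have -> : column_sum (N - k).+1 c * b * a =
      (#|F|%:R ^+ k'.+1)^-1 *: ((#|F|%:R ^+ k'.+1 *: column_sum k'.+2 c) * (b * a)).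
    by rewrite ek -ga_scalerAl scalerA mulVr ?unitrX // scale1r mulrA.
  apply: XZ; rewrite e mulr_suml; apply: (big_ind X) => // d _.
  by rewrite -!mulrA; apply: XM; have := Xa (c' d) (elt (h d) * b); rewrite -!mulrA.
move=> a Xa; apply: (step N) => // c b; have := Xa c b.
have -> : eig N psi c = (#|U|%:R)^-1 *: column_sum 1 c.
  by rewrite /column_sum trivial_columns1.
rewrite subnn -!ga_scalerAl => /(XZ #|U|%:R); rewrite scalerA.
by rewrite (mulrV (card_unipotent_unit N q_unit)) scale1r.
Qed.

End Mirabolic.

(** * Indices of parabolic subgroups *)

Section BlockParabolic.
Variables (N : nat) (F : finFieldType).
Local Notation n := N.+1.
Local Notation G := (GLg N F).
Local Notation B := (upper_triangular N F).
Local Notation mat := (@mat N F).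
Local Notation pm := (@pm N F).
Local Notation w0 := (perm (@rev_ord_inj n)).
Implicit Types (g h u v : G) (s t : 'S_n).

Variable blk : nat -> nat.
Hypothesis blk_mono : forall i j, (i <= j)%N -> (blk i <= blk j)%N.

Definition block_group : {set G} :=
  [set g | [forall i : 'I_n, forall j : 'I_n,
     (blk j < blk i)%N ==> (mat g i j == 0)]].

Lemma block_groupP g : reflect
  (forall i j : 'I_n, (blk j < blk i)%N -> mat g i j = 0) (g \in block_group).
Proof.
rewrite inE; apply: (iffP forallP) => [gP i j ji|gP i].
  by have /forallP/(_ j) := gP i; rewrite ji => /eqP.
by apply/forallP => j; apply/implyP => ji; rewrite gP.
Qed.

Fact block_group_set : group_set block_group.
Proof.
apply/group_setP; split.
  by apply/block_groupP => i j; rewrite mat1 mxE; case: eqP => // ->; rewrite ltnn.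
move=> g h /block_groupP gP /block_groupP hP; apply/block_groupP => i j ji.
rewrite matM mxE big1 // => k _; case: (ltnP (blk k) (blk i)) => ki.
  by rewrite gP // mul0r.
by rewrite hP ?mulr0 // (leq_trans ji).
Qed.
Canonical block_group_group := group block_group_set.

Lemma borel_block_group : B \subset block_group.
Proof.
apply/subsetP => g /borelP gB; apply/block_groupP => i j ji; apply: gB.
by rewrite ltnNge; apply: contraL ji => /blk_mono; rewrite -leqNgt.
Qed.

(** These are the shortest representatives of the cosets of the group of
    permutations that preserve the blocks. *)
Definition ascending t :=
  [forall i : 'I_n, forall j : 'I_n, (i < j)%N ==> (blk i == blk j) ==> (t i < t j)%N].

Lemma ascendingP t : reflect
  (forall i j : 'I_n, (i < j)%N -> blk i = blk j -> (t i < t j)%N) (ascending t).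
Proof.
apply: (iffP forallP) => [tP i j ij e|tP i].
  by have /forallP/(_ j) := tP i; rewrite ij e eqxx.
by apply/forallP => j; apply/implyP => ij; apply/implyP => /eqP e; apply: tP.
Qed.

Lemma ascending_adjacent t :
  (forall k k' : 'I_n, k' = k.+1 :> nat -> blk k = blk k' -> (t k < t k')%N) ->
  ascending t.
Proof.
move=> tS; apply/ascendingP => i j; move: {2}(j : nat) (erefl (j : nat)) => m.
elim: m j => [|m IH] j ej; first by rewrite ej.
have mn : (m < n)%N by rewrite ltnW // -ej.
rewrite ej ltnS leq_eqVlt => /orP[/eqP im|im] e.
  by apply: tS; [rewrite ej im | rewrite e ej].
have e' : blk i = blk m.
  by apply/eqP; rewrite eqn_leq blk_mono ?(ltnW im) //= e blk_mono.
apply: ltn_trans (IH (Ordinal mn) (erefl _) im e') _.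
by apply: tS; [rewrite ej | rewrite -e' e ej].
Qed.

Lemma pm_block_group s : (forall i : 'I_n, blk (s i) = blk i) -> pm s \in block_group.
Proof.
move=> sP; apply/block_groupP => i j ji; rewrite mat_pm !mxE.
by case: (s i =P j) ji => [<-|//]; rewrite sP ltnn.
Qed.

(** Among the representatives in the coset of block-preserving permutations, the
    one maximising the sum of the [i * t i] is increasing on each block. *)
Lemma double_coset_exists g : exists t p b,
  [/\ ascending t, p \in block_group, b \in B & g = (p * pm t * b)%g].
Proof.
have [u [s [b [uU bB ->]]]] := bruhat g.
pose W := [set w : 'S_n | [forall i : 'I_n, blk (w i) == blk i]].
have W1 : 1%g \in W by rewrite inE; apply/forallP => i; rewrite perm1.
case: (arg_maxnP (fun w : 'S_n => \sum_(i < n) i * (w * s)%g i)%N W1) => w wW wmax.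
have wP (i : 'I_n) : blk (w i) = blk i.
  by have : w \in W := wW; rewrite inE => /forallP/(_ i)/eqP.
exists (w * s)%g, (u * pm w^-1)%g, b; split=> //.
- apply: ascending_adjacent => k k' kk' e.
  rewrite ltnNge; apply/negP; rewrite leq_eqVlt => /orP[/eqP/val_inj/perm_inj ek|lt_t].
    by move: kk'; rewrite ek; lia.
  have kw : (tperm k k' * w)%g \in W.
    by rewrite inE; apply/forallP => i; rewrite permM wP; case: tpermP => [->|->|]; rewrite // e.
  have /= := wmax _ kw; rewrite -mulgA leqNgt => /negP[].
  have := tperm_adjacent_sum (t := (tperm k k' * (w * s))%g) kk'.
  by rewrite [(tperm _ _ * (tperm _ _ * _))%g]mulgA tperm2 mul1g !(permM (tperm _ _)) tpermL tpermR; apply.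
- rewrite groupM //; first by rewrite (subsetP borel_block_group) ?(subsetP (unipotent_borel _ _)).
  by apply: pm_block_group => i; rewrite -{2}(permKV w i) wP.
by rewrite pmM !mulgA pmV mulgKV.
Qed.

(** The diagonal of [b] bounds the blocks of one permutation by those of the
    other; hence both differ by a permutation preserving the blocks, which is
    increasing on each of them. *)
Lemma double_coset_unique t t' p b : ascending t -> ascending t' ->
  p \in block_group -> b \in B -> pm t' = (p * pm t * b)%g -> t = t'.
Proof.
move=> /ascendingP tA /ascendingP t'A pP bB e.
have bV : (b^-1 = pm t'^-1 * p * pm t)%g.
  apply: (mulIg b); rewrite mulVg -!mulgA [(p * _)%g]mulgA -e pmV mulVg //.
have le_blk (i : 'I_n) : (blk (t'^-1%g i) <= blk (t^-1%g i))%N.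
  have := borel_diag i (groupVr bB : b^-1%g \in B).
  rewrite bV mat_pmr mat_pml leqNgt; apply: contra => lt_blk.
  by have /block_groupP -> := pP.
have blkE := perm_dominated (f := fun i : 'I_n => blk i) le_blk.
have rP (j : 'I_n) : blk (t'^-1%g (t j)) = blk j by rewrite blkE permK.
suff e1 : (t * t'^-1)%g = 1%g by rewrite -[t]mulg1 -(mulVg t') mulgA e1 mul1g.
apply: perm_ascending_id => i j ij; rewrite !permM.
have [lt_blk|gt_blk|eq_blk] := ltngtP (blk i) (blk j).
- rewrite ltnNge; apply/negP => /blk_mono; rewrite !rP leqNgt.
  by rewrite lt_blk.
- by move: (blk_mono (ltnW ij)); rewrite leqNgt gt_blk.
have lt_t := tA _ _ ij eq_blk; rewrite ltnNge; apply/negP.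
rewrite leq_eqVlt => /orP[/eqP/val_inj/perm_inj ej|lt_r].
  by move: lt_t; rewrite ej ltnn.
have := t'A _ _ lt_r; rewrite !rP !permKV eq_blk => /(_ erefl).
by rewrite ltnNge ltnW.
Qed.

(** Decompose the group into double cosets [P t B].  For a shortest
    representative [t], the intersection of the parabolic with the conjugate
    of the Borel subgroup is contained in the Borel subgroup. *)
Lemma index_block_group :
  #|[set: G] : block_group|%g = (\sum_(t | ascending t) #|unipotent_sub F (t * w0)|)%N.
Proof.
pose D t : {set G} := (block_group * (B :^ (pm t)^-1))%g.
have memD t g : (g * (pm t)^-1 \in D t)%g <->
    exists p b, [/\ p \in block_group, b \in B & g = (p * pm t * b)%g].
  split=> [/mulsgP[p b' pP]|[p [b [pP bB ->]]]].
    rewrite mem_conjgV => bB e; exists p, (b' ^ pm t)%g; split=> //.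
    apply: (mulIg (pm t)^-1%g); rewrite e conjgE !mulgA mulgK mulgK //.
  apply/mulsgP; exists p (b ^ (pm t)^-1)%g => //; first by rewrite memJ_conjg.
  by rewrite conjgE invgK !mulgA.
have cardD t : ascending t -> #|D t| = (#|block_group| * #|unipotent_sub F (t * w0)|)%N.
  move=> /ascendingP tA.
  have q_gt1 : (1 < #|F|)%N by exact: card_finNzRing_gt1.
  have Iq : (0 < #|F|.-1 ^ n * #|F| ^ #|noninversions t|)%N.
    by rewrite muln_gt0 !expn_gt0 -ltnS prednK ?q_gt1 //= ?(ltnW q_gt1).
  apply/eqP; rewrite -(eqn_pmul2r Iq) -card_borel_sub.
  have E : (B :&: (B :^ (pm t)^-1) = block_group :&: (B :^ (pm t)^-1))%g.
    apply/eqP; rewrite eqEsubset setSI ?borel_block_group //=.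
    apply/subsetP => g; rewrite !in_setI => /andP[/block_groupP gP gB].
    rewrite gB andbT; apply/borelP => i j ji.
    have := blk_mono (ltnW ji); rewrite leq_eqVlt => /orP[/eqP e|]; last exact: gP.
    move: gB; rewrite mem_conjgV conjgE -pmV => /borelP gB.
    have := gB _ _ (tA _ _ ji e).
    by rewrite mat_pml mat_pmr !permK.
  rewrite {1}E -(mul_cardG block_group_group (conjG_group (borel_group N F) (pm t)^-1)) /=.
  rewrite cardJg -mulnA; apply/eqP; congr (_ * _)%N.
  have := card_borel_sub F (1%g : 'S_n).
  rewrite pm1 invg1 conjsg1 setIid => ->; rewrite -card_unipotent.
  rewrite card_borel_sub -card_unipotent_sub [RHS]mulnCA; congr (_ * _)%N.
  by rewrite mulnC card_unipotent_sub_rev.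
have tot : (#|[set: G]| = \sum_(t | ascending t) #|D t|)%N.
  rewrite -sum1_card; under [RHS]eq_bigr => t _ do rewrite -sum1_card.
  rewrite (eq_bigr (fun g => \sum_(t | ascending t) (g * (pm t)^-1 \in D t)%g)%N) => [|g _]; last first.
    have [t [p [b [tA pP bB e]]]] := double_coset_exists g.
    have gt : (g * (pm t)^-1 \in D t)%g by apply/memD; exists p, b.
    rewrite (bigD1 t) //= gt big1 // => t' /andP[t'A]; apply: contraNeq.
    rewrite eqb0 negbK => /memD[p' [b' [p'P b'B e']]]; apply/eqP/esym.
    apply: (double_coset_unique (p := (p'^-1 * p)%g) (b := (b * b'^-1)%g)) => //.
    - by rewrite groupM ?groupV.
    - by rewrite groupM ?groupV.
    apply: (mulgI p'); apply: (mulIg b'); rewrite -e' e.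
    by rewrite !mulgA mulgV mul1g mulgKV.
  rewrite exchange_big /=; apply: eq_bigr => t _.
  rewrite (reindex_inj (mulIg (pm t))) /= [RHS]big_mkcond /=.
  by apply: eq_big => g; rewrite ?inE // => _; rewrite mulgK; case: (g \in D t).
apply/eqP; rewrite -(eqn_pmul2l (cardG_gt0 block_group_group)) /=.
rewrite (Lagrange (subsetT block_group_group)) tot big_distrr /=.
by apply/eqP; apply: eq_bigr => t tA; rewrite cardD.
Qed.

End BlockParabolic.

(** * The norm of an eigenvector *)

Section Norm.
Variables (N : nat) (F : finFieldType) (R : idomainType).
Local Notation n := N.+1.
Local Notation G := (GLg N F).
Local Notation A := (group_algebra R G).
Local Notation elt := (@ga_elt R G).
Local Notation U := (unipotent N F).
Local Notation eps := (stein N F R).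
Local Notation pm := (@pm N F).
Local Notation mat := (@mat N F).
Local Notation w0 := (perm (@rev_ord_inj n)).
Implicit Types (g h u v : G) (s t : 'S_n) (a : A) (c : nat -> F) (k : nat).

Variable psi : F -> R.
Hypothesis psiD : forall x y, psi (x + y) = psi x * psi y.
Hypothesis psi0 : psi 0 = 1.
Hypothesis psi_nontrivial : exists x, psi x != 1.
Hypothesis q_unit : (#|F|%:R : R) \is a GRing.unit.
Hypothesis R_two : forall r : R, r + r = 0 -> r = 0.

Local Notation lam := (lam psi).
Local Notation eig := (eig N psi).
Local Notation eig_coord := (eig_coord psi).

Definition form_elt : A := eps * signed_sum N F R.

(** The square length of the eigenvector [eig c * eps] for the invariant form
    whose Gram element is [form_elt], an element fixed by the antipode. *)
Definition norm c : R := ga_trace (eig c * form_elt).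

Lemma antipode_form_elt : antipode form_elt = form_elt.
Proof.
rewrite /form_elt steinberg_eltE !antipodeM antipode_signed_sum.
by rewrite (antipode_ga_sum R (borel_group N F)) mulrA.
Qed.

Lemma trace_eig_coord c a : ga_trace (eig c * a * form_elt) = eig_coord c a * norm c.
Proof.
rewrite /norm /form_elt mulrA (eig_coordP psiD psi0 q_unit R_two) -ga_scalerAl.
by rewrite ga_traceZ (mulrA (eig c)).
Qed.

Lemma norm_opp c : norm (fun k => - c k) = norm c.
Proof.
rewrite /norm -(antipode_eig N psiD psi0) -[in LHS]antipode_form_elt -antipodeM.
by rewrite ga_trace_antipode ga_traceC.
Qed.

(** Invariance of the form: matrix coefficients between two eigenlines in the
    two directions differ by the ratio of the norms. *)
Lemma eig_coord_symmetry c c' g :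
  eig_coord c (elt g * eig c') * norm c =
  eig_coord (fun k => - c' k) (elt g^-1%g * eig (fun k => - c k)) * norm c'.
Proof.
rewrite -[norm c']norm_opp -!trace_eig_coord -!(antipode_eig N psiD psi0).
rewrite -[in LHS]ga_trace_antipode antipodeM antipode_form_elt !antipodeM antipode_elt.
by rewrite ga_traceC !mulrA.
Qed.

Definition descending c t :=
  [forall k : 'I_N, (c k != 0) ==> (t (inord k.+1) < t (inord k))%N].

Lemma descendingP c t : reflect
  (forall k, (k < N)%N -> c k != 0 -> (t (inord k.+1) < t (inord k))%N)
  (descending c t).
Proof.
apply: (iffP forallP) => [cP k kN ck|cP k].
  by have := cP (Ordinal kN); rewrite ck.
by apply/implyP; apply: cP.
Qed.

Lemma lam_unipotent_sub c t : descending c t ->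
  {in unipotent_sub F t, forall u, lam c u = 1}.
Proof.
move=> /descendingP cP u /unipotent_subP[_ u0]; rewrite /lam -psi0; congr psi.
apply: big1 => k _; have [->|ck] := eqVneq (c k) 0; first by rewrite mul0r.
by rewrite /sd u0 ?mulr0 // cP.
Qed.

Lemma lam_sum_unipotent_sub c t :
  \sum_(u in unipotent_sub F t) lam c u =
    if descending c t then #|unipotent_sub F t|%:R else 0.
Proof.
case: ifPn => [cP|].
  rewrite (eq_bigr (fun _ => 1)) ?sumr_const // => u uP.
  exact: lam_unipotent_sub uP.
rewrite negb_forall => /existsP[k]; rewrite negb_imply -leqNgt => /andP[ck].
have kE : (inord k : 'I_n) = k :> nat by rewrite inordK // ltnW // ltnS ltn_ord.
have k1E : (inord k.+1 : 'I_n) = k.+1 :> nat by rewrite inordK // ltnS ltn_ord.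
have nk : (inord k : 'I_n) != inord k.+1 by rewrite -val_eqE /= kE k1E ltn_eqF.
rewrite leq_eqVlt val_eqE (inj_eq perm_inj) (negPf nk) /= => lt_t.
have [z pz] := psi_nontrivial; pose x := z / c k.
have sUs : unipotent_sub F t \subset U by apply: subsetIl.
apply: (hom_sum_eq0 (lamM psiD c) (K := unipotent_sub_group F t)
         (h := tv (inord k) (inord k.+1) x) sUs).
  apply/unipotent_subP; split; first by apply: tv_unipotent; rewrite kE k1E.
  move=> i j lt_ji; rewrite mat_tv // !mxE.
  case: (i =P j) lt_ji => [->|_ lt_ji]; first by rewrite ltnn.
  case: (i =P _) lt_ji => [->|_ _]; last by rewrite mulr0 addr0.
  by case: (j =P _) => [->|_ _]; rewrite ?mulr0 ?addr0 // ltnNge ltnW.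
suff -> : lam c (tv (inord k : 'I_n) (inord k.+1) x) = psi z by [].
rewrite /lam; congr psi; rewrite (bigD1 k) //= big1 ?addr0 => [|j jk].
  rewrite /sd mat_tv // !mxE (negPf nk) !eqxx add0r mulr1 /x mulrC divfK //.
have jE : (inord j : 'I_n) = j :> nat by rewrite inordK // ltnW // ltnS ltn_ord.
have j1E : (inord j.+1 : 'I_n) = j.+1 :> nat by rewrite inordK // ltnS ltn_ord.
rewrite /sd mat_tv // !mxE -!val_eqE /= jE j1E kE val_eqE (negPf jk).
by rewrite ltn_eqF // add0r mulr0 mulr0.
Qed.

(** This is the number of triangular groups [t B t^-1] containing [u]. *)
Lemma coef_form_elt u : u \in U ->
  ga_coef form_elt u = \sum_t (u \in unipotent_sub F t)%:R.
Proof.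
move=> uU; rewrite /form_elt /signed_sum mulr_sumr coef_sum [RHS](reindex_inj invg_inj).
apply: eq_bigr => t _ /=; rewrite -ga_scalerAr coefZ coef_eltr -pmV.
rewrite (coef_eps_cell R _ uU) -unipotent_subE // mulrA /sgn odd_permV.
by rewrite -/(sgn R t) sgn_sq mul1r.
Qed.

Lemma norm_sum c :
  norm c = (#|U|%:R)^-1 * \sum_(t | descending c t) #|unipotent_sub F t|%:R.
Proof.
rewrite /norm /ga_trace coef_lin_idem; set w := _^-1; congr (w * _).
rewrite (eq_bigr (fun u => \sum_t lam c u * (u \in unipotent_sub F t)%:R)) => [|u uU]; last first.
  rewrite mulg1 coef_form_elt ?groupV // mulr_sumr; apply: eq_bigr => t _.
  by rewrite (@groupV _ (unipotent_sub_group F t)).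
rewrite exchange_big [RHS]big_mkcond; apply: eq_bigr => t _ /=.
rewrite -lam_sum_unipotent_sub [RHS]big_mkcond [LHS]big_mkcond; apply: eq_bigr => u _ /=.
rewrite in_setI; case: (u \in U) => //=.
by case: (u \in _); rewrite ?mulr1 ?mulr0.
Qed.

(** The permutations with prescribed descents are the reversals of the shortest
    coset representatives, so the norm counts the cosets of a parabolic. *)
Lemma norm_index (blk : nat -> nat) c :
  (forall i j, (i <= j)%N -> (blk i <= blk j)%N) ->
  (forall k, (k < N)%N -> (c k != 0) = (blk k == blk k.+1)) ->
  norm c = (#|U|%:R)^-1 * #|[set: G] : block_group N F blk|%g%:R.
Proof.
move=> blk_mono cP; rewrite norm_sum (index_block_group N F blk_mono) natr_sum.
congr (_ * _); rewrite [LHS](reindex_inj (mulIg w0)) /=; apply: eq_bigl => t.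
have revE (i : 'I_n) : ((t * w0)%g i = n - (t i).+1 :> nat)%N by rewrite permM permE.
apply/descendingP/ascendingP => [dP|aP k kN ck].
  apply/ascendingP; apply: (ascending_adjacent blk_mono) => k k' kk' e.
  have kN : (k < N)%N by rewrite -ltnS -kk' ltn_ord.
  have := dP k kN; rewrite cP // -kk' e eqxx !revE !inord_val => /(_ isT).
  by move: (nat_of_ord (t k)) (nat_of_ord (t k')) => a b; lia.
have kE : (inord k : 'I_n) = k :> nat by rewrite inordK // ltnW.
have k1E : (inord k.+1 : 'I_n) = k.+1 :> nat by rewrite inordK.
have := aP (inord k) (inord k.+1); rewrite !kE !k1E ltnSn !revE => /(_ isT).
rewrite cP // in ck; move/(_ (eqP ck)).
have := ltn_ord (t (inord k)); have := ltn_ord (t (inord k.+1)).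
by move: (nat_of_ord (t (inord k))) (nat_of_ord (t (inord k.+1))) => x y; lia.
Qed.

End Norm.

(** * Linking eigenvectors *)

Section Link.
Variables (N : nat) (F : finFieldType) (R : idomainType).
Local Notation n := N.+1.
Local Notation G := (GLg N F).
Local Notation A := (group_algebra R G).
Local Notation elt := (@ga_elt R G).
Local Notation U := (unipotent N F).
Local Notation B := (upper_triangular N F).
Local Notation eps := (stein N F R).
Local Notation pm := (@pm N F).
Local Notation mat := (@mat N F).
Implicit Types (g h u v p b : G) (s t : 'S_n) (a : A) (c : nat -> F) (k : nat).

Variable psi : F -> R.
Hypothesis psiD : forall x y, psi (x + y) = psi x * psi y.
Hypothesis psi0 : psi 0 = 1.
Hypothesis q_unit : (#|F|%:R : R) \is a GRing.unit.

Local Notation lam := (lam psi).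
Local Notation eig := (eig N psi).
Local Notation eig_coord := (eig_coord psi).

Lemma eig_coord_eq c a r : eig c * a * eps = r *: (eig c * eps) -> eig_coord c a = r.
Proof.
move=> e; rewrite /eig_coord e coefZ (coef_eig_eps_rev N psi0).
have uK := mulrV (card_unipotent_unit N q_unit).
have sK := sgn_sq R (perm (@rev_ord_inj n)).
set v := (#|U|%:R)^-1 in uK *; set w := sgn _ _ in sK *.
have -> : #|U|%:R * w * (r * (v * w)) = (#|U|%:R * v) * (w * w) * r by ring.
by rewrite uK sK !mul1r.
Qed.

(** The coefficient between two eigenlines of an element [x] normalising the
    generator, when the conjugates of [U]-elements under [x] either stay in [U]
    and match the characters or contribute nothing. *)
Lemma eig_coord_conj c c' x r :
  elt x * eps = r *: eps ->
  (forall u, u \in U -> (x * u * x^-1)%g \in U -> lam c (x * u * x^-1)%g = lam c' u) ->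
  (forall u, u \in U -> (x * u * x^-1)%g \notin U ->
     eig c * elt (x * u * x^-1)%g * eps = 0) ->
  eig_coord c (elt x * eig c') =
    (#|U|%:R)^-1 * #|[set u in U | (x * u * x^-1)%g \in U]|%:R * r.
Proof.
move=> xr lamE out; apply: eig_coord_eq.
have -> : eig c' = (#|U|%:R)^-1 *: \sum_(u in U) lam c' u *: elt u by [].
have eigU u (uU : u \in U) := eig_elt psiD psi0 c uU.
move: (eig c) eigU out => E EU out; move: (stein N F R) xr out => e xr out.
rewrite -ga_scalerAr -ga_scalerAr -ga_scalerAl -2!scalerA; congr (_ *: _).
rewrite mulr_sumr mulr_sumr mulr_suml -sumr_const scaler_suml.
have ex u : E * elt (x * u)%g * e = r *: (E * elt (x * u * x^-1)%g * e).
  have -> : elt (x * u)%g = elt (x * u * x^-1)%g * elt x by rewrite -eltM mulgKV.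
  by rewrite (mulrA E) -(mulrA _ (elt x) e) xr -ga_scalerAr.
rewrite (bigID (fun u => (x * u * x^-1)%g \in U)) /= [X in _ + X]big1 ?addr0; last first.
  move=> u /andP[uU vU].
  by rewrite -!ga_scalerAr -!ga_scalerAl -eltM ex out // !scaler0.
apply: eq_big => u; first by rewrite [RHS]in_set.
case/andP => uU vU; rewrite -!ga_scalerAr -!ga_scalerAl -eltM ex.
rewrite EU // -!ga_scalerAl !scalerA mul1r -lamE //.
by rewrite mulrAC (homV (lamM psiD c) (lam1 N psi0 c) vU) mul1r.
Qed.

(** Changing the nonzero parameters of a character amounts to conjugating by a
    diagonal matrix, which fixes the generator of the Steinberg lattice. *)
Lemma torus_coord c c' : (forall k, (k < N)%N -> (c k == 0) = (c' k == 0)) ->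
  exists h, eig_coord c' (elt h * eig c) = 1.
Proof.
move=> cc'.
pose d := fix d k := if k is k'.+1 then (if c k' == 0 then 1 else c' k' / c k') * d k' else 1.
have d_neq0 k : (k <= N)%N -> d k != 0.
  elim: k => [|k IH] kN /=; first exact: oner_neq0.
  rewrite mulf_neq0 ?(IH (ltnW kN)) //; case: ifPn => [_|ck]; first exact: oner_neq0.
  by rewrite mulf_neq0 ?invr_neq0 // -cc'.
have d_unit (i : 'I_n) : d i != 0 by rewrite d_neq0 // -ltnS.
have uD : diag_mx (\row_(i < n) d i) \in unitmx.
  by rewrite unitmxE det_diag unitfE; apply/prodf_neq0 => i _; rewrite mxE.
have [h hE] := mat_surj uD; exists h.
have mat_h g (i j : 'I_n) : mat (h * g)%g i j = d i * mat g i j.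
  by rewrite matM hE mul_diag_mx !mxE.
have mat_hV g (i j : 'I_n) : mat (g * h^-1)%g i j = mat g i j / d j.
  apply: (mulIf (d_unit j)); rewrite divfK //.
  have -> : mat g i j = mat (g * h^-1 * h)%g i j by rewrite mulgKV.
  by rewrite (matM (g * h^-1)%g h) hE mul_mx_diag [RHS]mxE [(\row_i _) _ _]mxE.
have hpB s : ((pm s)^-1 * h * pm s \in B)%g.
  apply/borelP => i j ji; rewrite -pmV mat_pmr mat_pml -[h]mulg1 mat_h mat1 mxE.
  by rewrite (inj_eq perm_inj) -val_eqE gtn_eqF ?mulr0.
have h_eps : elt h * eps = 1 *: eps.
  rewrite scale1r; apply/ga_coefP => g; rewrite coef_eltl !coef_eps; apply: eq_bigr => s _.
  suff -> : ((pm s)^-1 * g = ((pm s)^-1 * h * pm s) * ((pm s)^-1 * (h^-1 * g)))%g.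
    by rewrite (@groupMl _ (borel_group N F) _ _ (hpB s)).
  by rewrite !mulgA mulgK mulgK.
have mat_conj g (i j : 'I_n) : mat (h * g * h^-1)%g i j = d i * mat g i j / d j.
  by rewrite mat_hV mat_h.
have hU u : u \in U -> (h * u * h^-1)%g \in U.
  move=> /unipotentP uU; apply/unipotentP => i j ji; rewrite mat_conj uU //.
  by case: eqP => [->|]; rewrite ?mulr1 ?divff // mulr0 mul0r.
rewrite (eig_coord_conj h_eps (c := c') (c' := c)) ?mulr1.
- have -> : [set u in U | (h * u * h^-1)%g \in U] = U.
    by apply/setP => u; rewrite [LHS]in_set andb_idr //; apply: hU.
  by rewrite mulVr // (card_unipotent_unit N q_unit).
- move=> u uU _; rewrite /lam; congr psi; apply: eq_bigr => k _.
  have kn : (k < n)%N by rewrite ltnW // ltnS ltn_ord.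
  have k1n : (k.+1 < n)%N by rewrite ltnS ltn_ord.
  rewrite /sd mat_conj !inordK //=.
  have := cc' _ (ltn_ord k); case: (c k =P 0) => [-> /esym/eqP ->|/eqP ck /esym/negbT c'k].
    by rewrite !mul0r.
  have dk : d k != 0 by rewrite d_neq0 // (ltnW (ltn_ord k)).
  by field; rewrite ?ck ?c'k ?dk.
by move=> u uU; rewrite hU.
Qed.

End Link.

(** * Merging two adjacent blocks *)

Section Merge.
Variables (N : nat) (F : finFieldType) (R : idomainType).
Local Notation n := N.+1.
Local Notation G := (GLg N F).
Local Notation A := (group_algebra R G).
Local Notation elt := (@ga_elt R G).
Local Notation U := (unipotent N F).
Local Notation B := (upper_triangular N F).
Local Notation eps := (stein N F R).
Local Notation pm := (@pm N F).
Local Notation mat := (@mat N F).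
Implicit Types (g h u v p b : G) (s t : 'S_n) (a : A) (c : nat -> F) (k : nat).

Variable psi : F -> R.
Hypothesis psiD : forall x y, psi (x + y) = psi x * psi y.
Hypothesis psi0 : psi 0 = 1.
Hypothesis q_unit : (#|F|%:R : R) \is a GRing.unit.
Hypothesis R_two : forall r : R, r + r = 0 -> r = 0.

Local Notation lam := (lam psi).
Local Notation eig := (eig N psi).
Local Notation eig_coord := (eig_coord psi).

Lemma double_reversal K : (K <= n)%N -> exists r : 'S_n,
  forall i : 'I_n, r i = (if i < K then K.-1 - i else N + K - i)%N :> nat.
Proof.
move=> Kn; pose f (i : 'I_n) : 'I_n := inord (if i < K then K.-1 - i else N + K - i)%N.
have fE i : f i = (if i < K then K.-1 - i else N + K - i)%N :> nat.
  by have ? := ltn_ord i; rewrite inordK //; do ?case: ifP; lia.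
have f_inj : injective f.
  move=> i j /(congr1 val); rewrite /= !fE => e; apply: val_inj => /=.
  by have ? := ltn_ord i; have ? := ltn_ord j; move: e; do ?case: ifP; lia.
by exists (perm f_inj) => i; rewrite permE fE.
Qed.

Let low K (i : nat) : nat := (K <= i)%N.
Fact low_mono K i j : (i <= j)%N -> (low K i <= low K j)%N.
Proof. by rewrite /low; case: (leqP K i) => // Ki ij; rewrite (leq_trans Ki). Qed.

(** Expand the second eigenvector over [U] and conjugate by the shuffle [s] of the
    intervals [0, K) and [K, n).  The conjugates in [U] contribute equal terms,
    and their number is a power of the order of the field.  A conjugate [g]
    outside [U] contributes nothing: [eig c * g * eps] vanishes on the maximal
    parabolic subgroup at [K], where the eigenvector [eig c * eps], of which it
    is a multiple, has a nonzero value. *)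
Lemma shuffle_coord K s c c' : (K <= n)%N ->
  (forall i j : 'I_n, (i < j)%N -> (j < K)%N || (K <= i)%N -> (s i < s j)%N) ->
  (forall k, (k < N)%N -> c k != 0 -> k.+1 != K) ->
  (forall u, u \in U -> (pm s * u * (pm s)^-1)%g \in U ->
     lam c (pm s * u * (pm s)^-1)%g = lam c' u) ->
  eig_coord c (elt (pm s) * eig c') \is a GRing.unit.
Proof.
move=> Kn s_mono cK lamE.
have conjE u (i j : 'I_n) : mat (pm s * u * (pm s)^-1)%g i j = mat u (s i) (s j).
  by rewrite -pmV mat_pmr invgK mat_pml.
(* The longest permutation of the maximal parabolic subgroup. *)
have [r rE] := double_reversal Kn.
have rP : pm r \in block_group N F (low K).
  apply: pm_block_group => i; rewrite /low rE; congr nat_of_bool.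
  by have ? := ltn_ord i; case: ifP => ?; apply/idP/idP; lia.
have r_desc : descending c r.
  apply/descendingP => k kN ck; rewrite !rE !inordK ?ltnS ?(ltnW kN) //.
  by have /eqP ? := cK k kN ck; do ?case: ifP; lia.
have sgnU t : sgn R t \is a GRing.unit by rewrite /sgn unitrX // unitrN unitr1.
have value : ga_coef (eig c * eps) (pm r) != 0.
  rewrite (coef_eig_eps_pm (lam_unipotent_sub psi0 r_desc)) card_unipotent_sub natrX.
  have unit_neq0 (z : R) : z \is a GRing.unit -> z != 0.
    by apply: contraTneq => ->; rewrite unitr0.
  by apply: unit_neq0; rewrite !unitrM unitrV (card_unipotent_unit N q_unit) sgnU unitrX.
have out u : u \in U -> (pm s * u * (pm s)^-1)%g \notin U ->
    eig c * elt (pm s * u * (pm s)^-1)%g * eps = 0.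
  move=> uU; set g := (_ * u * _)%g; apply: contraNeq => ne0.
  have support v t : v \in U -> ((pm t)^-1 * (g^-1 * (v^-1 * pm r)) \in B)%g -> g \in U.
    move=> vU bB; set b := (_ * (g^-1 * _))%g in bB.
    have gtP : (g * pm t)%g \in block_group N F (low K).
      have -> : (g * pm t = v^-1 * pm r * b^-1)%g.
        by apply: (mulIg b); rewrite mulgKV /b !mulgA mulgK mulgV mul1g.
      rewrite !groupM ?groupV ?rP //; apply: (subsetP (borel_block_group _ _ (@low_mono K))) => //.
      exact: (subsetP (unipotent_borel _ _)).
    have g0 (i j : 'I_n) : (j < K)%N -> (K <= i)%N -> mat g i (t^-1%g j) = 0.
      move=> jK Ki; rewrite -mat_pmr; have /block_groupP -> // := gtP.
      by rewrite /low Ki [(K <= j)%N]leqNgt jK.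
    have gii i : mat g i i = 1.
      by have /unipotentP uP := uU; rewrite conjE uP // eqxx.
    pose S := [set i : 'I_n | (i < K)%N].
    have tS : t^-1%g @: S = S.
      apply/eqP; rewrite eqEcard card_imset ?leqnn ?andbT; last exact: perm_inj.
      apply/subsetP => _ /imsetP[j jS ->]; rewrite !inE in jS *.
      rewrite ltnNge; apply/negP => Kt; have := gii (t^-1%g j).
      by rewrite g0 // => /eqP; rewrite eq_sym oner_eq0.
    apply/unipotentP => i j; rewrite leq_eqVlt => /orP[/eqP/val_inj->|ji].
      by rewrite gii eqxx.
    rewrite -val_eqE gtn_eqF //=; have [/andP[jK Ki]|lohi] := boolP ((j < K)%N && (K <= i)%N).
      have : j \in S by rewrite inE.
      by rewrite -tS => /imsetP[j' j'S ->]; apply: g0 => //; move: j'S; rewrite inE.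
    have lt_s : (s j < s i)%N.
      by apply: s_mono => //; move: lohi; rewrite negb_and -leqNgt -ltnNge; case/orP => H; apply/orP; [right | left].
    have /unipotentP uP := uU; rewrite conjE uP ?(ltnW lt_s) //.
    by rewrite -val_eqE gtn_eqF.
  have : ga_coef (eig c * elt g * eps) (pm r) != 0.
    rewrite (eig_coordP psiD psi0 q_unit R_two) coefZ; apply: mulf_neq0; last exact: value.
    apply: contraNneq ne0; rewrite (eig_coordP psiD psi0 q_unit R_two) => ->.
    by rewrite scale0r.
  rewrite -mulrA coef_lin_idem; apply: contraR => gU; apply/eqP.
  rewrite big1 ?mulr0 // => v vU; rewrite coef_eltl coef_eps big1 ?mulr0 // => t _.
  case: (boolP (_ \in B)) => [/(support _ _ vU)|]; last by rewrite mulr0.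
  by rewrite (negPf gU).
rewrite (eig_coord_conj psiD psi0 q_unit (@pm_eps N F R s) lamE out).
have -> : [set u in U | (pm s * u * (pm s)^-1)%g \in U] = unipotent_sub F s^-1%g.
  apply/setP => u; rewrite [LHS]in_set; case: (boolP (u \in U)) => uU /=; last first.
    by rewrite in_setI (negPf uU).
  rewrite unipotent_subE // pmV invgK; apply/idP/idP => [|vB].
    exact: (subsetP (unipotent_borel _ _)).
  rewrite inE vB /=; apply/forallP => i; rewrite conjE.
  by have /unipotentP -> := uU; rewrite ?eqxx.
by rewrite card_unipotent_sub natrX !unitrM sgnU unitrX // unitrV (card_unipotent_unit N q_unit).
Qed.

Lemma interval_swap K0 x y : (K0 + x + y <= n)%N -> exists s : 'S_n,
  forall i : 'I_n, s i = (if i < K0 then i : nat else if i < K0 + x then i + y else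
                   if i < K0 + x + y then i - x else i)%N :> nat.
Proof.
move=> Kn; pose f (i : 'I_n) : 'I_n := inord (if i < K0 then i : nat else
  if i < K0 + x then i + y else if i < K0 + x + y then i - x else i)%N.
have fE i : f i = (if i < K0 then i : nat else if i < K0 + x then i + y else
                   if i < K0 + x + y then i - x else i)%N :> nat.
  by have ? := ltn_ord i; rewrite inordK //; do ?case: ifP; lia.
have f_inj : injective f.
  move=> i j /(congr1 val); rewrite /= !fE => e; apply: val_inj => /=.
  by have ? := ltn_ord i; have ? := ltn_ord j; move: e; do ?case: ifP; lia.
by exists (perm f_inj) => i; rewrite permE fE.
Qed.

(** Here [J] marks the superdiagonal positions interior to a block; the blocks
    starting at [K0] of sizes [x] and [y] are merged. *)
Lemma merge_coord (J : pred nat) K0 x y (c := fun k => (J k)%:R : F)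
    (c' := fun k => (J k || (k.+1 == K0 + x)%N)%:R : F) :
  (K0 + x + y <= n)%N -> (0 < x)%N -> (0 < y)%N ->
  (forall k, J k -> (k < N)%N) ->
  (forall k, (K0 <= k)%N -> (k.+1 < K0 + x + y)%N -> k.+1 != (K0 + x)%N -> J k) ->
  (forall k, [|| k.+1 == K0, k.+1 == (K0 + x)%N | k.+1 == (K0 + x + y)%N] -> ~~ J k) ->
  exists g, eig_coord c (elt g * eig c') \is a GRing.unit.
Proof.
move=> Kn x_gt0 y_gt0 JN Jin Jout; have [s sE] := interval_swap Kn.
exists (pm s); apply: (shuffle_coord (K := (K0 + x)%N)).
- exact: leq_trans (leq_addr _ _) Kn.
- move=> i j ij; rewrite !sE => H.
  by do ?case: ifP; move: H ij; lia.
- move=> k _; rewrite /c; apply: contraNneq => e.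
  by rewrite (negPf (Jout _ _)) ?e ?eqxx ?orbT.
move=> u /unipotentP uU /unipotentP vU; rewrite /lam; congr psi.
have conjE (i j : 'I_n) : mat (pm s * u * (pm s)^-1)%g i j = mat u (s i) (s j).
  by rewrite -pmV mat_pmr invgK mat_pml.
set v := (_ * u * _)%g in vU *.
have cN : c N = 0 by rewrite /c; case: (boolP (J N)) => // /JN; rewrite ltnn.
have c'N : c' N * sd u N = 0.
  rewrite /c'; move: cN; rewrite /c; case: (J N) => [/eqP|_ /=]; first by rewrite oner_eq0.
  by rewrite gtn_eqF ?mul0r //; lia.
transitivity (\sum_(k < n) c k * sd v k).
  by rewrite big_ord_recr /= cN mul0r addr0.
transitivity (\sum_(k < n) c' k * sd u k); last by rewrite big_ord_recr /= c'N addr0.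
rewrite [RHS](reindex_inj (@perm_inj _ s)); apply: eq_bigr => k _ /=.
have sdv : (k < N)%N -> sd v k = mat u (s k) (s (inord k.+1)).
  by move=> kN; rewrite /sd conjE inord_val.
have sdu (i : 'I_n) : (s k).+1 = i :> nat -> sd u (s k) = mat u (s k) i.
  move=> e; rewrite /sd inord_val; congr (mat u _ _); apply: val_inj.
  by rewrite /= inordK e.
have s1 : (k < N)%N -> s (inord k.+1) = (if k.+1 < K0 then k.+1 else
    if k.+1 < K0 + x then k.+1 + y else if k.+1 < K0 + x + y then k.+1 - x else k.+1)%N :> nat.
  by move=> kN; rewrite sE inordK.
have same : J k -> J (s k) || ((s k).+1 == K0 + x)%N -> (s (inord k.+1) = (s k).+1 :> nat) ->
    c k * sd v k = c' (s k) * sd u (s k).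
  move=> Jk J'k e; have kN := JN _ Jk.
  by rewrite /c /c' Jk J'k !mul1r sdv // (sdu (s (inord k.+1))).
have zero : ~~ J k -> ~~ (J (s k) || ((s k).+1 == K0 + x)%N) ->
    c k * sd v k = c' (s k) * sd u (s k).
  by move=> /negPf Jk /negPf J'k; rewrite /c /c' Jk J'k !mul0r.
have J'in m : (K0 <= m)%N -> (m.+1 < K0 + x + y)%N -> J m || (m.+1 == K0 + x)%N.
  by move=> Km mK; case: eqP => [|/eqP ne]; rewrite ?orbT // Jin.
have sk := sE k; have lt_k := ltn_ord k.
have [kK0|K0k] := ltnP k K0.
  rewrite kK0 in sk; case: (boolP (J k)) => Jk.
    apply: same => //; first by rewrite sk Jk.
    have ne : k.+1 != K0 by apply: contraL Jk => e; rewrite Jout ?e.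
    by rewrite s1 ?JN // sk ifT //; lia.
  by apply: zero => //; rewrite sk negb_or Jk /=; lia.
have [kK|Kk] := ltnP k (K0 + x).
  rewrite ltnNge K0k /= kK in sk.
  have [e|ne] := eqVneq k.+1 (K0 + x)%N.
    apply: zero; first by rewrite Jout // e eqxx orbT.
    by rewrite sk negb_or Jout /=; lia.
  have Jk : J k by apply: Jin => //; lia.
  apply: same => //; first by rewrite sk J'in //; lia.
  by rewrite s1 ?JN // sk; do ?case: ifP; lia.
have [kL|Lk] := ltnP k (K0 + x + y).
  rewrite ltnNge K0k /= ltnNge Kk /= kL in sk.
  have [e|ne] := eqVneq k.+1 (K0 + x + y)%N.
    (* The last position of the second block goes to a superdiagonal position
       inside the merged block; as [v] is unipotent, [u] vanishes there. *)
    have Jk : ~~ J k by rewrite Jout // e eqxx !orbT.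
    have K0n : (K0 < n)%N by lia.
    have s0 : s (Ordinal K0n) = (K0 + y)%N :> nat by rewrite sE /=; do ?case: ifP; lia.
    rewrite (sdu (s (Ordinal K0n))); last by rewrite s0 sk; lia.
    rewrite -conjE vU /=; last by lia.
    rewrite -val_eqE /= gtn_eqF; last by lia.
    by rewrite /c (negPf Jk) mul0r mulr0.
  have Jk : J k by apply: Jin => //; lia.
  apply: same => //; first by rewrite sk J'in //; lia.
  by rewrite s1 ?JN // sk; do ?case: ifP; lia.
have {}sk : s k = k :> nat by rewrite sk; do ?case: ifP; lia.
case: (boolP (J k)) => Jk.
  apply: same => //; first by rewrite sk Jk.
  by rewrite s1 ?JN // sk; do ?case: ifP; lia.
by apply: zero => //; rewrite sk negb_or Jk /=; lia.
Qed.

End Merge.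

(** * Valuations of Gaussian factorials *)

Section GeometricSum.
Local Open Scope nat_scope.
Implicit Types (q Q l i j : nat).

Definition gsum q i := \sum_(j < i) q ^ j.

Lemma gsum_pred q i : (q ^ i).-1 = q.-1 * gsum q i.
Proof. exact: predn_exp. Qed.

Lemma gsumE q i : 1 < q -> (q ^ i - 1) %/ (q - 1) = gsum q i.
Proof. by case: q => [|q] // q1; rewrite !subn1 gsum_pred mulKn //; lia. Qed.

Lemma gsumD q i j : gsum q (i + j) = gsum q i + q ^ i * gsum q j.
Proof.
rewrite /gsum big_split_ord /= big_distrr /=; congr (_ + _).
by apply: eq_bigr => k _; rewrite expnD.
Qed.

Lemma gsumM q i j : 1 < q -> gsum q (i * j) = gsum q i * gsum (q ^ i) j.
Proof.
move=> q1; apply/eqP; rewrite -(@eqn_pmul2l q.-1); last by lia.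
by rewrite mulnA -!gsum_pred expnM.
Qed.

Lemma gsum0 q : gsum q 0 = 0. Proof. exact: big_ord0. Qed.
Lemma gsum1 q : gsum q 1 = 1. Proof. exact: big_ord1. Qed.

Lemma gsum_gt0 q i : 0 < i -> 0 < gsum q i.
Proof. by case: i => // i _; rewrite /gsum big_ord_recl. Qed.

Lemma gsum_mod q l i : q = 1 %[mod l] -> gsum q i = i %[mod l].
Proof.
move=> q1; elim: i => [|i IH]; first by rewrite gsum0.
rewrite -addn1 gsumD gsum1 muln1 -modnDm IH.
by rewrite -modnXm q1 modnXm exp1n modnDm.
Qed.

Lemma expn_lin q l z i : q = 1 + l * z -> exists t, q ^ i = 1 + i * (l * z) + l ^ 2 * t.
Proof.
move=> eq; elim: i => [|i [t IH]]; first by exists 0; rewrite muln0 mul0n !addn0.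
by exists (i * z * z + t + t * l * z); rewrite expnS IH eq; ring.
Qed.

Lemma logn_gsum_prime q l : prime l -> q = 1 %[mod l] -> (l = 2 -> q = 1 %[mod 4]) ->
  1 < q -> logn l (gsum q l) = 1.
Proof.
move=> l_pr q1 q1_4 q_gt1.
suff [X ->] : exists X, gsum q l = l * (1 + l * X).
  rewrite lognM ?(prime_gt0 l_pr) // (logn_prime l l_pr) eqxx lognE l_pr /=.
  by rewrite dvdn_addl ?dvdn_mulr // Euclid_dvd1.
have [l2|l_odd] := eqVneq l 2.
  have /eqP := q1_4 l2; rewrite eqn_mod_dvd ?(ltnW q_gt1) // => /dvdnP[z ez].
  exists z; rewrite l2 /gsum !big_ord_recl big_ord0 /= expn0 expn1.
  by move: ez; lia.
move/eqP: q1; rewrite eqn_mod_dvd ?(ltnW q_gt1) // => /dvdnP[z ez].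
have eq : q = 1 + l * z by rewrite mulnC -ez subnKC // ltnW.
have /choice[t tE] := fun i => expn_lin i eq.
have sum_id : \sum_(i < l) i = l * l.-1./2.
  rewrite -(big_mkord xpredT id) bin2_sum bin2.
  case: (even_prime l_pr) l_odd => [->//|l_odd _].
  by rewrite -[in RHS]divn2 -divn2 muln_divA // dvdn2 -subn1 oddB ?(prime_gt0 l_pr) // l_odd.
exists (z * l.-1./2 + \sum_(i < l) t i).
rewrite /gsum; under eq_bigr => i _ do rewrite tE.
rewrite !big_split /= sum1_card card_ord.
rewrite -big_distrl -big_distrr /= sum_id.
by move: (l.-1./2) (\sum_(i < l) t i) => a b; ring.
Qed.

(** Lifting the exponent: [gsum q (l * j)] is [gsum q l * gsum (q ^ l) j], and
    the first factor is computed modulo [l ^ 2]. *)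
Lemma logn_gsum q l i : prime l -> q = 1 %[mod l] -> (l = 2 -> q = 1 %[mod 4]) ->
  1 < q -> 0 < i -> logn l (gsum q i) = logn l i.
Proof.
move=> l_pr; elim/ltn_ind: i q => i IH q q1 q4 q_gt1 i_gt0.
have [/dvdnP[j ej]|ndvd] := boolP (l %| i); last first.
  rewrite [LHS]lognE [RHS]lognE (negPf ndvd) !andbF.
  suff /negPf -> : ~~ (l %| gsum q i) by rewrite !andbF.
  by rewrite /dvdn gsum_mod // -/(dvdn _ _).
have j_gt0 : 0 < j by move: i_gt0; rewrite ej; case: (j).
have l_gt1 := prime_gt1 l_pr.
rewrite ej mulnC gsumM // !lognM ?gsum_gt0 ?(prime_gt0 l_pr) //.
rewrite logn_gsum_prime // (logn_prime l l_pr) eqxx IH //.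
- by rewrite ej ltn_Pmulr.
- by rewrite -modnXm q1 modnXm exp1n.
- by move=> /q4 q1'; rewrite -modnXm q1' modnXm exp1n.
by rewrite -[1](expn0 q) ltn_exp2l ?(prime_gt0 l_pr).
Qed.

End GeometricSum.

Section FactorialCarry.
Local Open Scope nat_scope.
Variable l : nat.
Hypothesis l_pr : prime l.

Lemma logn_addl i m t : i < l ^ m -> 0 < i -> l ^ m %| t -> logn l (t + i) = logn l i.
Proof.
move=> i_lt i_gt0 /dvdnP[c ->].
have lt_m : logn l i < m.
  rewrite ltnNge; apply/negP => le_m; have := dvdn_leq i_gt0 (pfactor_dvdnn l i).
  by rewrite leqNgt (leq_trans i_lt) // leq_pexp2l ?(prime_gt0 l_pr).
have [j jl ej] := pfactor_coprime l_pr i_gt0.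
set v := logn l i in lt_m ej *; rewrite ej -(subnK (ltnW lt_m)) expnD mulnA -mulnDl.
have lj : ~~ (l %| j) by rewrite -prime_coprime.
have nl : ~~ (l %| c * l ^ (m - v) + j).
  rewrite dvdn_addr // dvdn_mull // -[m - v]prednK ?subn_gt0 // expnS dvdn_mulr //.
have t_gt0 : 0 < c * l ^ (m - v) + j by case: (_ + j) nl; rewrite ?dvdn0.
by rewrite lognM ?expn_gt0 ?(prime_gt0 l_pr) // pfactorK // lognE (negPf nl) !andbF.
Qed.

(** No carry occurs when [t] is added to [c * l ^ i]. *)
Lemma logn_fact_shift c i t : t <= l ^ i -> (t < l ^ i) || ~~ (l %| c.+1) ->
  logn l (c * l ^ i + t)`! = logn l (c * l ^ i)`! + logn l t`!.
Proof.
elim: t => [|t IH] le_t H; first by rewrite fact0 logn1 !addn0.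
rewrite addnS factS lognM ?fact_gt0 // IH ?(ltnW le_t) ?le_t //.
rewrite factS lognM ?fact_gt0 //.
suff -> : logn l (c * l ^ i + t).+1 = logn l t.+1 by lia.
rewrite -addnS; move: le_t H; rewrite leq_eqVlt => /orP[/eqP->|lt_t _].
  rewrite ltnn /= => lc; rewrite addnC -mulSn lognM ?expn_gt0 ?(prime_gt0 l_pr) //.
  by rewrite (lognE l c.+1) (negPf lc) !andbF.
by rewrite (@logn_addl _ i) // dvdn_mull.
Qed.

Lemma logn_fact_pow_add i j : i < j ->
  logn l (l ^ j + l ^ i)`! = logn l (l ^ j)`! + logn l (l ^ i)`!.
Proof.
move=> ij; have lt_ij : l ^ i < l ^ j by rewrite ltn_exp2l ?prime_gt1.
by rewrite -{1}[l ^ j]mul1n logn_fact_shift ?mul1n ?lt_ij ?(ltnW lt_ij).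
Qed.

(** Removing the highest power of [l] does not produce a carry either. *)
Lemma logn_fact_peel i X : l ^ i <= X < l ^ i.+1 ->
  logn l X`! = logn l (X - l ^ i)`! + logn l (l ^ i)`!.
Proof.
case/andP => iX Xi; have li_gt0 : 0 < l ^ i by rewrite expn_gt0 prime_gt0.
pose c := X %/ l ^ i; pose r := X %% l ^ i.
have r_lt : r < l ^ i by rewrite ltn_mod.
have c_gt0 : 0 < c by rewrite divn_gt0.
have c_lt : c < l by rewrite ltn_divLR // -expnS.
have eX : X = c * l ^ i + r by exact: divn_eq.
have ec : c = c.-1.+1 by rewrite prednK.
have eX' : X - l ^ i = c.-1 * l ^ i + r by rewrite eX {1}ec mulSn; lia.
rewrite eX' eX !logn_fact_shift ?r_lt ?(ltnW r_lt) //.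
have -> : c * l ^ i = c.-1 * l ^ i + l ^ i by rewrite {1}ec mulSn addnC.
rewrite logn_fact_shift //; first by lia.
by rewrite prednK // gtnNdvd ?orbT.
Qed.

Lemma logn_fact_prime : logn l l`! = 1.
Proof.
have l_gt0 := prime_gt0 l_pr.
rewrite -{2}(prednK l_gt0) factS prednK // lognM ?fact_gt0 // (logn_prime l l_pr) eqxx.
rewrite logn_fact // big_nat_cond big1 // => k /andP[/andP[k1 _] _].
rewrite divn_small // prednK // -{1}[l]expn1 leq_pexp2l //.
Qed.

End FactorialCarry.

Section Weight.
Local Open Scope nat_scope.
Variables (q l e : nat).
Hypothesis q_gt1 : 1 < q.
Hypothesis l_pr : prime l.
Hypothesis lq : ~~ (l %| q).
Hypothesis e_ge2 : 2 <= e.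
Hypothesis le : l %| gsum q e.
Hypothesis e_min : forall i, 2 <= i -> l %| gsum q i -> e <= i.

Let d := logn l (gsum q e).

Lemma dvdn_gsum i : (l %| gsum q i) = (e %| i).
Proof.
elim/ltn_ind: i => i IH; case: (ltnP i e) => [ie|ei].
  case: i IH ie => [|[|i]] IH ie; first by rewrite gsum0 !dvdn0.
    by rewrite gsum1 !dvdn1 !eqn_leq [l <= 1]leqNgt prime_gt1 // [e <= 1]leqNgt e_ge2.
  rewrite [RHS]gtnNdvd //; apply/negbTE/negP => /e_min; lia.
rewrite -(subnKC ei) gsumD dvdn_addr // Euclid_dvdM // Euclid_dvdX // (negPf lq) /=.
by rewrite IH ?dvdn_addr //; lia.
Qed.

Lemma logn_gsum_min i : 0 < i ->
  logn l (gsum q i) = if e %| i then d + logn l (i %/ e) else 0.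
Proof.
move=> i_gt0; case: ifP => [/dvdnP[j ej]|ndvd]; last first.
  by rewrite lognE dvdn_gsum ndvd !andbF.
have j_gt0 : 0 < j by move: i_gt0; rewrite ej; case: (j).
have e_gt0 : 0 < e by exact: ltnW.
have l_q : q ^ e = 1 %[mod l].
  apply/eqP; rewrite eqn_mod_dvd ?expn_gt0 ?(ltnW q_gt1) // subn1 gsum_pred.
  exact: dvdn_mull.
rewrite ej mulnK // mulnC gsumM // lognM ?gsum_gt0 // (@logn_gsum (q ^ e)) //.
  move=> l2; have q_odd : odd q by move: lq; rewrite l2 dvdn2 negbK.
  have e2 : e = 2.
    apply/eqP; rewrite eqn_leq e_ge2 andbT e_min // l2.
    by rewrite /gsum !big_ord_recl big_ord0 /= dvdn2 expn1 expn0 addn0 oddD q_odd.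
  rewrite e2; have -> : q = (q./2).*2.+1 by rewrite -[LHS]odd_double_half q_odd.
  have -> : (q./2).*2.+1 ^ 2 = (q./2 ^ 2 + q./2) * 4 + 1 by rewrite -muln2; nia.
  by rewrite modnMDl.
by rewrite -[1](expn0 q) ltn_exp2l.
Qed.

(** This is the valuation of the product of [gsum q i] for [i] up to [x]: the
    multiples [e * j] of [e] contribute [d + logn l j] each. *)
Definition weight x := d * (x %/ e) + logn l (x %/ e)`!.

Lemma weight_small x : x < e -> weight x = 0.
Proof. by move=> xe; rewrite /weight divn_small // muln0 fact0 logn1. Qed.

Lemma weight_mul X : weight (e * X) = d * X + logn l X`!.
Proof. by rewrite /weight mulKn // ltnW. Qed.

Lemma divS_min x : x.+1 %/ e = x %/ e + (e %| x.+1).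
Proof. by rewrite divnS 1?addnC // ltnW. Qed.

Lemma weightS x :
  weight x.+1 = weight x + (if e %| x.+1 then d + logn l (x.+1 %/ e) else 0).
Proof.
rewrite /weight divS_min; case: (e %| _); rewrite ?addn0 //= addn1 mulnS factS.
by rewrite lognM ?fact_gt0 // addnACA addnC.
Qed.

Lemma logn_gaussian_factorial x :
  logn l (\prod_(1 <= i < x.+1) (q ^ i - 1)) = x * logn l (q - 1) + weight x.
Proof.
elim: x => [|x IH]; first by rewrite big_geq // logn1 weight_small // ltnW.
rewrite big_nat_recr //= lognM; last 2 first.
- rewrite big_seq_cond; apply: prodn_cond_gt0 => i; rewrite mem_index_iota andbT => /andP[i1 _].
  by rewrite subn_gt0 -[1](expn0 q) ltn_exp2l.
- by rewrite subn_gt0 -[1](expn0 q) ltn_exp2l.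
rewrite IH (subn1 (q ^ _)) gsum_pred lognM ?gsum_gt0 //; last by lia.
by rewrite logn_gsum_min // weightS subn1; lia.
Qed.

End Weight.

(** * Compositions up to merging without loss of valuation *)

Section MergeEquiv.
Local Open Scope nat_scope.
Variables (q l e : nat).
Hypothesis l_pr : prime l.
Hypothesis e_ge2 : 2 <= e.
Local Notation weight := (weight q l e).
Implicit Types (a b s u v : seq nat) (x y i j : nat).

(** The merges allowed here are those that do not change the valuation of the
    index of the parabolic subgroup. *)
Inductive merge_equiv : seq nat -> seq nat -> Prop :=
| merge_refl a : merge_equiv a a
| merge_sym a b : merge_equiv a b -> merge_equiv b a
| merge_trans a b c : merge_equiv a b -> merge_equiv b c -> merge_equiv a c
| merge_step u v x y : 0 < x -> 0 < y -> weight (x + y) = weight x + weight y ->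
    merge_equiv (u ++ x :: y :: v) (u ++ (x + y) :: v).

Lemma merge_equiv_cat u v a b :
  merge_equiv a b -> merge_equiv (u ++ a ++ v) (u ++ b ++ v).
Proof.
elim=> [c|c c' _ IH|c c' c'' _ IH1 _ IH2|u' v' x y x0 y0 w].
- exact: merge_refl.
- exact: merge_sym.
- exact: merge_trans IH1 IH2.
by rewrite -!catA /= !(catA u); apply: merge_step.
Qed.

Lemma merge_equiv_sum a b : merge_equiv a b ->
  [/\ sumn a = sumn b, (0 \notin a) = (0 \notin b)
    & \sum_(x <- a) weight x = \sum_(x <- b) weight x].
Proof.
elim=> {a b} [//|a b _ [-> -> ->] //|a b c _ [-> -> ->] _ [-> -> ->] //|].
move=> u v x y x0 y0 w; rewrite !sumn_cat !mem_cat !inE !big_cat !big_cons /= w.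
rewrite !addnA; split=> //; congr (~~ (_ || _)).
by rewrite !(eq_sym 0) addn_eq0 !eqn0Ngt x0 y0.
Qed.

Definition special x := (x = 1) \/ exists i, x = e * l ^ i.

Lemma special_gt0 x : special x -> 0 < x.
Proof.
by case=> [->|[i ->]] //; rewrite muln_gt0 (ltnW e_ge2) expn_gt0 (prime_gt0 l_pr).
Qed.

Lemma weight1 : weight 1 = 0.
Proof. by rewrite weight_small. Qed.

Lemma weightD1 x : ~~ (e %| x.+1) -> weight x.+1 = weight x + weight 1.
Proof. by move=> /negPf ne; rewrite weight1 weightS // ne. Qed.

(** No carry occurs in the addition of two distinct powers of [l], nor when [1] is
    added to a multiple of [e]. *)
Lemma special_weightD x y : special x -> special y -> x != y ->
  weight (x + y) = weight x + weight y.
Proof.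
have one i : weight (1 + e * l ^ i) = weight 1 + weight (e * l ^ i).
  rewrite add1n weightD1 1?addnC // -addn1 dvdn_addr ?dvdn_mulr //.
  by rewrite dvdn1 neq_ltn e_ge2 orbT.
have pow i j : i < j -> weight (e * l ^ i + e * l ^ j) =
    weight (e * l ^ i) + weight (e * l ^ j).
  move=> ij; rewrite -mulnDr !weight_mul // (addnC (l ^ i)) logn_fact_pow_add //.
  by rewrite mulnDr; ring.
case=> [->|[i ->]] [->|[j ->]] //; rewrite ?one //.
  by rewrite addnC one addnC.
move=> ne; case: (ltngtP i j) => [/pow //|/pow|eij]; last by rewrite eij eqxx in ne.
by rewrite addnC => ->; rewrite addnC.
Qed.

Lemma merge_equiv_swap x y v : special x -> special y ->
  merge_equiv [:: x, y & v] [:: y, x & v].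
Proof.
move=> sx sy; have [->|ne] := eqVneq x y; first exact: merge_refl.
have [x0 y0] := (special_gt0 sx, special_gt0 sy).
have h x' y' : special x' -> special y' -> x' != y' ->
    merge_equiv [:: x', y' & v] (x' + y' :: v).
  move=> sx' sy' ne'; apply: (@merge_step [::]); rewrite ?special_gt0 //.
  exact: special_weightD.
apply: merge_trans (h _ _ sx sy ne) _; rewrite addnC; apply/merge_sym/h => //.
by rewrite eq_sym.
Qed.

Lemma merge_equiv_cons x a b : merge_equiv a b -> merge_equiv (x :: a) (x :: b).
Proof. by move/(merge_equiv_cat [:: x] [::]); rewrite !cats0. Qed.

(** Peel off the parts of the expansion of [x] one at a time: a unit while [x]
    is not a multiple of [e], and then the highest [e * l ^ i] below [x]. *)
Lemma merge_equiv_special x : 0 < x ->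
  exists2 b, (forall y, y \in b -> special y) & merge_equiv [:: x] b.
Proof.
elim/ltn_ind: x => x IH x_gt0.
have peel y : 0 < y < x -> special y -> weight x = weight (x - y) + weight y ->
    exists2 b, (forall y, y \in b -> special y) & merge_equiv [:: x] b.
  case/andP => y0 yx sy w; have [||b bs xb] := IH (x - y); try by lia.
  exists (y :: b) => [z|]; first by rewrite inE => /orP[/eqP->|/bs].
  apply: merge_trans (merge_equiv_cons y xb); apply: merge_sym.
  have := @merge_step [::] [::] y (x - y) y0; rewrite subn_gt0 yx subnKC ?(ltnW yx) //=.
  by apply=> //; rewrite w addnC.
have [/dvdnP[X eX]|ne] := boolP (e %| x); last first.
  case: x IH x_gt0 peel ne => [//|[|x]] IH _ peel ne.
    by exists [:: 1]; [move=> y; rewrite inE => /eqP->; left | apply: merge_refl].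
  by apply: (peel 1) => //; [left | rewrite weightD1 // subn1].
have X_gt0 : 0 < X by move: x_gt0; rewrite eX; case: (X).
have e_gt0 := ltnW e_ge2.
have := trunc_log_bounds (prime_gt1 l_pr) X_gt0; set i := trunc_log l X => Xi.
have [iX _] := andP Xi; move: iX; rewrite leq_eqVlt => /orP[/eqP eXi|iX].
  exists [:: x]; last exact: merge_refl.
  by move=> y; rewrite inE => /eqP->; right; exists i; rewrite eX -eXi mulnC.
apply: (peel (e * l ^ i)).
- by rewrite muln_gt0 e_gt0 expn_gt0 (prime_gt0 l_pr) eX mulnC ltn_pmul2r.
- by right; exists i.
rewrite eX mulnC -mulnBr !weight_mul // (logn_fact_peel l_pr Xi).
by rewrite -{1}(subnK (ltnW iX)) mulnDr addnACA.
Qed.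

Lemma merge_equiv_insert x s : special x -> (forall y, y \in s -> special y) ->
  sorted leq s -> exists t, [/\ sorted leq t, perm_eq t (x :: s) & merge_equiv (x :: s) t].
Proof.
move=> sx; elim: s => [|y s IH] ss ord; first by exists [:: x]; split=> //; apply: merge_refl.
case: (leqP x y) => [xy|/ltnW yx].
  by exists [:: x, y & s]; split=> //=; [rewrite xy | apply: merge_refl].
have [||t [t_ord t_perm t_eq]] := IH.
- by move=> z zs; apply: ss; rewrite inE zs orbT.
- exact: path_sorted ord.
exists (y :: t); split.
- rewrite /= path_min_sorted //; apply/allP => z; rewrite (perm_mem t_perm) inE.
  case/orP => [/eqP-> //|zs]; move: ord; rewrite /= (path_sortedE leq_trans).
  by case/andP => /allP/(_ z zs).
- by rewrite (perm_trans (_ : perm_eq _ (y :: x :: s))) ?perm_cons // (perm_catCA [:: y] [:: x]).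
apply: merge_trans (merge_equiv_cons y t_eq).
by apply: merge_equiv_swap => //; apply: ss; rewrite inE eqxx.
Qed.

(** Break every part into special ones and sort by insertion; two distinct
    special parts may be exchanged, as they can be merged. *)
Lemma merge_equiv_normal a : 0 \notin a ->
  exists b, [/\ sorted leq b, forall y, y \in b -> special y & merge_equiv a b].
Proof.
elim: a => [|x a IH]; first by exists [::]; split=> //; apply: merge_refl.
rewrite inE negb_or eq_sym -lt0n => /andP[x_gt0 /IH[b [b_ord bs ab]]].
have [c cs xc] := merge_equiv_special x_gt0.
suff [t [t_ord ts ct]] : exists t, [/\ sorted leq t, forall y, y \in t -> special y
    & merge_equiv (c ++ b) t].
  exists t; split=> //; apply: merge_trans (merge_equiv_cons x ab) _.
  by apply: merge_trans ct; apply: (merge_equiv_cat [::] b xc).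
elim: c cs {xc} => [|y c IHc] cs; first by exists b; split=> //; apply: merge_refl.
have [|t [t_ord ts ct]] := IHc; first by move=> z zc; apply: cs; rewrite inE zc orbT.
have ys : special y by apply: cs; rewrite inE eqxx.
have [t' [t'_ord t'_perm t'_eq]] := merge_equiv_insert ys ts t_ord.
exists t'; split=> //.
  by move=> z; rewrite (perm_mem t'_perm) inE => /orP[/eqP->|/ts].
by apply: merge_trans (merge_equiv_cons y ct) t'_eq.
Qed.

End MergeEquiv.

(** * Orders of block triangular groups *)

Lemma reshape_index_cons x s i :
  reshape_index (x :: s) i = if (i < x)%N then 0%N else (reshape_index s (i - x)).+1.
Proof.
rewrite /reshape_index /= subn_eq0; case: ltnP => // xi.
by rewrite subSn.
Qed.

Lemma reshape_index_mono s i j :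
  (i <= j)%N -> (reshape_index s i <= reshape_index s j)%N.
Proof.
rewrite (reshape_leq s) => /orP[/ltnW //|/andP[/eqP-> _]].
exact: leqnn.
Qed.

Section BlockOrder.
Variable F : finFieldType.

Definition unit_count m : nat := #|[set A : 'M[F]_m | A \in unitmx]|.

(** Stated for matrices of any size, zero included, so that one can recurse on the
    list of blocks. *)
Definition block_count m (f : nat -> nat) : nat :=
  #|[set A : 'M[F]_m | (A \in unitmx) &&
      [forall i : 'I_m, forall j : 'I_m, (f j < f i)%N ==> (A i j == 0)]]|.

Lemma eq_block_count m f g : f =1 g -> block_count m f = block_count m g.
Proof.
move=> fg; congr #|pred_of_set _|; apply/setP => A; rewrite !inE; congr (_ && _).
by apply: eq_forallb => i; apply: eq_forallb => j; rewrite !fg.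
Qed.

Lemma block_count_cat x m (f : nat -> nat) :
  block_count (x + m) (fun i => if (i < x)%N then 0%N else (f (i - x)%N).+1) =
    (unit_count x * #|F| ^ (x * m) * block_count m f)%N.
Proof.
set f' := (fun i : nat => _).
pose S := setX (setX [set A : 'M[F]_x | A \in unitmx] [set: 'M[F]_(x, m)])
  [set D : 'M[F]_m | (D \in unitmx) &&
      [forall i : 'I_m, forall j : 'I_m, (f j < f i)%N ==> (D i j == 0)]].
pose h (t : 'M[F]_x * 'M[F]_(x, m) * 'M[F]_m) : 'M[F]_(x + m) :=
  block_mx t.1.1 t.1.2 0 t.2.
have h_inj : injective h.
  by move=> [[A1 A2] A3] [[D1 D2] D3] /eq_block_mx[/= -> -> _ ->].
transitivity #|S|; last by rewrite !cardsX cardsT card_mx.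
rewrite -(card_imset _ h_inj); congr #|pred_of_set _|.
have unitE t : (h t \in unitmx) = (t.1.1 \in unitmx) && (t.2 \in unitmx).
  by rewrite !unitmxE det_ublock unitrM.
have lE (i : 'I_x) : f' (lshift m i) = 0%N by rewrite /f' /= ltn_ord.
have rE (i : 'I_m) : f' (rshift x i) = (f i).+1.
  by rewrite /f' /= ltnNge leq_addr addKn.
apply/setP => A; rewrite inE; apply/andP/imsetP => [[uA /forallP A0]|[[[A1 A2] A3]]].
  have dl0 : dlsubmx A = 0.
    apply/matrixP => i j; rewrite !mxE; have /forallP/(_ (lshift m j)) := A0 (rshift x i).
    by rewrite lE rE => /eqP.
  have hA : A = h (ulsubmx A, ursubmx A, drsubmx A).
    by rewrite /h /= -[LHS]submxK dl0.
  exists (ulsubmx A, ursubmx A, drsubmx A) => //.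
  move: uA; rewrite {1}hA unitE /= => /andP[u1 u2].
  rewrite !in_setX !inE /= u1 u2 /=; apply/forallP => i; apply/forallP => j.
  have /forallP/(_ (rshift x j)) := A0 (rshift x i).
  by rewrite !rE ltnS !mxE.
rewrite !in_setX !inE /= andbT => /and3P[u1 u3 /forallP A3P] ->.
rewrite unitE /= u1 u3; split=> //; apply/forallP => i; apply/forallP => j.
case: (split_ordP i) => i' ->; first by rewrite lE ltn0.
case: (split_ordP j) => j' ->.
  by rewrite lE rE block_mxEdl mxE eqxx implybT.
by rewrite !rE ltnS block_mxEdr; apply: (forallP (A3P i')).
Qed.

Lemma block_count_reshape s :
  block_count (sumn s) (reshape_index s) =
    (\prod_(x <- s) unit_count x * #|F| ^ (\sum_(i < size s) nth 0 s i * sumn (drop i.+1 s)))%N.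
Proof.
elim: s => [|x s IH] /=.
  rewrite big_nil big_ord0 mul1n expn0 -[RHS](cards1 (0 : 'M[F]_0)).
  congr #|pred_of_set _|; apply/setP => A; rewrite !inE !thinmx0 eqxx.
  by rewrite unitmxE det_mx00 unitr1; apply/forallP => -[].
rewrite (eq_block_count _ (reshape_index_cons x s)) block_count_cat IH.
by rewrite big_cons big_ord_recl /= drop0 expnD; ring.
Qed.

Lemma unit_count_GL m : unit_count m.+1 = #|'GL_m.+1[F]%g|.
Proof. by rewrite cardsT /= /unit_count cardsE card_sub. Qed.

Lemma logn_unit_count l x : prime l -> ~~ (l %| #|F|)%N -> (0 < x)%N ->
  logn l (unit_count x) = logn l (\prod_(1 <= i < x.+1) (#|F| ^ i - 1))%N.
Proof.
case: x => // x l_pr lq _; have q_gt1 : (1 < #|F|)%N := card_finNzRing_gt1 F.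
rewrite unit_count_GL card_GL // lognM ?expn_gt0 ?(ltnW q_gt1) //.
  by rewrite lognX (lognE l #|F|) (negPf lq) !andbF muln0.
rewrite big_seq_cond; apply: prodn_cond_gt0 => i; rewrite mem_index_iota andbT => /andP[i1 _].
by rewrite subn_gt0 -[1%N](expn0 #|F|) ltn_exp2l.
Qed.

Section Index.
Variables (N l e : nat).
Local Notation n := N.+1.
Local Notation q := #|F|.
Hypothesis l_pr : prime l.
Hypothesis lq : ~~ (l %| q)%N.
Hypothesis e_ge2 : (2 <= e)%N.
Hypothesis le : (l %| gsum q e)%N.
Hypothesis e_min : forall i, (2 <= i)%N -> (l %| gsum q i)%N -> (e <= i)%N.
Let q_gt1 : (1 < q)%N := card_finNzRing_gt1 F.

Lemma unit_count_gt0 x : (0 < unit_count x)%N.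
Proof. by rewrite card_gt0; apply/set0Pn; exists 1%:M; rewrite inE unitmx1. Qed.

Lemma logn_block_count s : 0%N \notin s ->
  logn l (block_count (sumn s) (reshape_index s)) =
    (sumn s * logn l (q - 1) + \sum_(x <- s) weight q l e x)%N.
Proof.
move=> s_pos; rewrite block_count_reshape lognM ?expn_gt0 ?(ltnW q_gt1) //; last first.
  by apply: prodn_gt0 => x; apply: unit_count_gt0.
rewrite lognX (lognE l q) (negPf lq) !andbF muln0 addn0.
elim: s s_pos => [|x s IH]; first by rewrite !big_nil logn1.
rewrite inE negb_or eq_sym -lt0n => /andP[x_gt0 /IH e'].
rewrite !big_cons lognM ?unit_count_gt0 //; last first.
  by apply: prodn_gt0 => y; apply: unit_count_gt0.
rewrite e' logn_unit_count // (logn_gaussian_factorial q_gt1 l_pr lq e_ge2 le e_min) /=.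
by rewrite mulnDl; lia.
Qed.

Lemma card_block_group f : #|block_group N F f| = block_count n f.
Proof.
rewrite -(card_imset _ (@mat_inj N F)); congr #|pred_of_set _|.
apply/setP => A; rewrite inE; apply/imsetP/andP => [[g gP ->]|[uA /forallP A0]].
  split; first exact: mat_unit.
  by apply/forallP => i; apply/forallP => j; apply/implyP => ji; have /block_groupP -> := gP.
have [g gA] := mat_surj uA; exists g => //; apply/block_groupP => i j ji.
by have /forallP/(_ j) := A0 i; rewrite ji gA => /eqP.
Qed.

(** The order of a block triangular group is a power of [q] times the orders of
    the general linear groups of its blocks.  The factors [q - 1] cancel in the
    index because the parts add up to [n]. *)
Lemma logn_index a : is_composition n a ->
  (logn l #|[set: GLg N F] : block_group N F (reshape_index a)|%g
    + \sum_(x <- a) weight q l e x = weight q l e n)%N.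
Proof.
case/andP => a_pos /eqP a_sum.
have := Lagrange (subsetT (block_group_group N F (reshape_index a))).
move/(congr1 (logn l)); rewrite lognM ?cardG_gt0 ?indexg_gt0 //=.
rewrite card_block_group -{1}a_sum logn_block_count // a_sum.
have -> : #|[set: GLg N F]| = unit_count n by rewrite unit_count_GL.
rewrite logn_unit_count // (logn_gaussian_factorial q_gt1 l_pr lq e_ge2 le e_min).
by rewrite -addnA => /eqP; rewrite eqn_add2l addnC => /eqP.
Qed.

End Index.
End BlockOrder.

(** * Compositions as sets of simple roots *)

Section Inner.
Local Open Scope nat_scope.
Implicit Types (a b s u v : seq nat) (x y k m : nat).

(** The inner positions are the simple roots of the Levi subgroup attached to [a];
    a composition of a given integer amounts to a set of simple roots. *)
Definition inner a k := (k.+1 < sumn a) && (reshape_index a k == reshape_index a k.+1).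

Lemma inner_cons x s k : 0 < x ->
  inner (x :: s) k = (k.+1 < x) || ((x <= k) && inner s (k - x)).
Proof.
move=> x_gt0; rewrite /inner /= !reshape_index_cons.
have [k1x|xk1] /= := ltnP k.+1 x.
  by rewrite (ltnW k1x) eqxx andbT (leq_trans k1x) ?leq_addr.
have [kx|xk] /= := ltnP k x; first by rewrite andbF.
by rewrite eqSS subSn //; congr (_ && _); lia.
Qed.

Lemma inner_merge u v x y k : 0 \notin u -> 0 < x -> 0 < y ->
  inner (u ++ (x + y) :: v) k = inner (u ++ x :: y :: v) k || (k.+1 == sumn u + x).
Proof.
move=> + x_gt0 y_gt0; elim: u k => [|z u IH] k /=.
  move=> _; rewrite !inner_cons ?addn_gt0 ?x_gt0 // subnDA.
  by case: (inner v _); lia.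
rewrite inE negb_or eq_sym -lt0n => /andP[z_gt0 u_pos].
rewrite !inner_cons // IH //.
by case: (inner _ _); lia.
Qed.

Lemma inner_in u v x y k : 0 \notin u -> 0 < x -> 0 < y ->
  sumn u <= k -> k.+1 < sumn u + x + y -> k.+1 != sumn u + x ->
  inner (u ++ x :: y :: v) k.
Proof.
move=> + x_gt0 y_gt0; elim: u k => [|z u IH] k /=.
  by move=> _; rewrite !inner_cons //; lia.
rewrite inE negb_or eq_sym -lt0n => /andP[z_gt0 u_pos] H1 H2 H3.
by rewrite inner_cons // IH //; lia.
Qed.

Lemma inner_out u v x y k : 0 \notin u -> 0 < x -> 0 < y ->
  [|| k.+1 == sumn u, k.+1 == sumn u + x | k.+1 == sumn u + x + y] ->
  ~~ inner (u ++ x :: y :: v) k.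
Proof.
move=> + x_gt0 y_gt0; elim: u k => [|z u IH] k /=.
  by move=> _ H; rewrite !inner_cons //; move: H; case: (inner v _); lia.
rewrite inE negb_or eq_sym -lt0n => /andP[z_gt0 u_pos] H.
rewrite inner_cons //; apply/negP => /orP[k1z|/andP[zk]]; first by move: H; lia.
by apply/negP/IH => //; move: H; lia.
Qed.

Lemma inner_surj (J : pred nat) m :
  exists a, [/\ 0 \notin a, sumn a = m.+1 & forall k, k < m -> inner a k = J k].
Proof.
elim: m J => [|m IH] J; first by exists [:: 1].
have [[|x s] [a_pos a_sum aJ]] := IH (fun k => J k.+1); first by [].
move: a_pos; rewrite inE negb_or eq_sym -lt0n => /andP[x_gt0 s_pos].
case J0 : (J 0).
  exists (x.+1 :: s); split=> [||[|k] km].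
  - by rewrite inE negb_or.
  - by move: a_sum => /= <-.
  - by rewrite inner_cons // J0 ltnS x_gt0.
  by rewrite -aJ // !inner_cons // subSS !ltnS.
exists [:: 1, x & s]; split=> [||[|k] km].
- by rewrite !inE /= negb_or [0 == x]eq_sym -lt0n x_gt0.
- by move: a_sum => /= ->.
- by rewrite inner_cons // J0.
by rewrite inner_cons //= subn1 aJ.
Qed.

Lemma inner_inj a b : 0 \notin a -> 0 \notin b -> sumn a = sumn b ->
  (forall k, k.+1 < sumn a -> inner a k = inner b k) -> a = b.
Proof.
elim: a b => [|x a IH] [|y b] //=.
- by rewrite inE negb_or eq_sym -lt0n => _ /andP[y_gt0 _]; lia.
- by rewrite inE negb_or eq_sym -lt0n => /andP[x_gt0 _]; lia.
rewrite !inE !negb_or ![0 == _]eq_sym -!lt0n => /andP[x_gt0 a_pos] /andP[y_gt0 b_pos].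
move=> e_sum eJ; have exy : x = y.
  case: (ltngtP x y) => // [xy|yx].
    have := eJ x.-1; rewrite prednK // !inner_cons // prednK //; lia.
  have := eJ y.-1; rewrite prednK // !inner_cons // prednK //; lia.
rewrite exy; congr (_ :: _); apply: IH => //; first by lia.
move=> k k_lt; have := eJ (k + y); rewrite exy !inner_cons // leq_addl addnK /=.
have -> : ((k + y).+1 < y) = false by lia.
by apply; lia.
Qed.

End Inner.

(** * Classification of the standard parabolic subgroups *)

Section Classification.
Variables (N : nat) (F : finFieldType).
Local Notation n := N.+1.
Local Notation G := (GLg N F).
Local Notation B := (upper_triangular N F).
Local Notation mat := (@mat N F).
Local Notation pm := (@pm N F).
Implicit Types (g h u v : G) (s t : 'S_n).

Lemma tv_commutator (i j l : 'I_n) (c : F) : i != j -> j != l -> i != l ->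
  (tv i j 1%R * tv j l c)%g = (tv i l c * (tv j l c * tv i j 1%R))%g.
Proof.
move=> ij jl il; apply: mat_inj; apply/matrixP => k m.
rewrite !mat_tvl // !mat_tv // !mxE eqxx.
have [->|ki] := eqVneq k i.
  rewrite (negPf ij) [l == i]eq_sym (negPf il) [l == j]eq_sym (negPf jl) /=.
  by rewrite ![m == _]eq_sym; case: (i == m); case: (j == m); case: (l == m) => /=; ring.
have [->|kj] /= := eqVneq k j; last by ring.
by rewrite [l == i]eq_sym (negPf il) ![m == _]eq_sym; case: (j == m); case: (l == m) => /=; ring.
Qed.

Lemma pm_tv_conj s (i j : 'I_n) (c : F) : i != j ->
  (pm s * tv (s i) (s j) c * (pm s)^-1)%g = tv i j c.
Proof.
move=> ij; apply: mat_inj; apply/matrixP => k m.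
rewrite -pmV mat_pmr invgK mat_pml !mat_tv ?(inj_eq perm_inj) // !mxE.
by rewrite !(inj_eq perm_inj).
Qed.

Variable P : {group G}.
Hypothesis sBP : B \subset P.

Let upper_in (i j : 'I_n) (c : F) : (i < j)%N -> tv i j c \in P.
Proof.
by move=> ij; rewrite (subsetP sBP) // (subsetP (unipotent_borel _ _)) // tv_unipotent.
Qed.

Let comm_in (i j l : 'I_n) (c : F) : i != j -> j != l -> i != l ->
  tv i j 1%R \in P -> tv j l c \in P -> tv i l c \in P.
Proof.
move=> ij jl il ijP jlP; have e := tv_commutator c ij jl il.
have : (tv i l c * (tv j l c * tv i j 1%R))%g \in P by rewrite -e groupM.
by rewrite groupMr // groupM.
Qed.

(** An overgroup of the upper triangular group with an element that is nonzero
    below the diagonal at position [k] contains the [k]-th adjacent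
    transposition: its Bruhat factor conjugates an upper transvection to one
    crossing position [k], and commutators bring it next to the diagonal. *)
Lemma adjacent_in (k k' i j : 'I_n) g : k' = k.+1 :> nat -> g \in P ->
  (j <= k)%N -> (k < i)%N -> mat g i j != 0 -> pm (tperm k k') \in P.
Proof.
move=> kk' gP jk ki gij; have [u [s [b [uU bB eg]]]] := bruhat g.
have uP : u \in P by rewrite (subsetP sBP) // (subsetP (unipotent_borel _ _)).
have bP : b \in P by rewrite (subsetP sBP).
have sP : pm s \in P by move: gP; rewrite eg groupMr // groupMl.
have [m im sm] : exists2 m : 'I_n, (i <= m)%N & (s m <= j)%N.
  have [m /eqP] : exists m, mat u i m * mat b (s m) j != 0.
    apply/existsP; apply: contraNT gij; rewrite negb_exists => /forallP all0.
    rewrite eg -mulgA matM mxE big1 // => m _; rewrite mat_pml.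
    by have := all0 m; rewrite negbK => /eqP.
  move=> ne0; exists m; rewrite leqNgt; apply/negP => H; apply: ne0.
    have /unipotentP -> := uU; last exact: ltnW.
    by rewrite -val_eqE gtn_eqF ?mul0r.
  by have /borelP -> := bB; rewrite ?mulr0.
have [m' m'k sm'] : exists2 m' : 'I_n, (m' <= k)%N & (k < s m')%N.
  have [/existsP[m' /andP[]]|] := boolP [exists m' : 'I_n, (m' <= k) && (k < s m')]%N.
    by move=> ? ?; exists m'.
  rewrite negb_exists => /forallP none; pose S := [set x : 'I_n | (x <= k)%N].
  have sS : s @: S = S.
    apply/eqP; rewrite eqEcard card_imset ?leqnn ?andbT; last exact: perm_inj.
    apply/subsetP => _ /imsetP[x xS ->]; rewrite !inE in xS *.
    by have := none x; rewrite xS -leqNgt.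
  have : s m \in S by rewrite inE (leq_trans sm).
  rewrite -sS mem_imset ?inE; last exact: perm_inj.
  by rewrite leqNgt (leq_trans ki).
have mm' : m != m' by rewrite -val_eqE gtn_eqF // (leq_ltn_trans m'k) // (leq_trans ki).
have low c : tv m m' c \in P.
  rewrite -(pm_tv_conj s c mm') !groupM ?groupV //; apply: upper_in.
  by rewrite (leq_ltn_trans sm) // (leq_ltn_trans jk).
have low1 c : tv k' m' c \in P.
  have [->|ne] := eqVneq k' m; first exact: low.
  have k'm : (k' < m)%N.
    by rewrite ltn_neqAle val_eqE ne kk' (leq_trans ki).
  apply: (comm_in ne mm' _ (upper_in _ k'm) (low c)).
  by rewrite -val_eqE gtn_eqF //= kk' ltnS.
have low2 : tv k' k 1%R \in P.
  have [e|nk] := eqVneq m' k; first by move: (low1 1%R); rewrite e.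
  have lt_m'k : (m' < k)%N by rewrite ltn_neqAle val_eqE nk.
  apply: (comm_in _ nk _ (low1 _) (upper_in _ lt_m'k)).
    by rewrite -val_eqE gtn_eqF //= kk' ltnS.
  by rewrite -val_eqE gtn_eqF //= kk'.
have k'k : k' != k by rewrite -val_eqE gtn_eqF //= kk'.
have yE x z : mat (tv k' k 1%R) x z = (x == z)%:R + (if (x == k') && (z == k) then 1 else 0).
  rewrite mat_tv // !mxE; case: (x =P k') => //= _; case: (z =P k) => _ /=;
  by rewrite ?mulr1 ?mulr0.
have := @min_parabolic_cosets N F int k k' (tv k' k 1%R) kk'.
have -> : (tv k' k 1%R \in B) = false.
  apply/negP => /borelP/(_ k' k); rewrite kk' => /(_ (ltnSn _))/eqP.
  by rewrite yE (negPf k'k) !eqxx add0r oner_eq0.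
have -> : min_parabolic k k' (tv k' k (1%R : F)).
  apply/min_parabolicP => x z zx; rewrite xpair_eqE yE => /negPf ->.
  by rewrite -val_eqE gtn_eqF ?addr0.
rewrite add0r => sum1.
have [t tB] : exists t : F, (tv k' k 1%R * tv k k' t * pm (tperm k k') \in B)%g.
  apply/existsP; apply: contraPT sum1; rewrite negb_exists => /forallP none.
  by rewrite big1 // => t _; rewrite (negPf (none t)).
have /(subsetP sBP) := tB; rewrite groupMl // groupM // upper_in //.
by rewrite kk'.
Qed.

(** The positions [k] crossed by some element of [P], in the sense of a nonzero
    entry to the lower left of [k], give the composition.  By [adjacent_in],
    [P] contains the adjacent transpositions at these positions, hence all
    permutations preserving the blocks; Bruhat decomposition does the rest. *)
Lemma parabolic_classification :
  exists2 a, is_composition n a & P = block_group N F (reshape_index a) :> {set G}.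
Proof.
pose J k := [exists g : G, (g \in P) && [exists i : 'I_n, exists j : 'I_n,
  [&& (j <= k)%N, (k < i)%N & mat g i j != 0]]].
have [a [a_pos a_sum aJ]] := inner_surj J N.
have riJ k : (k < N)%N -> (reshape_index a k == reshape_index a k.+1) = J k.
  by move=> kN; rewrite -aJ // /inner a_sum ltnS kN.
exists a; first by rewrite /is_composition a_pos a_sum eqxx.
have ri_mono := @reshape_index_mono a.
apply/eqP; rewrite eqEsubset; apply/andP; split; apply/subsetP => g gP.
  apply/block_groupP => i j ji; apply: contraTeq ji => gij; rewrite -leqNgt.
  case: (leqP i j) => [/ri_mono //|lt_ji].
  have step m : (j + m <= i)%N -> (reshape_index a (j + m) <= reshape_index a j)%N.
    elim: m => [|m IH] le_m; first by rewrite addn0.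
    apply: leq_trans (IH _); last by lia.
    have jmN : (j + m < N)%N by have := ltn_ord i; lia.
    suff e : reshape_index a (j + m) == reshape_index a (j + m).+1 by rewrite addnS (eqP e).
    rewrite riJ //; apply/existsP; exists g; rewrite gP.
    by apply/existsP; exists i; apply/existsP; exists j; rewrite leq_addr gij andbT -addnS.
  by have := step (i - j)%N; rewrite subnKC ?(ltnW lt_ji) //; apply.
have adj (k k' : 'I_n) : k' = k.+1 :> nat -> reshape_index a k = reshape_index a k' ->
    pm (tperm k k') \in P.
  move=> kk' e; have kN : (k < N)%N by have := ltn_ord k'; lia.
  have : J k by rewrite -riJ // -kk' e.
  case/existsP => h /andP[hP /existsP[i /existsP[j /and3P[jk ki hij]]]].
  exact: (adjacent_in kk' hP jk ki hij).
have perm_in s : (forall i : 'I_n, reshape_index a (s i) = reshape_index a i) -> pm s \in P.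
  move=> sa; apply: contraT => sP.
  pose W := [set w : 'S_n | [forall i : 'I_n, reshape_index a (w i) == reshape_index a i]
                            && (pm w \notin P)].
  have sW : s \in W by rewrite inE sP andbT; apply/forallP => i; rewrite sa.
  case: (arg_maxnP (fun w : 'S_n => \sum_(i < n) i * w i)%N sW) => w wW wmax.
  have : w \in W := wW; rewrite inE => /andP[/forallP wa wP].
  have [asc|] := boolP (ascending (reshape_index a) w).
    case/negP: wP; suff -> : w = 1%g by rewrite pm1 group1.
    apply: perm_ascending_id => i j ij.
    have [lt_r|] := ltnP (reshape_index a i) (reshape_index a j).
      rewrite ltnNge; apply/negP => /ri_mono.
      by rewrite (eqP (wa i)) (eqP (wa j)) leqNgt lt_r.
    move=> ge_r; move/ascendingP: asc; apply=> //.
    by apply/eqP; rewrite eqn_leq ge_r ri_mono // ltnW.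
  move=> nasc; exfalso; move/negP: nasc; apply.
  apply: (ascending_adjacent ri_mono) => k k' kk' e; rewrite ltnNge; apply/negP.
  rewrite leq_eqVlt => /orP[/eqP/val_inj/perm_inj ek|lt_w].
    by move: kk'; rewrite ek; lia.
  have kW : (tperm k k' * w)%g \in W.
    rewrite inE pmM groupMl ?adj // wP andbT; apply/forallP => i; rewrite permM.
    by rewrite (eqP (wa _)); case: tpermP => [->|->|_ _]; rewrite ?e.
  have /= := wmax _ kW; rewrite leqNgt => /negP[].
  have := tperm_adjacent_sum (t := (tperm k k' * w)%g) kk'.
  by rewrite mulgA tperm2 mul1g !permM tpermL tpermR; apply.
have [u [s [b [uU bB eg]]]] := bruhat g.
have uB : u \in B by rewrite (subsetP (unipotent_borel _ _)).
have sP : pm s \in block_group N F (reshape_index a).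
  have sB := subsetP (borel_block_group N F ri_mono).
  have -> : pm s = (u^-1 * g * b^-1)%g by rewrite eg !mulgA mulVg mul1g mulgK.
  have uQ : u \in block_group_group N F (reshape_index a) := sB _ uB.
  have bQ : b \in block_group_group N F (reshape_index a) := sB _ bB.
  exact: groupM (groupM (groupVr uQ) gP) (groupVr bQ).
have [uP bP] := (subsetP sBP u uB, subsetP sBP b bB).
rewrite eg; apply: groupM (groupM uP _) bP; apply: perm_in => i.
have dom (i0 : 'I_n) : (reshape_index a ((1%g : 'S_n) i0) <= reshape_index a (s i0))%N.
  rewrite perm1 leqNgt; apply/negP => lt_r; have /block_groupP := sP.
  by move/(_ _ _ lt_r)/eqP; rewrite mat_pm !mxE eqxx oner_eq0.
by have := perm_dominated (f := fun i : 'I_n => reshape_index a i) dom i; rewrite perm1.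
Qed.

End Classification.

(** * The coefficient ring *)

Section LocalRing.
Variables (R : idomainType) (l : nat).
Hypothesis l_pr : prime l.
Hypothesis hlocal : local_with_maximal_ideal (multiples l R).
Hypothesis hchar : [pchar R] =i pred0.
Implicit Types (x y r : R) (m : nat).

Lemma multiples_maximal : maximal_ideal (multiples l R).
Proof. by apply/(hlocal (multiples l R)) => x. Qed.

Lemma one_not_multiple : 1 \notin multiples l R.
Proof. by have [[]] := multiples_maximal. Qed.

(** A nonunit lies in a maximal ideal, by Zorn. *)
Lemma unit_or_multiple x : x \notin multiples l R -> x \is a GRing.unit.
Proof.
move=> xl; apply: contraT => x_nu; case/negP: xl.
pose good (J : R -> bool) : Prop := idealr_closed (J : {pred R}) /\ x \in (J : {pred R}).
pose J0 : R -> bool := fun y => `[< exists r, y = r * x >].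
have J0_good : good J0.
  split; last by apply/asboolP; exists 1; rewrite mul1r.
  split; first by apply/asboolP; exists 0; rewrite mul0r.
    apply/asboolP => -[r e]; case/negP: x_nu; apply/unitrPr.
    by exists r; rewrite mulrC -e.
  move=> a _ _ /asboolP[r ->] /asboolP[r' ->]; apply/asboolP; exists (a * r + r').
  by rewrite mulrDl mulrA.
pose T := {J : R -> bool | good J}.
pose sub (s t : T) := `[< forall y, sval s y -> sval t y >].
have [||A tot|[J [Jid xJ]] Jmax] := @classical_sets.ZL_preorder T (exist _ J0 J0_good) sub.
- by move=> t; apply/asboolP.
- by move=> r s t /asboolP rs /asboolP st; apply/asboolP => y /rs/st.
- have [[t0 At0]|noA] := pselect (exists t, A t); last first.
    by exists (exist _ J0 J0_good) => s As; case: noA; exists s.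
  pose K : R -> bool := fun y => `[< exists2 s, A s & y \in sval s >].
  have K_good : good K.
    split; last by apply/asboolP; exists t0 => //; case: (svalP t0).
    split; first by apply/asboolP; exists t0 => //; case: (svalP t0) => -[].
      by apply/asboolP => -[s _]; case: (svalP s) => -[_ /negP].
    move=> a u v /asboolP[s As us] /asboolP[t At vt]; apply/asboolP.
    have [/asboolP st|/asboolP ts] := tot _ _ As At.
      by exists t => //; case: (svalP t) => -[_ _ cl] _; apply: cl => //; apply: st.
    by exists s => //; case: (svalP s) => -[_ _ cl] _; apply: cl => //; apply: ts.
  by exists (exist _ K K_good) => s As; apply/asboolP => y ys; apply/asboolP; exists s.
have /(hlocal J) eJ : maximal_ideal J.
  split=> // J' J'id JJ' y; apply/idP/idP => [yJ'|]; last exact: JJ'.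
  have /asboolP := Jmax (exist good J' (conj J'id (JJ' x xJ))) (asboolT JJ').
  by apply.
by rewrite -eJ.
Qed.

Lemma natr_unit m : ~~ (l %| m)%N -> (m%:R : R) \is a GRing.unit.
Proof.
move=> lm; apply: unit_or_multiple; apply/negP => /multiplesP[y ey].
have m_gt0 : (0 < m)%N by case: m lm {ey}; rewrite ?dvdn0.
have cop : coprime m l by rewrite coprime_sym prime_coprime.
have [u v e _] := egcdnP l m_gt0.
case/negP: one_not_multiple; apply/multiplesP; exists (u%:R * y - v%:R).
rewrite mulrnBl -mulrnAr -ey -natrM e -[(_ *+ l)]mulr_natr -natrM natrD (eqP cop).
by rewrite addrC addKr.
Qed.

Lemma natr_eq0 m : ((m%:R : R) == 0) = (m == 0%N).
Proof. exact: (pcharf0P R).1. Qed.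

Lemma double_eq0 r : r + r = 0 -> r = 0.
Proof.
by move/eqP; rewrite -mulr2n -mulr_natr mulf_eq0 natr_eq0 orbF => /eqP.
Qed.

Lemma multiple_or_unit r : r \in multiples l R \/ r \is a GRing.unit.
Proof.
by case: (boolP (r \in multiples l R)) => [|/unit_or_multiple]; [left|right].
Qed.

(** Cancel the common power of [l], which is nonzero in characteristic zero; on
    the side of smaller valuation an integer prime to [l] remains, a unit. *)
Lemma valuation_multiple (x y w : R) m m' : (0 < m)%N -> (0 < m')%N ->
  w \is a GRing.unit -> x * (w * m%:R) = y * (w * m'%:R) ->
  (logn l m < logn l m')%N -> x \in multiples l R.
Proof.
move=> m_gt0 m'_gt0 uw e lt_v; have [k lk ek] := pfactor_coprime l_pr m_gt0.
have [k' _ ek'] := pfactor_coprime l_pr m'_gt0.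
have uk : (k%:R : R) \is a GRing.unit by apply: natr_unit; rewrite -prime_coprime.
have lv : (l ^ logn l m)%:R != 0 :> R by rewrite natr_eq0 -lt0n expn_gt0 (prime_gt0 l_pr).
have e1 : x * k%:R = y * (k' * l ^ (logn l m' - logn l m))%:R.
  have mE : m%:R = k%:R * (l ^ logn l m)%:R :> R by rewrite -natrM -ek.
  have m'E : m'%:R = (k' * l ^ (logn l m' - logn l m))%:R * (l ^ logn l m)%:R :> R.
    by rewrite -natrM -mulnA -expnD subnK ?(ltnW lt_v) // -ek'.
  apply: (mulIf lv); apply: (mulIr uw).
  transitivity (x * (w * m%:R)); first by rewrite mE; ring.
  by rewrite e m'E; ring.
apply/multiplesP; exists (y * (k' * l ^ (logn l m' - logn l m).-1)%:R * k%:R^-1).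
apply: (mulIr uk); rewrite e1 -mulrnAl mulrVK // -mulrnAr -mulrnA -mulnA -expnSr prednK //.
by rewrite subn_gt0.
Qed.

Lemma valuation_unit (x y w : R) m m' : (0 < m)%N -> (0 < m')%N ->
  w \is a GRing.unit -> x * (w * m%:R) = y * (w * m'%:R) ->
  logn l m = logn l m' -> x \is a GRing.unit -> y \is a GRing.unit.
Proof.
move=> m_gt0 m'_gt0 uw e eq_v ux; have [k lk ek] := pfactor_coprime l_pr m_gt0.
have [k' lk' ek'] := pfactor_coprime l_pr m'_gt0.
have uk : (k%:R : R) \is a GRing.unit by apply: natr_unit; rewrite -prime_coprime.
have lv : (l ^ logn l m)%:R != 0 :> R by rewrite natr_eq0 -lt0n expn_gt0 (prime_gt0 l_pr).
suff e1 : x * k%:R = y * k'%:R.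
  by have : y * k'%:R \is a GRing.unit; [rewrite -e1 unitrM ux | rewrite unitrM => /andP[]].
have mE : m%:R = k%:R * (l ^ logn l m)%:R :> R by rewrite -natrM -ek.
have m'E : m'%:R = k'%:R * (l ^ logn l m)%:R :> R by rewrite -natrM eq_v -ek'.
apply: (mulIf lv); apply: (mulIr uw).
transitivity (x * (w * m%:R)); first by rewrite mE; ring.
by rewrite e m'E; ring.
Qed.

End LocalRing.

Section AdditiveCharacter.
Variables (F : finFieldType) (R : idomainType) (p : nat) (z : R).
Hypothesis hp : p \in [pchar F].
Hypothesis hz : p.-primitive_root z.

(** Compose a coordinate function over the prime field with the powers of [z]. *)
Lemma additive_character : exists psi : F -> R,
  [/\ forall x y, psi (x + y) = psi x * psi y, psi 0 = 1 & exists x, psi x != 1].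
Proof.
have p_pr := pcharf_prime hp; pose V := pPrimeCharType hp.
pose b := vbasis {:V}; pose coef i : V -> 'F_p := coord b i.
have [i ci] : exists i, coef i 1 != 0.
  apply/existsP; apply: contraT; rewrite negb_exists => /forallP c0.
  have := coord_vbasis (memvf (1 : V)); rewrite big1 => [/eqP|i _]; first by rewrite oner_eq0.
  by have := c0 i; rewrite negbK => /eqP; rewrite /coef => ->; rewrite scale0r.
have valD (u v : 'F_p) : val (u + v) = ((val u + val v) %% p)%N by rewrite /= {3}(Fp_cast p_pr).
exists (fun x : F => z ^+ val (coef i (x : V))); split.
- move=> x y; rewrite -exprD -[RHS](prim_expr_mod hz) -valD /coef.
  by congr (_ ^+ val _); rewrite -linearD.
- by rewrite /coef linear0 expr0.
exists 1; rewrite -[1 in X in _ != X](expr0 z) (eq_prim_root_expr hz) mod0n.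
rewrite modn_small; last by have := ltn_ord (coef i 1); rewrite [X in (_ < X)%N](Fp_cast p_pr).
by apply: contra ci => /eqP e; apply/eqP/val_inj.
Qed.

Lemma prime_not_dvd_card l : prime l -> l <> p -> ~~ (l %| #|F|)%N.
Proof.
move=> l_pr lp; have p_pr := pcharf_prime hp.
have -> : #|F| = #|pPrimeCharType hp| by [].
rewrite card_pprimeChar Euclid_dvdX // negb_and; apply/orP; left.
by rewrite dvdn_prime2 //; apply/eqP.
Qed.

End AdditiveCharacter.

(** * Submodules of the reduction of a principal left ideal *)

Section Reduction.
Variables (l : nat) (R : comNzRingType) (gT : finGroupType).
Local Notation A := (group_algebra R gT).
Variable x : A.
Local Notation M := (left_ideal x : lmodType A).
Local Notation L := (reduction l M).
Implicit Types (a b c : A) (v : L).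

Fact ideal_gen_mem : (x : A^o) \in left_ideal_pred x.
Proof. by apply/asboolP; exists 1; rewrite mul1r. Qed.
Definition ideal_gen : M := LeftIdeal ideal_gen_mem.

(** The class of [a * x]. *)
Definition red a : L := reduce l (a *: ideal_gen).

Lemma val_ideal_gen a : val (a *: ideal_gen) = a * x.
Proof. by []. Qed.

Lemma ideal_genP (w : M) : exists a, w = a *: ideal_gen.
Proof.
have /asboolP[a e] := valP w; exists a; apply: val_inj.
by rewrite val_ideal_gen -e.
Qed.

Lemma red_surj v : exists a, v = red a.
Proof.
have [a e] := ideal_genP (reduce_repr v); exists a.
by rewrite /red -e reduce_reprK.
Qed.

Lemma red_eq a b c : a * x = b * x + (c * x) *+ l -> red a = red b.
Proof.
move=> e; apply/reduceP; exists (c *: ideal_gen); apply: val_inj.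
by rewrite raddfD raddfMn.
Qed.

Lemma red_eqP a b : red a = red b -> exists c, a * x = b * x + (c * x) *+ l.
Proof.
move/reduceP => [w /(congr1 val)]; have [c ->] := ideal_genP w => e; exists c.
by move: e; rewrite raddfD raddfMn.
Qed.

Lemma redD a b : red (a + b) = red a + red b.
Proof. by rewrite /red scalerDl raddfD. Qed.

Lemma red0 : red 0 = 0.
Proof. by rewrite /red scale0r raddf0. Qed.

Lemma redM a b : red (a * b) = ga_residue l a *: red b.
Proof. by rewrite /red -scalerA reduceZ. Qed.

Variable X : {pred L}.
Hypothesis X_sub : submod_closed X.

Lemma submod_red0 : red 0 \in X.
Proof. by rewrite red0; case: X_sub. Qed.

Lemma submod_redM a b : red b \in X -> red (a * b) \in X.
Proof.
by move=> bX; rewrite redM -[_ *: _]addr0; apply: (X_sub.2) => //; case: X_sub.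
Qed.

Lemma submod_redD a b : red a \in X -> red b \in X -> red (a + b) \in X.
Proof. by move=> aX bX; rewrite redD -[red a]scale1r; apply: (X_sub.2). Qed.

End Reduction.

Section SubmoduleOf.
Variables (l : nat) (R : comNzRingType) (gT : finGroupType).
Local Notation A := (group_algebra R gT).
Variable x : A.
Local Notation M := (left_ideal x : lmodType A).
Variable Q : A -> Prop.
Hypothesis Q0 : Q 0.
Hypothesis QD : forall a b, Q a -> Q b -> Q (a + b).
Hypothesis QM : forall a b, Q b -> Q (a * b).

(** A submodule of the reduction given by a condition on representatives in the
    group algebra. *)
Definition submod_of : {pred reduction l M} := fun v => `[< exists2 a, red l x a = v & Q a >].

Lemma submod_of_closed : submod_closed submod_of.
Proof.
split; first by apply/asboolP; exists 0; rewrite ?red0.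
move=> k _ _ /asboolP[a <- Qa] /asboolP[b <- Qb]; apply/asboolP.
exists (ga_residue_repr k * a + b); last by apply: QD => //; apply: QM.
by rewrite redD redM ga_residue_reprK.
Qed.

Lemma submod_ofP a : (forall b, red l x b = red l x a -> Q b -> Q a) ->
  (red l x a \in submod_of) <-> Q a.
Proof.
move=> Qa; split=> [/asboolP[b e Qb]|Qa']; first exact: Qa e Qb.
by apply/asboolP; exists a.
Qed.

End SubmoduleOf.

(** * The composition series *)

Section Chain.
Variables (N : nat) (F : finFieldType) (R : idomainType) (l e : nat).
Local Notation n := N.+1.
Local Notation q := #|F|.
Local Notation G := (GLg N F).
Local Notation A := (group_algebra R G).
Local Notation elt := (@ga_elt R G).
Local Notation U := (unipotent N F).
Local Notation eps := (stein N F R).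
Local Notation L := (reduction l (left_ideal eps : lmodType A)).
Implicit Types (g : G) (a b : A) (c : nat -> F) (s : seq nat) (t : nat).

Variable psi : F -> R.
Hypothesis psiD : forall x y, psi (x + y) = psi x * psi y.
Hypothesis psi0 : psi 0 = 1.
Hypothesis psi_nontrivial : exists x, psi x != 1.
Hypothesis l_pr : prime l.
Hypothesis lq : ~~ (l %| q)%N.
Hypothesis e_ge2 : (2 <= e)%N.
Hypothesis le : (l %| gsum q e)%N.
Hypothesis e_min : forall i, (2 <= i)%N -> (l %| gsum q i)%N -> (e <= i)%N.
Hypothesis hlocal : local_with_maximal_ideal (multiples l R).
Hypothesis hchar : [pchar R] =i pred0.

Let q_unit : (q%:R : R) \is a GRing.unit. Proof. exact: natr_unit lq. Qed.
Let R_two : forall r : R, r + r = 0 -> r = 0. Proof. exact: double_eq0. Qed.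

Local Notation eig := (eig N psi).
Local Notation eig_coord := (@eig_coord N F R psi).
Local Notation norm := (norm N psi).
Local Notation red := (red l eps).
Local Notation multl := (multiples l R).

Let coordP c a : eig c * a * eps = eig_coord c a *: (eig c * eps).
Proof. exact: (eig_coordP psiD psi0 q_unit R_two). Qed.

Let coord_eq c a r : eig c * a * eps = r *: (eig c * eps) -> eig_coord c a = r.
Proof. exact: (eig_coord_eq psi0 q_unit). Qed.

Lemma eig_coordD c a b : eig_coord c (a + b) = eig_coord c a + eig_coord c b.
Proof. by apply: coord_eq; rewrite mulrDr mulrDl !coordP scalerDl. Qed.

Lemma eig_coordZ c r a : eig_coord c (r *: a) = r * eig_coord c a.
Proof.
by apply: coord_eq; rewrite -(ga_scalerAr r (eig c)) -(ga_scalerAl r _ eps) coordP scalerA.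
Qed.

Lemma eig_coord0 c : eig_coord c 0 = 0.
Proof. by rewrite -(scale0r (0 : A)) eig_coordZ mul0r. Qed.

Lemma eig_coord_sum c (I : Type) (r : seq I) (P : pred I) (f : I -> A) :
  eig_coord c (\sum_(i <- r | P i) f i) = \sum_(i <- r | P i) eig_coord c (f i).
Proof. by apply: (big_morph (eig_coord c)) => [a b|]; rewrite ?eig_coordD ?eig_coord0. Qed.

Lemma eig_coord_eig c : eig_coord c (eig c) = 1.
Proof.
apply: coord_eq; rewrite scale1r.
by rewrite (eig_idem N psiD psi0 q_unit).
Qed.

Lemma multl_mul r r' : r \in multl -> r' * r \in multl.
Proof. by move=> /multiplesP[y ->]; apply/multiplesP; exists (r' * y); rewrite mulrnAr. Qed.

Lemma red_multiple r a : r \in multl -> red (r *: a) = red 0.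
Proof.
move=> /multiplesP[y ->]; apply: (red_eq (c := y *: a)); rewrite mul0r add0r.
by rewrite -!(ga_scalerAl _ a) scalerMnl.
Qed.

Lemma red_coord c a : red (eig c * a) = red (eig_coord c a *: eig c).
Proof.
apply: (red_eq (c := 0)); rewrite mul0r mul0rn addr0 coordP.
exact: ga_scalerAl.
Qed.

Section Submodule.
Variable X : {pred L}.
Hypothesis X_sub : submod_closed X.

Lemma submodZ r a : red a \in X -> red (r *: a) \in X.
Proof. by move=> aX; rewrite -[a]mul1r ga_scalerAl; apply: submod_redM. Qed.

Lemma submod_unitZ r a : r \is a GRing.unit -> red (r *: a) \in X -> red a \in X.
Proof. by move=> ur /(submodZ r^-1); rewrite scalerA mulVr // scale1r. Qed.

Lemma link c c' x : eig_coord c' (x * eig c) \is a GRing.unit ->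
  red (eig c) \in X -> red (eig c') \in X.
Proof.
move=> ux cX; apply: (submod_unitZ ux); rewrite -red_coord mulrA.
exact: submod_redM.
Qed.

Lemma torus_link c c' : (forall k, (k < N)%N -> (c k == 0) = (c' k == 0)) ->
  red (eig c) \in X -> red (eig c') \in X.
Proof.
move=> cc'; have [h eh] := torus_coord psiD psi0 q_unit cc'.
by apply: link (elt h) _; rewrite eh unitr1.
Qed.

End Submodule.

(** Only the support of the parameters of a character matters, by [torus_link],
    so that one character for each composition suffices. *)
Definition block_char s : nat -> F := fun k => (inner s k)%:R.

Definition index_val s := logn l #|[set: G] : block_group N F (reshape_index s)|%g.

Lemma block_char_eq0 s k : (block_char s k == 0) = ~~ inner s k.
Proof. by rewrite /block_char; case: (inner s k); rewrite ?oner_eq0 ?eqxx. Qed.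

Lemma composition_of_char c : exists2 s, is_composition n s &
  forall k, (k < N)%N -> (block_char s k == 0) = (c k == 0).
Proof.
have [s [s_pos s_sum sJ]] := inner_surj (fun k => c k != 0) N.
exists s; first by rewrite /is_composition s_pos s_sum eqxx.
by move=> k kN; rewrite block_char_eq0 sJ // negbK.
Qed.

Lemma norm_block_char s : is_composition n s ->
  norm (block_char s) = (#|U|%:R)^-1 * #|[set: G] : block_group N F (reshape_index s)|%g%:R.
Proof.
case/andP => s_pos /eqP s_sum.
apply: (norm_index psiD psi0 psi_nontrivial q_unit (@reshape_index_mono s)) => k kN.
by rewrite block_char_eq0 negbK /inner s_sum ltnS kN.
Qed.

Let U_unit : ((#|U|%:R)^-1 : R) \is a GRing.unit.
Proof. by rewrite unitrV (card_unipotent_unit N q_unit). Qed.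

Lemma coord_symmetry s s' g : is_composition n s -> is_composition n s' ->
  eig_coord (block_char s) (elt g * eig (block_char s')) *
    ((#|U|%:R)^-1 * #|[set: G] : block_group N F (reshape_index s)|%g%:R) =
  eig_coord (fun k => - block_char s' k) (elt g^-1%g * eig (fun k => - block_char s k)) *
    ((#|U|%:R)^-1 * #|[set: G] : block_group N F (reshape_index s')|%g%:R).
Proof.
move=> cs cs'; rewrite -!norm_block_char //.
exact: (eig_coord_symmetry psiD psi0 q_unit R_two).
Qed.

(** By [coord_symmetry] this coefficient is a multiple of the ratio of the two
    indices. *)
Lemma separation s s' b : is_composition n s -> is_composition n s' ->
  (index_val s < index_val s')%N ->
  eig_coord (block_char s) (b * eig (block_char s')) \in multl.
Proof.
move=> cs cs' lt_v; rewrite [b]ga_expand mulr_suml eig_coord_sum.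
apply: rpred_sum => g _; rewrite -ga_scalerAl eig_coordZ; apply: multl_mul.
by apply: (valuation_multiple l_pr hlocal hchar _ _ U_unit (coord_symmetry g cs cs')).
Qed.

(** Merging gives a unit coefficient in one direction; when the norms have equal
    valuation, [coord_symmetry] gives one in the other direction. *)
Lemma merge_link (X : {pred L}) s s' : submod_closed X -> is_composition n s ->
  merge_equiv q l e s s' ->
  (red (eig (block_char s)) \in X) = (red (eig (block_char s')) \in X).
Proof.
move=> X_sub cs eqs; elim: eqs cs => {s s'}.
- by [].
- move=> a b ab IH cb; rewrite IH //; move: cb; rewrite /is_composition.
  by have [-> -> _] := merge_equiv_sum ab.
- move=> a b c ab IHab bc IHbc ca; rewrite IHab // IHbc //; move: ca.
  by rewrite /is_composition; have [-> -> _] := merge_equiv_sum ab.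
move=> u v x y x_gt0 y_gt0 w cs.
have cs' : is_composition n (u ++ (x + y)%N :: v).
  move: cs; rewrite /is_composition.
  by have [-> -> _] := merge_equiv_sum (merge_step u v x_gt0 y_gt0 w).
have [s_pos /eqP s_sum] := andP cs.
have u_pos : 0%N \notin u by move: s_pos; rewrite mem_cat negb_or => /andP[].
have [g ug] : exists g, eig_coord (block_char (u ++ x :: y :: v))
    (elt g * eig (block_char (u ++ (x + y)%N :: v))) \is a GRing.unit.
  have [||||||g ug] := @merge_coord N F R psi psiD psi0 q_unit R_two
    (inner (u ++ x :: y :: v)) (sumn u) x y.
  - by move: s_sum; rewrite sumn_cat /=; lia.
  - by [].
  - by [].
  - by move=> k /andP[]; rewrite s_sum ltnS.
  - by move=> k; apply: inner_in.
  - by move=> k; apply: inner_out.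
  exists g; move: ug; rewrite (eig_ext psi (c' := block_char (u ++ (x + y)%N :: v))) //.
  by move=> k _; rewrite /block_char inner_merge.
apply/idP/idP => sX; last exact: (link X_sub ug).
have eq_v : index_val (u ++ x :: y :: v) = index_val (u ++ (x + y)%N :: v).
  have /eqP := logn_index l_pr lq e_ge2 le e_min cs.
  rewrite -(logn_index l_pr lq e_ge2 le e_min cs').
  have [_ _ ->] := merge_equiv_sum (merge_step u v x_gt0 y_gt0 w).
  by rewrite eqn_add2r => /eqP.
have ug' := valuation_unit l_pr hlocal hchar (indexg_gt0 _ _) (indexg_gt0 _ _) U_unit
  (coord_symmetry g cs cs') eq_v ug.
have neg s (Y : {pred L}) : submod_closed Y ->
    (red (eig (block_char s)) \in Y) = (red (eig (fun k => - block_char s k)) \in Y).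
  by move=> Y_sub; apply/idP/idP; apply: torus_link => // k _; rewrite oppr_eq0.
by rewrite neg //; apply: (link X_sub ug'); rewrite -neg.
Qed.

(** By [eig_generate] an element is recovered from its projections on the
    eigenlines, each of which is zero modulo [l] or a unit multiple of the
    eigenvector. *)
Lemma submod_incl (X Y : {pred L}) : submod_closed X -> submod_closed Y ->
  (forall s, is_composition n s -> red (eig (block_char s)) \in Y ->
     red (eig (block_char s)) \in X) ->
  {subset Y <= X}.
Proof.
move=> X_sub Y_sub YX v; have [a ->] := red_surj v => aY.
apply: (@eig_generate N F R psi psiD psi0 psi_nontrivial q_unit (fun a => red a \in X)) => {v}.
- exact: submod_red0.
- by move=> b b'; apply: submod_redD.
- by move=> b b'; apply: submod_redM.
move=> c b; have baY : red (eig c * b * a) \in Y by apply: submod_redM.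
rewrite -mulrA red_coord in baY *.
have [lr|ur] := multiple_or_unit hlocal (eig_coord c (b * a)).
  by rewrite red_multiple //; apply: submod_red0.
apply: submodZ => //; have [s cs sc] := composition_of_char c.
apply: (torus_link X_sub sc); apply: YX => //.
apply: (torus_link Y_sub (c := c)) => [k kN|]; first by rewrite sc.
exact: (submod_unitZ Y_sub ur baY).
Qed.

(** The layers of the filtration of the lattice by the invariant form. *)
Definition layer t a := forall s, is_composition n s -> (index_val s < t)%N ->
  forall b, eig_coord (block_char s) (b * a) \in multl.

Lemma layer0 t : layer t 0.
Proof. by move=> s _ _ b; rewrite mulr0 eig_coord0 rpred0. Qed.

Lemma layerD t a b : layer t a -> layer t b -> layer t (a + b).
Proof. by move=> La Lb s cs st x; rewrite mulrDr eig_coordD rpredD ?La ?Lb. Qed.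

Lemma layerM t a b : layer t b -> layer t (a * b).
Proof. by move=> Lb s cs st x; rewrite mulrA; apply: Lb. Qed.

Lemma layer_red t a b : red b = red a -> layer t b -> layer t a.
Proof.
move=> /esym/red_eqP[x ex] Lb s cs st y.
have -> : eig_coord (block_char s) (y * a) =
    eig_coord (block_char s) (y * b) + eig_coord (block_char s) (y * x) *+ l.
  apply: coord_eq; rewrite scalerDl -scalerMnl -!coordP -!mulrA ex !mulrDr.
  by rewrite -!mulrnAr.
rewrite rpredD ?Lb //; apply/multiplesP.
by exists (eig_coord (block_char s) (y * x)).
Qed.

Definition layer_submod t : {pred L} := submod_of (layer t).

Lemma layer_closed t : submod_closed (layer_submod t).
Proof. by apply: submod_of_closed; [apply: layer0|apply: layerD|apply: layerM]. Qed.

Lemma eig_layer s t : is_composition n s ->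
  (red (eig (block_char s)) \in layer_submod t) = (t <= index_val s)%N.
Proof.
move=> cs; have memP := submod_ofP (@layer_red t (eig (block_char s))).
apply/idP/idP => [/memP Ls|ts].
  rewrite leqNgt; apply/negP => /(Ls s cs)/(_ 1).
  by rewrite mul1r eig_coord_eig (negPf (one_not_multiple hlocal)).
by apply/memP => s' cs' s't b; apply: separation => //; apply: leq_trans ts.
Qed.

Lemma layer_subset t t' : (t <= t')%N -> {subset layer_submod t' <= layer_submod t}.
Proof.
move=> tt'; apply: submod_incl; try exact: layer_closed.
by move=> s cs; rewrite !eig_layer //; apply: leq_trans.
Qed.

Section Separated.
(** The only ingredient that depends on the size of [n]. *)
Hypothesis val_inj : forall s s', is_composition n s -> is_composition n s' ->
  index_val s = index_val s' -> merge_equiv q l e s s'.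

(** A submodule between two consecutive layers is decided by whether it contains
    one eigenvector of valuation [t], since [merge_link] provides the others. *)
Lemma layer_covers s0 t t' : is_composition n s0 -> index_val s0 = t -> (t < t')%N ->
  (forall s, is_composition n s -> (t <= index_val s)%N ->
     index_val s = t \/ (t' <= index_val s)%N) ->
  submod_covers (layer_submod t') (layer_submod t).
Proof.
move=> cs0 s0t tt' gap; split.
- by split; apply: layer_closed.
- exact: layer_subset (ltnW tt').
- move=> /(_ (red (eig (block_char s0)))).
  by rewrite !eig_layer // s0t leqnn leqNgt tt' => /(_ isT).
move=> X X_sub loX Xhi; have [s0X|s0X] := boolP (red (eig (block_char s0)) \in X).
  right=> v; apply/idP/idP; [exact: Xhi | apply: submod_incl => // [|s cs]].
    exact: layer_closed.
  rewrite eig_layer // => /(gap s cs)[st|ts]; last by apply: loX; rewrite eig_layer.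
  by rewrite (merge_link X_sub cs (val_inj cs cs0 _)) // st s0t.
left=> v; apply/idP/idP; [apply: submod_incl => // [|s cs sX] | exact: loX].
  exact: layer_closed.
rewrite eig_layer //; have := Xhi _ sX; rewrite eig_layer // => /(gap s cs)[st|//].
by case/negP: s0X; rewrite -(merge_link X_sub cs (val_inj cs cs0 _)) // st s0t.
Qed.

Lemma chain_length (vs : seq nat) : sorted gtn vs ->
  (forall s, is_composition n s -> index_val s \in vs) ->
  (forall v, v \in vs -> exists2 s, is_composition n s & index_val s = v) ->
  has_composition_length L (size vs).
Proof.
move=> vs_sorted vs_all vs_val.
have vs_nth i j : (i < j)%N -> (j < size vs)%N -> (nth 0 vs j < nth 0 vs i)%N.
  move=> ij jv; apply: (sorted_ltn_nth (leT := gtn)) => //.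
    by move=> x y z xy yz; apply: ltn_trans yz xy.
  by rewrite inE (ltn_trans ij).
(* The thresholds of the filtration, starting above all values, where the layer
   vanishes. *)
pose t i := if i is j.+1 then nth 0%N vs j else (nth 0%N vs 0).+1.
have vs_le v i : v \in vs -> (nth 0 vs i <= v)%N -> (i < size vs)%N ->
    v = nth 0 vs i \/ (t i <= v)%N.
  move=> /(nthP 0%N)[j jv <-]; case: (ltngtP i j) => [ij|ji|->]; last by left.
    by rewrite leqNgt vs_nth.
  move=> _ iv; right; case: i ji iv => // i; rewrite ltnS leq_eqVlt /=.
  by move=> /orP[/eqP->//|ji] iv; apply/ltnW/vs_nth => //; apply: ltnW.
exists (fun i => layer_submod (t i)); split.
- move=> v; rewrite [RHS]inE; have Z_sub : submod_closed (pred1 (0 : L)).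
    split; first by rewrite inE.
    by move=> k x y; rewrite !inE => /eqP-> /eqP->; rewrite scaler0 addr0.
  apply/idP/eqP => [|->]; last by case: (layer_closed (t 0%N)).
  have : {subset layer_submod (t 0%N) <= pred1 (0 : L)}.
    apply: submod_incl => // [|s cs]; first exact: layer_closed.
    rewrite eig_layer // /t ltnNge => /negP[].
    have /(nthP 0%N)[j jv <-] := vs_all s cs; case: j jv => // j jv.
    exact/ltnW/vs_nth.
  by move=> sub /sub; rewrite inE => /eqP.
- move=> v; rewrite [RHS]inE; apply: (submod_incl (Y := predT)) => //.
    exact: layer_closed.
  move=> s cs _; rewrite eig_layer //; have /(nthP 0%N)[j jv <-] := vs_all s cs.
  case: (size vs) jv (@vs_nth j) => // m; rewrite /t ltnS leq_eqVlt.
  by case/orP => [/eqP->//|jm] /(_ m jm) H; apply/ltnW/H.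
move=> i iv; have [s0 cs0 s0t] := vs_val _ (mem_nth 0%N iv).
apply: (layer_covers cs0) => //=.
  by case: i iv {s0t} => [|i] iv /=; [apply: ltnSn | apply: vs_nth].
by move=> s cs H; have := vs_le _ _ (vs_all s cs) H iv.
Qed.

End Separated.
End Chain.

(** * Partitions with special parts *)

Section Partitions.
Local Open Scope nat_scope.
Variables (q l e n : nat).
Hypothesis l_pr : prime l.
Hypothesis e_ge2 : 2 <= e.
Local Notation X := (n %/ e).
Local Notation d := (logn l (gsum q e)).
Local Notation weight := (weight q l e).
Local Notation special := (special l e).
Implicit Types (y z : nat * (nat * nat)) (b s : seq nat).

Let l_gt1 : 1 < l. Proof. exact: prime_gt1. Qed.
Let l_gt0 : 0 < l. Proof. exact: ltnW. Qed.
Let e_gt0 : 0 < e. Proof. exact: ltnW. Qed.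

(** The number of multiples of [e] used by the parts [e], [e * l], [e * l ^ 2]
    with multiplicities [y.2.2], [y.2.1], [y.1]. *)
Definition load y := y.2.2 + l * y.2.1 + l ^ 2 * y.1.
Definition load_weight y := d * load y + y.2.1 + l.+1 * y.1.

Definition parts y : seq nat :=
  nseq (n - e * load y) 1 ++ nseq y.2.2 e ++ nseq y.2.1 (e * l) ++ nseq y.1 (e * l ^ 2).

Lemma load_le y : (load y <= X) = (e * load y <= n).
Proof. by rewrite leq_divRL // mulnC. Qed.

Lemma parts_composition y : load y <= X -> is_composition n (parts y).
Proof.
rewrite load_le => yn; rewrite /is_composition /parts !sumn_cat !sumn_nseq.
have [el_gt0 el2_gt0] : 0 < e * l /\ 0 < e * l ^ 2 by rewrite !muln_gt0 e_gt0 l_gt0.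
rewrite !mem_cat !mem_nseq !(@ltn_eqF 0) ?e_gt0 ?el_gt0 ?el2_gt0 //= !andbF /=.
apply/eqP; rewrite mul1n -[RHS](subnK yn); congr (_ + _).
by rewrite /load !mulnDr !mulnA addnA.
Qed.

Lemma parts_special y (b : nat) : b \in parts y -> special b.
Proof.
rewrite /parts !mem_cat !mem_nseq => /or4P[] /andP[_ /eqP->]; first by left.
- by right; exists 0; rewrite muln1.
- by right; exists 1; rewrite expn1.
by right; exists 2.
Qed.

Lemma sizes_increasing : [/\ 1 < e, e < e * l & e * l < e * l ^ 2].
Proof. by rewrite e_ge2 ltn_Pmulr // -mulnn mulnA ltn_Pmulr ?muln_gt0 ?e_gt0. Qed.

Lemma parts_sorted y : sorted leq (parts y).
Proof.
have [e1 el el2] := sizes_increasing.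
have sorted_nseq k (x : nat) s : (forall t, t \in s -> x <= t) -> sorted leq s ->
    sorted leq (nseq k x ++ s).
  move=> xs ss; elim: k => [|k IH] //=; rewrite path_min_sorted //.
  apply/allP => z; rewrite mem_cat mem_nseq => /orP[/andP[_ /eqP->] //|]; exact: xs.
rewrite /parts -[nseq y.1 _]cats0.
apply: (sorted_nseq _ _ _ _) => [x|]; last apply: (sorted_nseq _ _ _ _) => [x|];
  last apply: (sorted_nseq _ _ _ _) => [x|]; last exact: (sorted_nseq _ _ _ _).
- by rewrite !mem_cat !mem_nseq in_nil orbF => /or3P[] /andP[_ /eqP->]; lia.
- by rewrite !mem_cat !mem_nseq in_nil orbF => /orP[] /andP[_ /eqP->]; lia.
by rewrite mem_cat mem_nseq in_nil orbF => /andP[_ /eqP->]; lia.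
Qed.

Lemma weight_sizes :
  [/\ weight e = d, weight (e * l) = d * l + 1 & weight (e * l ^ 2) = d * l ^ 2 + l.+1].
Proof.
have we : weight e = d by rewrite -[X in weight X]muln1 weight_mul // muln1 logn1 addn0.
rewrite we !weight_mul // logn_fact_prime //; split=> //; congr (_ + _).
rewrite logn_fact // big_ltn; last by rewrite ltnS expn_gt0 l_gt0.
rewrite big_ltn; last by rewrite ltnS -mulnn (leq_trans _ (leq_pmulr _ _)).
rewrite big_nat_cond big1 => [|k /andP[/andP[k3 _] _]].
  by rewrite addn0 expn1 -{1}mulnn mulnK // divnn expn_gt0 l_gt0 addn1.
by rewrite divn_small // ltn_exp2l.
Qed.

Lemma parts_weight y : \sum_(x <- parts y) weight x = load_weight y.
Proof.
have [w0 w1 w2] := weight_sizes.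
have sum_nseq k (x : nat) : \sum_(t <- nseq k x) weight t = k * weight x.
  by rewrite big_nseq iter_addn_0 mulnC.
rewrite /parts !big_cat /= !sum_nseq w0 w1 w2 weight1 // muln0 add0n.
by rewrite /load_weight /load; ring.
Qed.

Lemma count_parts y x : x \in [:: e; e * l; e * l ^ 2] -> 
  count_mem x (parts y) = if x == e then y.2.2 else if x == e * l then y.2.1 else y.1.
Proof.
have [e1 el el2] := sizes_increasing; rewrite /parts !count_cat !count_nseq /=.
rewrite !inE => /or3P[] /eqP->; rewrite ?eqxx.
- by rewrite !(gtn_eqF e1, ltn_eqF e1, gtn_eqF el, gtn_eqF (ltn_trans el el2)); lia.
- rewrite !(ltn_eqF (ltn_trans e1 el), ltn_eqF el, gtn_eqF el, gtn_eqF el2); lia.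
rewrite !(ltn_eqF (ltn_trans e1 (ltn_trans el el2)), ltn_eqF (ltn_trans el el2),
  gtn_eqF (ltn_trans el el2), ltn_eqF el2, gtn_eqF el2); lia.
Qed.

Lemma parts_inj y z : parts y = parts z -> y = z.
Proof.
have [e1 el el2] := sizes_increasing.
move=> eq_p; have c x := congr1 (count_mem x) eq_p.
have := c e; rewrite !count_parts ?inE ?eqxx // => e22.
have := c (e * l); rewrite !count_parts ?inE ?eqxx ?orbT // gtn_eqF // => e21.
have := c (e * l ^ 2); rewrite !count_parts ?inE ?eqxx ?orbT //.
rewrite gtn_eqF ?(ltn_trans el el2) // gtn_eqF // => e11.
by case: y z e11 e21 e22 {eq_p c} => [y1 [y2 y3]] [z1 [z2 z3]] /= -> -> ->.
Qed.

Definition loads : seq (nat * (nat * nat)) :=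
  [seq (a2, p) | a2 <- iota 0 (X %/ l ^ 2).+1,
     p <- [seq (a1, a0) | a1 <- iota 0 ((X - l ^ 2 * a2) %/ l).+1,
                          a0 <- iota 0 (X - l ^ 2 * a2 - l * a1).+1]].

Lemma mem_loads y : (y \in loads) = (load y <= X).
Proof.
have l2_gt0 : 0 < l ^ 2 by rewrite expn_gt0 l_gt0.
case: y => a2 [a1 a0]; apply/allpairsPdep/idP => [[a [p [aX pX [-> ->]]]]|].
  move: pX => /allpairsPdep[c [f [cX fX ->]]]; move: aX cX fX.
  rewrite !mem_iota !add0n /= !ltnS (leq_divRL _ _ l2_gt0) (leq_divRL _ _ l_gt0) /load /= => H1 H2 H3.
  by rewrite (mulnC a) in H1; rewrite (mulnC c) in H2; lia.
rewrite [load _]/(a0 + l * a1 + l ^ 2 * a2) => le_X; exists a2, (a1, a0); apply: And3 => //.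
  by rewrite mem_iota add0n ltnS (leq_divRL _ _ l2_gt0) mulnC; lia.
apply/allpairsPdep; exists a1, a0; apply: And3 => //; rewrite mem_iota add0n ltnS.
  by rewrite (leq_divRL _ _ l_gt0) mulnC; lia.
lia.
Qed.

Lemma uniq_loads : uniq loads.
Proof.
apply: allpairs_uniq_dep; rewrite ?iota_uniq //.
  by move=> a2 _; apply: allpairs_uniq_dep => [|a1 _|[a b] [c f] _ _ /= [-> ->]];
    rewrite ?iota_uniq.
by move=> [a b] [c f] _ _ /= [-> ->].
Qed.

Lemma size_loads : size loads =
  \sum_(0 <= a2 < (X %/ l ^ 2).+1) \sum_(0 <= a1 < ((X - l ^ 2 * a2) %/ l).+1)
     (X - l ^ 2 * a2 - l * a1).+1.
Proof.
rewrite size_allpairs_dep sumnE big_map /index_iota subn0; apply: eq_bigr => a2 _.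
rewrite size_allpairs_dep sumnE big_map subn0; apply: eq_bigr => a1 _.
by rewrite size_iota.
Qed.

Lemma arithmetic_sum k x : 2 * \sum_(0 <= j < k.+1) (k * l + x - l * j).+1 =
  k.+1 * (k * l + 2 * x + 2).
Proof.
rewrite big_nat_rev /= add0n.
rewrite (eq_big_nat _ _ (F2 := fun j => (j * l + x).+1)) => [|j /andP[_ jk]].
  elim: k => [|k IH]; first by rewrite big_nat1; lia.
  by rewrite big_nat_recr //= [LHS]mulnDr IH; ring.
by rewrite subSS (mulnC l) mulnBl; have : j * l <= k * l; [rewrite leq_mul2r; lia | lia].
Qed.

Lemma size_loads0 : X < l -> size loads = X.+1.
Proof.
move=> Xl; have Xl2 : X < l ^ 2 by rewrite -mulnn (leq_trans Xl) // leq_pmulr.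
rewrite size_loads (divn_small Xl2) big_nat1 muln0 !subn0 (divn_small Xl).
by rewrite big_nat1 muln0 subn0.
Qed.

Lemma size_loads1 x1 x0 : x1 < l -> x0 < l -> X = x1 * l + x0 ->
  2 * size loads = x1.+1 * (x1 * l + 2 * x0 + 2).
Proof.
move=> x1l x0l eX; have Xl2 : X < l ^ 2 by rewrite eX -mulnn; nia.
rewrite size_loads (divn_small Xl2) big_nat1 muln0 !subn0 eX divnMDl // (divn_small x0l) addn0.
exact: arithmetic_sum.
Qed.

Lemma size_loads2 x0 : x0 < l -> X = l ^ 2 + x0 ->
  2 * size loads = l.+1 * (l * l + 2 * x0 + 2) + 2 * x0.+1.
Proof.
move=> x0l eX; have l2_gt0 : 0 < l ^ 2 by rewrite expn_gt0 l_gt0.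
have x0l2 : x0 < l ^ 2 by rewrite -mulnn; nia.
rewrite size_loads eX divnDl ?dvdnn // divnn l2_gt0 (divn_small x0l2).
rewrite big_nat_recr //= big_nat1 muln0 !subn0 muln1 addKn (divn_small x0l).
rewrite big_nat1 muln0 subn0 mulnDr -mulnn divnMDl // (divn_small x0l) addn0.
by rewrite arithmetic_sum.
Qed.

Hypothesis X_small : d <= l -> X <= d * l.
Hypothesis X_mid : d = l.+1 -> X <= l ^ 2.
Hypothesis X_large : l.+1 < d -> X < l ^ 2 + l.

Lemma quotient_bound : X < l ^ 2 + l.
Proof.
case: (ltngtP d l.+1) => [|/X_large //|/X_mid]; last by lia.
by rewrite ltnS => dl; apply: leq_ltn_trans (X_small dl) _; rewrite -mulnn; nia.
Qed.

Lemma top_le1 y : load y <= X -> y.1 <= 1.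
Proof.
move=> yX; rewrite leqNgt; apply/negP => y1.
have := leq_ltn_trans yX quotient_bound; rewrite /load -mulnn.
have : l * l * 2 <= l * l * y.1 by rewrite leq_mul2l y1 orbT.
have : l * 2 <= l * l by rewrite leq_mul2l l_gt1 orbT.
lia.
Qed.

(** If the weights agree and the loads differ, the smaller load has to make up for
    at least [d] by its terms [z.2.1 + l.+1 * z.1], which pushes it beyond the
    bound.  If the loads agree too, the only possible exchange is [l.+1] parts
    [e * l] for one part [e * l ^ 2], again beyond the bound. *)
Lemma load_weight_inj y z : load y <= X -> load z <= X ->
  load_weight y = load_weight z -> y = z.
Proof.
have le_load y' z' : load y' <= X -> load z' <= X ->
    load_weight y' = load_weight z' -> load y' <= load z'.
  move=> yX zX ew; rewrite leqNgt; apply/negP => lt_load.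
  have z1 := top_le1 zX; have bound := leq_ltn_trans zX quotient_bound.
  have ge_d : load_weight y' >= d * (load z').+1 + y'.2.1 + l.+1 * y'.1.
    by rewrite /load_weight !leq_add2r leq_mul2l lt_load orbT.
  have {}ge_d : d <= z'.2.1 + l.+1 * z'.1.
    by move: ge_d; rewrite ew /load_weight mulnS; lia.
  case: (posnP z'.1) => [z0|z_gt0].
    have zd : d <= z'.2.1 by move: ge_d; rewrite z0; lia.
    have ld : l * d <= load z'.
      have : l * d <= l * z'.2.1 by rewrite leq_mul2l zd orbT.
      by rewrite /load; lia.
    have gtX : l * d < X by apply: leq_ltn_trans ld _; apply: leq_trans yX.
    case: (ltngtP d l.+1) => [|ld'|ed].
    - by rewrite ltnS => /X_small; rewrite mulnC leqNgt gtX.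
    - have := ltn_trans gtX (X_large ld'); rewrite -mulnn.
      have : l * l.+1 <= l * d by rewrite leq_mul2l (ltnW ld') orbT.
      by rewrite mulnS; lia.
    have := leq_trans gtX (X_mid ed); rewrite ed -mulnn mulnS; lia.
  have z11 : z'.1 = 1 by apply/eqP; rewrite eqn_leq z1.
  have l2 : l ^ 2 <= load z' by rewrite /load z11 muln1 leq_addl.
  have gtX : l ^ 2 < X by apply: leq_ltn_trans l2 _; apply: leq_trans yX.
  case: (ltngtP d l.+1) => [|ld'|/X_mid]; last by rewrite leqNgt gtX.
    rewrite ltnS => dl; have := X_small dl; rewrite leqNgt (leq_ltn_trans _ gtX) //.
    by rewrite -mulnn leq_mul2r dl orbT.
  have := leq_ltn_trans zX (X_large ld'); rewrite /load z11 muln1.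
  case: (posnP z'.2.1) => [z21|z21_gt0].
    by move: ge_d ld'; rewrite z21 z11; lia.
  have : l <= l * z'.2.1 by rewrite leq_pmulr.
  lia.
move=> yX zX ew; have eS : load y = load z.
  by apply/eqP; rewrite eqn_leq !le_load.
have e1 : y.2.1 + l.+1 * y.1 = z.2.1 + l.+1 * z.1.
  by apply/eqP; move/eqP: ew; rewrite /load_weight eS -!addnA eqn_add2l.
have y1 := top_le1 yX; have z1 := top_le1 zX.
have bound := quotient_bound.
have no_mix y' z' : load z' <= X -> y'.1 = 1 -> z'.1 = 0 ->
    y'.2.1 + l.+1 * y'.1 = z'.2.1 + l.+1 * z'.1 -> False.
  move=> z'X y'1 z'0; rewrite y'1 z'0 => e2.
  have : l * l.+1 <= load z'.
    rewrite /load z'0; apply: leq_trans (leq_addr _ _).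
    by apply: leq_trans (leq_addl _ _); rewrite leq_mul2l; apply/orP; right; lia.
  by rewrite mulnS mulnn; lia.
have e3 : y.1 = z.1.
  case: (posnP y.1) => y0; case: (posnP z.1) => z0; try lia.
    by case: (no_mix z y yX _ y0 (esym e1)); lia.
  by case: (no_mix y z zX _ z0 e1); lia.
have e4 : y.2.1 = z.2.1 by move: e1; rewrite e3; lia.
have e5 : y.2.2 = z.2.2 by move: eS; rewrite /load e3 e4; lia.
by case: y z e3 e4 e5 {yX zX ew eS e1 y1 z1} => [y1 [y2 y3]] [z1 [z2 z3]] /= -> -> ->.
Qed.

(** A special part [e * l ^ 3] would exceed [n], so only four sizes occur. *)
Lemma normal_parts b : is_composition n b -> sorted leq b ->
  (forall x, x \in b -> special x) -> exists2 y, load y <= X & b = parts y.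
Proof.
case/andP => b_pos /eqP b_sum b_ord bs; have [e1 el el2] := sizes_increasing.
have kinds x : x \in b -> x \in [:: 1; e; e * l; e * l ^ 2].
  move=> xb; have xn : x <= n.
    rewrite -b_sum; elim: (b) xb => // z s IH; rewrite inE => /orP[/eqP->|/IH] /=; first exact: leq_addr.
    by move/leq_trans; apply; apply: leq_addl.
  case: (bs x xb) => [->|[i ex]]; first by rewrite inE.
  have : l ^ i <= X by rewrite leq_divRL // mulnC -ex.
  move=> li; have : l ^ i < l ^ 3.
    apply: leq_ltn_trans li _; apply: leq_trans quotient_bound _.
    by rewrite (expnS l 2) -mulnn; nia.
  rewrite ltn_exp2l // ex; case: i {li ex} => [|[|[|i]]] // _.
  - by rewrite muln1 !inE eqxx orbT.
  - by rewrite expn1 !inE eqxx !orbT.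
  by rewrite !inE eqxx !orbT.
pose y := (count_mem (e * l ^ 2) b, (count_mem (e * l) b, count_mem e b)).
pose b' := nseq (count_mem 1 b) 1 ++ nseq y.2.2 e ++ nseq y.2.1 (e * l) ++ nseq y.1 (e * l ^ 2).
have b'_kinds x : x \in b' -> x \in [:: 1; e; e * l; e * l ^ 2].
  by rewrite /b' !mem_cat !mem_nseq !inE => /or4P[] /andP[_ ->]; rewrite ?orbT.
have perm_b : perm_eq b b'.
  rewrite /perm_eq; apply/allP => x; rewrite mem_cat => xD.
  have {xD} : x \in [:: 1; e; e * l; e * l ^ 2] by case/orP: xD => [/kinds|/b'_kinds].
  rewrite /b' !inE /= !count_cat !count_nseq /= => /or4P[] /eqP->.
  - by rewrite !(gtn_eqF e1, gtn_eqF (ltn_trans e1 el), gtn_eqF (ltn_trans e1 (ltn_trans el el2))) !eqxx; lia.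
  - by rewrite !(ltn_eqF e1, gtn_eqF el, gtn_eqF (ltn_trans el el2)) !eqxx /=; lia.
  - by rewrite !(ltn_eqF (ltn_trans e1 el), ltn_eqF el, gtn_eqF el2) !eqxx /=; lia.
  by rewrite !(ltn_eqF (ltn_trans e1 (ltn_trans el el2)), ltn_eqF (ltn_trans el el2), ltn_eqF el2) !eqxx /=; lia.
have sum_b : count_mem 1 b + e * load y = n.
  rewrite -b_sum (perm_sumn perm_b) /b' !sumn_cat !sumn_nseq mul1n; congr (_ + _).
  by rewrite /load; ring.
have yX : load y <= X by rewrite load_le -sum_b leq_addl.
exists y => //; apply: (sorted_eq leq_trans anti_leq b_ord (parts_sorted y)).
rewrite (permPl perm_b) /b' /parts; have -> // : n - e * load y = count_mem 1 b.
by rewrite -sum_b addnK.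
Qed.

End Partitions.

(** * Counting the values of the index *)

Section Counting.
Variables (N : nat) (F : finFieldType) (l e : nat).
Local Notation n := N.+1.
Local Notation q := #|F|.
Local Notation G := (GLg N F).
Local Notation d := (logn l (gsum q e)).
Local Notation std a := (block_group_group N F (reshape_index a)).
Local Notation index_val := (index_val N F l).
Implicit Types (a b : seq nat) (y z : nat * (nat * nat)).

Hypothesis l_pr : prime l.
Hypothesis lq : ~~ (l %| q)%N.
Hypothesis e_ge2 : (2 <= e)%N.
Hypothesis le : (l %| gsum q e)%N.
Hypothesis e_min : forall i, (2 <= i)%N -> (l %| gsum q i)%N -> (e <= i)%N.
Hypothesis X_small : (d <= l -> n %/ e <= d * l)%N.
Hypothesis X_mid : d = l.+1 -> (n %/ e <= l ^ 2)%N.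
Hypothesis X_large : (l.+1 < d -> n %/ e < l ^ 2 + l)%N.

Lemma std_standard a : std a \in standard_parabolics n F.
Proof. by rewrite inE; apply: borel_block_group => i j; apply: reshape_index_mono. Qed.

(** The transvections below the diagonal recover the set of inner positions. *)
Lemma tv_block_group a (k k' : 'I_n) : k' = k.+1 :> nat ->
  (tv k' k (1%R : F) \in std a) = (reshape_index a k == reshape_index a k.+1).
Proof.
move=> kk'; have k'k : k' != k by rewrite -val_eqE gtn_eqF //= kk'.
have le_r : (reshape_index a k <= reshape_index a k')%N.
  by rewrite reshape_index_mono // kk'.
apply/block_groupP/eqP => [tvP|eq_r i j ji].
  apply/eqP; rewrite -kk' eqn_leq le_r leqNgt; apply/negP => /tvP/eqP.
  by rewrite mat_tv // !mxE (negPf k'k) !eqxx mulr1 add0r oner_eq0.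
rewrite mat_tv // !mxE; have [eij|_] := eqVneq i j; first by rewrite eij ltnn in ji.
have [ei|] := eqVneq i k'; last by rewrite mulr0 addr0.
have [ej|] := eqVneq j k; last by rewrite mulr0 addr0.
by rewrite ei ej eq_r -kk' ltnn in ji.
Qed.

Lemma std_inj a b : is_composition n a -> is_composition n b -> std a = std b -> a = b.
Proof.
case/andP => a_pos /eqP a_sum /andP[b_pos /eqP b_sum] eq_std.
apply: inner_inj => //; first by rewrite a_sum.
move=> k; rewrite /inner a_sum b_sum => kn; rewrite kn /=.
have kk' : Ordinal kn = (Ordinal (ltnW kn)).+1 :> nat by [].
by rewrite -!(tv_block_group _ kk') eq_std.
Qed.

(** This is where the bounds on [n] enter: the valuation gives the total weight,
    which determines a normal composition. *)
Lemma sorted_special_inj a b : is_composition n a -> is_composition n b ->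
    sorted leq a -> sorted leq b ->
    (forall x, x \in a -> special l e x) -> (forall x, x \in b -> special l e x) ->
  index_val a = index_val b -> a = b.
Proof.
move=> an bn a_ord b_ord a_sp b_sp eq_val.
have [y yX ay] := normal_parts l_pr e_ge2 X_small X_mid X_large an a_ord a_sp.
have [z zX bz] := normal_parts l_pr e_ge2 X_small X_mid X_large bn b_ord b_sp.
have := logn_index l_pr lq e_ge2 le e_min bn.
rewrite -(logn_index l_pr lq e_ge2 le e_min an) -/(index_val a) -/(index_val b).
rewrite eq_val => /addnI; rewrite ay bz !parts_weight // => /esym eq_w.
by rewrite (load_weight_inj l_pr e_ge2 X_small X_mid X_large yX zX eq_w).
Qed.

Lemma normal_form a : is_composition n a -> exists b,
  [/\ is_composition n b, sorted leq b, forall x, x \in b -> special l e x,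
      merge_equiv q l e a b & index_val b = index_val a].
Proof.
move=> an; have /andP[a_pos /eqP a_sum] := an.
have [b [b_ord b_sp ab]] := merge_equiv_normal q l_pr e_ge2 a_pos.
have [eq_sum eq_pos eq_w] := merge_equiv_sum ab.
have bn : is_composition n b by rewrite /is_composition -eq_pos -eq_sum a_pos a_sum eqxx.
exists b; split=> //; apply/eqP.
have := logn_index l_pr lq e_ge2 le e_min bn.
by rewrite -(logn_index l_pr lq e_ge2 le e_min an) eq_w => /addIn/eqP.
Qed.

Lemma index_val_merge_equiv a b : is_composition n a -> is_composition n b ->
  index_val a = index_val b -> merge_equiv q l e a b.
Proof.
move=> an bn eq_val; have [a' [a'n a'_ord a'_sp aa' va']] := normal_form an.
have [b' [b'n b'_ord b'_sp bb' vb']] := normal_form bn.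
have eq_ab : a' = b' by apply: sorted_special_inj; rewrite // va' vb'.
by apply: merge_trans aa' _; rewrite eq_ab; apply: merge_sym.
Qed.

Let index_parts y := index_val (parts l e n y).

Lemma index_parts_inj : {in loads l e n &, injective index_parts}.
Proof.
move=> y z; rewrite !mem_loads // => yX zX eq_val.
apply: (parts_inj (n := n) l_pr e_ge2); apply: sorted_special_inj eq_val;
  by [apply: parts_composition | apply: parts_sorted | apply: parts_special].
Qed.

Lemma index_val_parts a : is_composition n a ->
  exists2 y, y \in loads l e n & index_val a = index_parts y.
Proof.
move=> an; have [b [bn b_ord b_sp _ vb]] := normal_form an.
have [y yX by_] := normal_parts l_pr e_ge2 X_small X_mid X_large bn b_ord b_sp.
by exists y; rewrite ?mem_loads // /index_parts -by_.
Qed.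

Definition index_values :=
  undup [seq logn l #|[set: G] : P|%g | P : {group G} in standard_parabolics n F].

Lemma mem_index_values v :
  reflect (exists2 a, is_composition n a & index_val a = v) (v \in index_values).
Proof.
rewrite mem_undup; apply: (iffP idP) => [/imageP[P + ->]|[a an <-]].
  rewrite inE => BP; have [a an eP] := parabolic_classification BP.
  by exists a; rewrite // /index_val -eP.
by apply/imageP; exists (std a); first exact: std_standard.
Qed.

Lemma size_index_values : size index_values = size (loads l e n).
Proof.
rewrite -(size_map index_parts); apply/perm_size/uniq_perm.
- exact: undup_uniq.
- by rewrite map_inj_in_uniq ?uniq_loads //; apply: index_parts_inj.
move=> v; apply/mem_index_values/mapP => [[a an <-]|[y yX ->]].
  by have [y yX ->] := index_val_parts an; exists y.
by exists (parts l e n y) => //; apply: parts_composition; rewrite // -mem_loads.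
Qed.

Lemma card_special_parabolics : #|special_parabolics n F e l| = size (loads l e n).
Proof.
pose P y : {group G} := std (parts l e n y).
have P_uniq : uniq (map P (loads l e n)).
  rewrite map_inj_in_uniq ?uniq_loads // => y z; rewrite !mem_loads // => yX zX eqP.
  by apply: (parts_inj (n := n) l_pr e_ge2); apply: std_inj eqP; apply: parts_composition.
rewrite -(size_map P) -(card_uniqP P_uniq); apply: eq_card => Q.
rewrite inE; apply/andP/mapP => [[_ /asboolP[a [an eQ a_ord a_sp]]]|[y]].
  have [y yX ay] := normal_parts l_pr e_ge2 X_small X_mid X_large an a_ord a_sp.
  by exists y; rewrite ?mem_loads //; apply/val_inj; rewrite /= eQ ay.
rewrite mem_loads // => yX ->; split; first exact: std_standard.
apply/asboolP; exists (parts l e n y); split=> //; first exact: parts_composition.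
  exact: parts_sorted.
by move=> x; apply: parts_special.
Qed.

End Counting.

Theorem theorem8p5 (n : nat) (F : finFieldType) (q p l : nat)
    (R : idomainType) (e : nat)
    (hn : (2 <= n)%N) (hq : #|F| = q) (hp : p \in [pchar F])
    (hl : prime l) (hlp : l <> p)
    (hPID : principal_ideal_domain R)
    (hlocal : local_with_maximal_ideal (multiples l R))
    (hchar : [pchar R] =i pred0)
    (hroot : exists z : R, p.-primitive_root z)
    (he : is_min_nat (fun i => (2 <= i)%N /\ (l %| (q ^ i - 1) %/ (q - 1))%N) e) :
  let L := reduction l (steinberg_lattice n F R) in
  let V := num_index_valuations n F l in
  let Pstar := special_parabolics n F e l in
  let d := logn l ((q ^ e - 1) %/ (q - 1))%N in
  let m := trunc_log l (n %/ e)%N in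
  ((d <= l)%N -> (n %/ e <= d * l)%N) ->
  (d = l.+1 -> (n %/ e <= l ^ 2)%N) ->
  ((l.+1 < d)%N -> (n %/ e < l ^ 2 + l)%N) ->
  [/\ m = 0%N ->
        [/\ has_composition_length L V, V = #|Pstar| & #|Pstar| = (n %/ e + 1)%N],
      m = 1%N -> forall x1 x0 : nat, (x1 < l)%N -> (x0 < l)%N ->
        (n %/ e = x1 * l + x0)%N ->
        [/\ has_composition_length L V, V = #|Pstar|
          & #|Pstar|%:R = (x1%:R + 1) * (x1%:R / 2 * l%:R + x0%:R + 1) :> rat]
    & m = 2%N -> forall x0 : nat, (x0 < l)%N -> (n %/ e = l ^ 2 + x0)%N ->
        [/\ has_composition_length L V, V = #|Pstar|
          & #|Pstar|%:R = 1 / 2 * l%:R ^+ 3 + 1 / 2 * l%:R ^+ 2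
                          + (x0%:R + 1) * l%:R + 2 * (x0%:R + 1) :> rat]].
Proof.
case: n hn => [//|N] hn; rewrite -{}hq in he *.
move=> L V Pstar d m X_small X_mid X_large.
have q_gt1 := card_finNzRing_gt1 F.
have [[e_ge2 le] e_min'] := he; rewrite gsumE // in le.
have e_min i : (2 <= i)%N -> (l %| gsum #|F| i)%N -> (e <= i)%N.
  by move=> i2 li; apply: e_min'; rewrite gsumE.
have lq := prime_not_dvd_card hp hl hlp.
have [z z_root] := hroot; have [psi [psiD psi0 psi_nt]] := additive_character hp z_root.
rewrite /d gsumE // in X_small X_mid X_large.
have V_size : V = size (loads l e N.+1).
  exact: (size_index_values hl lq e_ge2 le e_min X_small X_mid X_large).
have P_size : #|Pstar| = size (loads l e N.+1).
  exact: (card_special_parabolics hl e_ge2 X_small X_mid X_large).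
have VP : V = #|Pstar| by rewrite P_size.
have cL : has_composition_length L V.
  pose vs := sort geq (index_values N F l).
  have -> : V = size vs by rewrite size_sort.
  apply: (chain_length psiD psi0 psi_nt hl lq e_ge2 le e_min hlocal hchar).
  - by move=> s s'; apply: index_val_merge_equiv.
  - by rewrite gtn_sorted_uniq_geq sort_uniq undup_uniq sort_sorted // => x y; apply: leq_total.
  - by move=> s sn; rewrite mem_sort; apply/mem_index_values; exists s.
  by move=> v; rewrite mem_sort => /mem_index_values.
have half k x : (2 * k = x)%N -> k%:R = x%:R / 2 :> rat.
  by move=> <-; rewrite natrM mulrC mulKf.
split=> [m0|m1 x1 x0 x1l x0l eX|m2 x0 x0l eX]; split=> //; rewrite P_size.
- rewrite size_loads0 ?addn1 //; have := trunc_log_ltn (N.+1 %/ e) (prime_gt1 hl).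
  by rewrite -/m m0 expn1.
- rewrite (half _ _ (size_loads1 hl e_ge2 x1l x0l eX)) natrM !natrD !natrM -addn1 natrD.
  by field.
rewrite (half _ _ (size_loads2 hl e_ge2 x0l eX)) -[l.+1]addn1 -[x0.+1]addn1.
rewrite !(natrD, natrM).
by field.
Qed.
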